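(* Let $G=\mathbb{R}^{2n+m}$ be an H-type group with sublaplacian $L$ and heat kernel $$p_t(x,z)=\frac1{(2\pi)^m}\int_{\mathbb{R}^m}e^{i\langle\lambda,z\rangle-\frac14|\lambda|\coth(t|\lambda|)|x|^2}\Big(\frac{|\lambda|}{4\pi\sinh(t|\lambda|)}\Big)^n d\lambda,\qquad t>0.$$ Then: 1. $(t,x,z)\mapsto p_t(x,z)$ is in $C^\infty((0,\infty)\times\mathbb{R}^{2n+m})$, and $p_t$ is a Schwartz function on $\mathbb{R}^{2n+m}$ for each $t>0$. 2. $(L-\frac{\partial}{\partial t})p_t=0$. 3. $\int_G p_t(x,z)\,dx\,dz=1$ for all $t>0$ (integration with respect to Lebesgue measure). 4. For $\alpha>0$, $p_t(x,z)=\alpha^{2(n+m)}p_{\alpha^2t}(\varphi_\alpha(x,z))$. In particular, $\lim_{t\to0}p_t(x,z)=0$ for all $(x,z)\ne0$. 5. $p_t$ is a radial function, as is $\frac{\partial}{\partial t}p_t=Lp_t$. In particular, $p_t(g^{-1})=p_t(g)$ and $Lp_t(g^{-1})=Lp_t(g)$ for all $g\in G$. 6. $p_t$ vanishes uniformly at infinity: for any $\epsilon>0$ there exists a compact set $K\subset G$ such that $\sup_{t>0,\ g\in G\setminus K}|p_t(g)|<\epsilon$.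
   Context: H-type groups. A finite-dimensional real Lie algebra $\mathfrak g$ with center $\mathfrak z$ is an H-type Lie algebra under an inner product $\langle\cdot,\cdot\rangle$ if $[\mathfrak z^\perp,\mathfrak z^\perp]=\mathfrak z$ and, for each $z\in\mathfrak z$ with $|z|=1$, the map $J_z:\mathfrak z^\perp\to\mathfrak z^\perp$ defined by $\langle J_z x,y\rangle=\langle z,[x,y]\rangle$ is orthogonal. An H-type group is a connected, simply connected Lie group whose Lie algebra is H-type. Every such group is realized as $G=\mathbb{R}^{2n+m}$ ($n,m\ge1$), with elements $g=(x,z)$, $x\in\mathbb{R}^{2n}$, $z\in\mathbb{R}^m$, where $(\mathbb{R}^{2n+m},[\cdot,\cdot])$ is an H-type Lie algebra under the Euclidean inner product with center $\{0\}\times\mathbb{R}^m$, the bracket is regarded as a map $\mathbb{R}^{2n}\times\mathbb{R}^{2n}\to\mathbb{R}^m$, and the group law is $(x,z)\star(x',z')=(x+x',\,z+z'+\frac12[x,x'])$, so the identity is $0$ and $(x,z)^{-1}=(-x,-z)$. Let $\{e_i\}$, $\{u_j\}$ be the standard bases of $\mathbb{R}^{2n}$, $\mathbb{R}^m$, let $X_i=\frac{\partial}{\partial x_i}+\frac12\sum_{j=1}^m\langle J_{u_j}x,e_i\rangle\frac{\partial}{\partial z_j}$, $i=1,\dots,2n$, and $L=\sum_{i=1}^{2n}X_i^2$. The dilation is $\varphi_\alpha(x,z)=(\alpha x,\alpha^2z)$, $\alpha>0$. A function on $G$ is radial if its value at $(x,z)$ depends only on $|x|$ and $|z|$. *)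

(* Defs.v *)
From HB Require Import structures.
From mathcomp Require Import all_boot all_order all_algebra.
From mathcomp Require Import all_classical all_reals all_analysis.
From mathcomp Require Import complex.

Set Implicit Arguments.
Unset Strict Implicit.
Unset Printing Implicit Defensive.
Import Order.TTheory GRing.Theory Num.Theory.
Import numFieldNormedType.Exports.
Local Open Scope classical_set_scope.
Local Open Scope ring_scope.

Section tuple_cons.
Context {R : realType} (d : nat).

Definition tuple_cons (v : R * d.-tuple R) : d.+1.-tuple R :=
  [tuple of v.1 :: v.2].

Definition tuple_uncons (v : d.+1.-tuple R) : R * d.-tuple R :=
  (thead v, [tuple of behead v]).

Lemma measurable_tuple_cons : measurable_fun setT tuple_cons.
Proof. exact: measurable_cons. Qed.

Lemma measurable_tuple_uncons : measurable_fun setT tuple_uncons.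
Proof.
apply: measurable_fun_pair; first exact: measurable_tnth.
exact: measurable_behead.
Qed.

Lemma tuple_consK : cancel tuple_cons tuple_uncons.
Proof. by move=> [x v]; congr (_, _); exact: val_inj. Qed.

Variable mu : {sigma_finite_measure set (d.-tuple R) -> \bar R}.

Definition leb_cons : set (d.+1.-tuple R) -> \bar R :=
  pushforward (lebesgue_measure \x mu)%E tuple_cons.

Let leb_cons0 : leb_cons set0 = 0%E.
Proof. by rewrite /leb_cons /pushforward preimage_set0 measure0. Qed.

Let leb_cons_ge0 A : (0 <= leb_cons A)%E.
Proof. by rewrite /leb_cons /pushforward; exact: measure_ge0. Qed.

Let leb_cons_sigma_additive : semi_sigma_additive leb_cons.
Proof.
have mpre A : measurable A -> measurable (tuple_cons @^-1` A).
  by move=> mA; rewrite -[X in measurable X]setTI; exact: measurable_tuple_cons.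
move=> F mF tF mUF; rewrite /leb_cons /pushforward preimage_bigcup.
apply: measure_semi_sigma_additive.
- by move=> n; exact: mpre.
- apply/trivIsetP => /= i j _ _ ij; rewrite -preimage_setI.
  by move/trivIsetP : tF => /(_ _ _ _ _ ij) ->//; rewrite preimage_set0.
- by rewrite -preimage_bigcup; exact: mpre.
Qed.

HB.instance Definition _ := isMeasure.Build _ _ _ leb_cons
  leb_cons0 leb_cons_ge0 leb_cons_sigma_additive.

Let leb_cons_sigma_finite : sigma_finite setT leb_cons.
Proof.
have /sigma_finiteP[F [TF ndF Foo]] := sigma_finiteT (@lebesgue_measure R).
have /sigma_finiteP[G [TG ndG Goo]] := sigma_finiteT mu.
exists (fun i => tuple_uncons @^-1` (F i `*` G i)).
  rewrite -preimage_bigcup -[LHS](preimage_setT tuple_uncons).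
  congr (_ @^-1` _); rewrite -setXTT TF TG predeqE => -[x y]; split.
    move=> [/= [i _ Fix] [k _ Gky]]; exists (maxn i k) => //; split.
    - by move: x Fix; exact/subsetPset/ndF/leq_maxl.
    - by move: y Gky; exact/subsetPset/ndG/leq_maxr.
  by move=> [i _ []/= ? ?]; split; exists i.
move=> i; have [mF Fioo] := Foo i; have [mG Gioo] := Goo i; split.
  rewrite -[X in measurable X]setTI; apply: measurable_tuple_uncons => //.
  exact: measurableX.
rewrite /leb_cons /pushforward -comp_preimage (_ : _ \o _ = id); last first.
  by apply/funext => v; exact: tuple_consK.
by rewrite preimage_id product_measure1E// lte_mul_pinfty// ge0_fin_numE.
Qed.

HB.instance Definition _ := Measure_isSigmaFinite.Build _ _ _ leb_cons
  leb_cons_sigma_finite.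

End tuple_cons.

Section lebesgue_tuple.
Context {R : realType}.

(* Lebesgue measure on R^d, carried by the Borel sets of d.-tuple R. *)
Fixpoint lebesgue_tuple d : set (d.-tuple R) -> \bar R :=
  match d with
  | 0 => \d_([tuple] : 0.-tuple R)
  | d'.+1 => pushforward (lebesgue_measure \x @lebesgue_tuple d')%E
               (@tuple_cons R d')
  end.

Lemma lebesgue_tuple_bundle d :
  exists mu : {sigma_finite_measure set (d.-tuple R) -> \bar R},
    mu = @lebesgue_tuple d :> (_ -> _).
Proof.
elim: d => [|d [mu /= <-]]; first by exists (\d_([tuple] : 0.-tuple R)).
by exists (leb_cons mu).
Qed.

Variable d : nat.

Let lebesgue_tuple0 : @lebesgue_tuple d set0 = 0%E.
Proof. by have [mu <-] := lebesgue_tuple_bundle d; exact: measure0. Qed.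

Let lebesgue_tuple_ge0 A : (0 <= @lebesgue_tuple d A)%E.
Proof. by have [mu <-] := lebesgue_tuple_bundle d; exact: measure_ge0. Qed.

Let lebesgue_tuple_sigma_additive : semi_sigma_additive (@lebesgue_tuple d).
Proof.
have [mu <-] := lebesgue_tuple_bundle d.
exact: measure_semi_sigma_additive.
Qed.

HB.instance Definition _ := isMeasure.Build _ _ _ (@lebesgue_tuple d)
  lebesgue_tuple0 lebesgue_tuple_ge0 lebesgue_tuple_sigma_additive.

Let lebesgue_tuple_sigma_finite : sigma_finite setT (@lebesgue_tuple d).
Proof. by have [mu <-] := lebesgue_tuple_bundle d; exact: sigma_finiteT. Qed.

HB.instance Definition _ := Measure_isSigmaFinite.Build _ _ _
  (@lebesgue_tuple d) lebesgue_tuple_sigma_finite.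

End lebesgue_tuple.
Arguments lebesgue_tuple {R} d _ : simpl never.

Section euclidean_space.
Context {R : realType} {d : nat}.
Implicit Types (u v x z : 'rV[R]_d) (f : 'rV[R]_d -> R) (U A B : set 'rV[R]_d).

Definition dotv u v : R := \sum_i u 0 i * v 0 i.

(* The library norm `|v| on row vectors is the sup norm. *)
Definition enorm v : R := Num.sqrt (dotv v v).

Definition orthoc A : set 'rV[R]_d := [set x | forall z, A z -> dotv x z = 0].

Definition rV_of_tuple (t : d.-tuple R) : 'rV[R]_d := \row_i tnth t i.

Definition partial (i : 'I_d) f : 'rV[R]_d -> R := 'D_(delta_mx 0 i) f.

Definition partials (s : seq 'I_d) f : 'rV[R]_d -> R := foldr partial f s.

(* f is C^oo on U, for U open: the partial derivatives of all orders exist and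
   are continuous at each point of U.  As U is open, the values that 'D takes
   outside of U are irrelevant. *)
Definition smooth_on U f := forall (s : seq 'I_d) (x : 'rV[R]_d), U x ->
  {for x, continuous (partials s f)} /\
  forall i : 'I_d, derivable (partials s f) x (delta_mx 0 i).

Definition schwartz f := smooth_on setT f /\
  forall (a : 'I_d -> nat) (s : seq 'I_d), exists C : R,
    forall x : 'rV[R]_d, `|(\prod_i x 0 i ^+ a i) * partials s f x| <= C.

End euclidean_space.

Section Htype_algebra.
Context {R : realType} {d : nat}.
Variable br : {bilinear 'rV[R]_d -> 'rV[R]_d -> 'rV[R]_d}.

Definition is_lie_bracket :=
  (forall x, br x x = 0) /\
  (forall x y z, br x (br y z) + br y (br z x) + br z (br x y) = 0).

Definition lie_center : set 'rV[R]_d := [set z | forall x, br z x = 0].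

(* [A, B]: the linear span of the brackets of elements of A and B. *)
Definition lie_span (A B : set 'rV[R]_d) : set 'rV[R]_d :=
  [set v | exists (k : nat) (c : 'I_k -> R) (a b : 'I_k -> 'rV[R]_d),
    [/\ forall i, A (a i), forall i, B (b i) &
        v = \sum_i c i *: br (a i) (b i)]].

(* <J_z x, y> = <z, [x, y]>, read off on the standard basis; see Jmap_dotv. *)
Definition Jmap (z x : 'rV[R]_d) : 'rV[R]_d :=
  \row_i dotv z (br x (delta_mx 0 i)).

Definition is_Htype :=
  [/\ is_lie_bracket,
      lie_span (orthoc lie_center) (orthoc lie_center) = lie_center &
      forall z, lie_center z -> enorm z = 1 ->
        forall x y, orthoc lie_center x -> orthoc lie_center y ->
          dotv (Jmap z x) (Jmap z y) = dotv x y].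

Lemma dotvC (u v : 'rV[R]_d) : dotv u v = dotv v u.
Proof. by apply: eq_bigr => i _; rewrite mulrC. Qed.

Lemma Jmap_dotv (z x y : 'rV[R]_d) : dotv (Jmap z x) y = dotv z (br x y).
Proof.
rewrite {2}(row_sum_delta y) linear_sumr /dotv /=.
under eq_bigr do rewrite mxE /dotv mulr_suml.
rewrite exchange_big /=; apply: eq_bigr => j _.
rewrite summxE mulr_sumr; apply: eq_bigr => i _.
by rewrite linearZr_LR /= !mxE mulrCA mulrC mulrA.
Qed.

Lemma Jmap_orthoc (z x : 'rV[R]_d) :
  is_lie_bracket -> orthoc lie_center (Jmap z x).
Proof.
move=> [alt _] y cy; rewrite Jmap_dotv.
have /eqP := alt (x + y).
rewrite linearDl !linearDr /= !alt add0r addr0 cy addr0 => /eqP ->.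
by rewrite /dotv big1// => i _; rewrite mxE mulr0.
Qed.

End Htype_algebra.

Section Htype_group.
Context {R : realType} {n m : nat}.
Local Notation G := 'rV[R]_(n.*2 + m).
Implicit Types (g : G) (f : G -> R).

Definition xpart g : 'rV[R]_(n.*2) := lsubmx g.
Definition zpart g : 'rV[R]_m := rsubmx g.

Variable br : {bilinear G -> G -> G}.

(* R^(2n+m) is an H-type Lie algebra for the Euclidean inner product, with
   center {0} x R^m. *)
Definition is_Htype_realization :=
  is_Htype br /\ lie_center br = [set g | xpart g = 0].

Definition hmul g g' : G :=
  row_mx (xpart g + xpart g')
    (zpart g + zpart g' +
     2^-1 *: zpart (br (row_mx (xpart g) 0) (row_mx (xpart g') 0))).

Definition hinv g : G := row_mx (- xpart g) (- zpart g).

Lemma hmulgV g : is_lie_bracket br -> hmul g (hinv g) = 0.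
Proof.
move=> [alt _]; rewrite /hmul /hinv /xpart /zpart row_mxKl row_mxKr.
rewrite -[X in row_mx (- _) X]oppr0 -opp_row_mx linearNr /= alt.
by rewrite oppr0 linear0 scaler0 !subrr addr0 row_mx0.
Qed.

Definition dil (a : R) g : G := row_mx (a *: xpart g) (a ^+ 2 *: zpart g).

Definition Xfield (i : 'I_(n.*2)) f : G -> R := fun g =>
  'D_(delta_mx 0 (lshift m i)) f g +
  2^-1 * \sum_(j < m)
    dotv (Jmap br (delta_mx 0 (rshift n.*2 j)) (row_mx (xpart g) 0))
         (delta_mx 0 (lshift m i)) *
    'D_(delta_mx 0 (rshift n.*2 j)) f g.

Definition sublaplacian f : G -> R := fun g =>
  \sum_(i < n.*2) Xfield i (Xfield i f) g.

Definition radial f := forall g g',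
  enorm (xpart g) = enorm (xpart g') -> enorm (zpart g) = enorm (zpart g') ->
  f g = f g'.

End Htype_group.

Section heat_kernel.
Context {R : realType}.

Definition sinh (x : R) : R := (expR x - expR (- x)) / 2.
Definition cosh (x : R) : R := (expR x + expR (- x)) / 2.
Definition coth (x : R) : R := cosh x / sinh x.

Definition cexp (w : R[i]) : R[i] :=
  ((expR (complex.Re w) * cos (complex.Im w)) +i*
   (expR (complex.Re w) * sin (complex.Im w)))%C.

Context {n m : nat}.
Local Notation G := 'rV[R]_(n.*2 + m).

Definition cintegrable (f : 'rV[R]_m -> R[i]) :=
  (lebesgue_tuple m).-integrable setT
    (fun l => (complex.Re (f (rV_of_tuple l)))%:E) /\
  (lebesgue_tuple m).-integrable setT
    (fun l => (complex.Im (f (rV_of_tuple l)))%:E).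

Definition cintegral (f : 'rV[R]_m -> R[i]) : R[i] :=
  ((\int[lebesgue_tuple m]_l complex.Re (f (rV_of_tuple l))) +i*
   (\int[lebesgue_tuple m]_l complex.Im (f (rV_of_tuple l))))%C.

(* At l = 0, a null set, division by sinh 0 = 0 yields an irrelevant value. *)
Definition heat_integrand (t : R) (g : G) (l : 'rV[R]_m) : R[i] :=
  cexp ((- (4^-1 * enorm l * coth (t * enorm l) * enorm (xpart g) ^+ 2)) +i*
        dotv l (zpart g))%C *
  (((enorm l / (4 * pi * sinh (t * enorm l))) ^+ n)%:C)%C.

Definition heat_kernelC (t : R) (g : G) : R[i] :=
  (((2 * pi) ^- m)%:C)%C * cintegral (heat_integrand t g).

Definition heat_kernel (t : R) (g : G) : R := complex.Re (heat_kernelC t g).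

End heat_kernel.

(* Main.v *)
Require Import Defs.
From HB Require Import structures.
From mathcomp Require Import all_boot all_order all_algebra.
From mathcomp Require Import all_classical all_reals all_analysis.
From mathcomp Require Import complex.
From mathcomp Require Import measurable_realfun ring lra.

Set Implicit Arguments.
Unset Strict Implicit.
Unset Printing Implicit Defensive.
Import Order.TTheory GRing.Theory Num.Theory.
Import numFieldNormedType.Exports.
Local Open Scope classical_set_scope.
Local Open Scope ring_scope.

(* With s = t^2 |l|^2, the integrand of the kernel is cos <l, z> times the
   weight exp (- (Q_0 s) |x|^2 / (4 t)) (4 pi t E_1 s)^-n, where
   E_0 s = cosh (sqrt s), E_1 s = sinh (sqrt s) / sqrt s and Q_0 = E_0 / E_1 are
   smooth in l.  All its derivatives are the weight times trigonometric
   functions and polynomials in t, 1/t, x, l, Q_0, Q_1, ...; they are dominated,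
   locally uniformly in t, by an integrable function of l, so one may
   differentiate under the integral.  Multiplication by z_j is, after integration
   by parts, a derivative in l_j, so the class of such integrals is stable under
   derivatives and multiplication by coordinates: its members are bounded,
   whence smoothness, the Schwartz property, and the decay estimates.
   The heat equation holds under the integral, pointwise in l, because
   |J_l x| = |l| |x| and <J_l x, x> = 0.
   Radiality in z: the rotation generators of the plane of z and w annihilate the
   kernel, again by integration by parts.  Integrating over z gives, by Fourier
   inversion, (2 pi)^m times the weight at l = 0, which is a Gaussian in x.
   The limit t -> 0 and the uniform decay come from the scaling identity and the
   bounds on p_1. *)

(** The formula is singular at l = 0: |l| is not smooth there and sinh (t |l|) vanishes. Passing to
    entire functions of s = t^2 |l|^2 removes this, and the integrand so obtained differs from the
    original one on the null set {0} only. Decay in l comes from E_1^-n alone; one factor 1/E_1,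
    hence n >= 1, already beats every power of |l|, because each term of the positive power series
    of E_1 bounds it from below. Symbols form a syntactic type, so that closure under derivatives
    and growth bounds are inductions; an integrand is a pair of symbols, the coefficients of cosine
    and sine, which derivatives in z and l mix. Apart from rotations of z, differentiation runs
    along affine lines, which leaves one-variable calculus. The only substitutions made in l are
    translations and scalar multiples; this is why radiality in z is proved infinitesimally. In the
    total mass the double integral over l and z is not absolutely convergent, so an Abel factor is
    inserted before the exchange and removed by dominated convergence. *)

(** * Tonelli and affine substitutions on R^d *)

Section lebesgue_tuple_integral.
Context {R : realType}.
Notation leb := (@lebesgue_measure R).

Lemma ge0_integral_tupleS d (F : d.+1.-tuple R -> \bar R) :
  measurable_fun setT F -> (forall v, 0 <= F v)%E ->
  (\int[lebesgue_tuple d.+1]_v F v =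
   \int[leb]_x \int[lebesgue_tuple d]_t F (tuple_cons (x, t)))%E.
Proof.
move=> mF F0.
have mc : measurable_fun [set: measurableTypeR R * d.-tuple R]
    (@tuple_cons R d) by exact: measurable_tuple_cons.
rewrite -(@fubini_tonelli1 _ _ _ _ _ leb (lebesgue_tuple d)
  (F \o @tuple_cons R d))//=; last exact: measurableT_comp.
have := @ge0_integral_pushforward _ _ _ _ R _ mc (leb \x lebesgue_tuple d)%E
  setT F measurableT mF (fun y _ => F0 y).
by rewrite preimage_setT.
Qed.

Lemma measurable_fun_integral_tuple d (F : d.+1.-tuple R -> \bar R) :
  measurable_fun setT F -> (forall v, 0 <= F v)%E ->
  measurable_fun setT
    (fun x : measurableTypeR R => \int[lebesgue_tuple d]_t F (tuple_cons (x, t)))%E.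
Proof.
move=> mF F0.
apply: (@measurable_fun_fubini_tonelli_F _ _ _ _ _ (lebesgue_tuple d)
  (F \o @tuple_cons R d)) => //=.
apply: measurableT_comp => //; exact: measurable_tuple_cons.
Qed.

(** Uniqueness of Lebesgue measure: the scaled pushforward has the right value on half-open
    intervals. For c < 0 the preimage of such an interval is closed on the other side. *)
Lemma lebesgue_measure_affine (c b : R) (A : set (measurableTypeR R)) : c != 0 ->
  measurable A ->
  (leb A = `|c|%:E * leb ((fun x => c * x + b)%R @^-1` A))%E.
Proof.
move=> c0 mA.
pose f : measurableTypeR R -> measurableTypeR R := fun x => c * x + b.
have mf : measurable_fun setT f.
  by apply: measurable_funD => //; exact: measurable_funM.
have c0' : 0 <= `|c| by [].
have unique := @lebesgue_measure_unique R (mscale (NngNum c0') (pushforward leb f)).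
apply: (unique mf) mA => {unique}//=.
move=> _ [[u v]] _ <-; rewrite /mscale/= /pushforward.
have [cp|cn|c00] := ltgtP c 0; last by rewrite c00 eqxx in c0.
- have -> : f @^-1` `]u, v] = `[(v - b) / c, (u - b) / c[%classic.
    apply/seteqP; split => x; rewrite /f /= !in_itv/= => /andP[h1 h2];
      apply/andP; split.
    + by rewrite ler_ndivrMr// lerBrDr [x * c]mulrC.
    + by rewrite ltr_ndivlMr// ltrBlDr [x * c]mulrC.
    + by move: h2; rewrite ltr_ndivlMr// ltrBlDr [x * c]mulrC.
    + by move: h1; rewrite ler_ndivrMr// lerBrDr [x * c]mulrC.
  rewrite !lebesgue_measure_itv/= !lte_fin ltr_nM2r ?invr_lt0// ltrD2r.
  case: ifP => uv; last by rewrite mule0.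
  rewrite -!EFinD -EFinM; congr EFin; rewrite ltr0_norm//; by field.
- have -> : f @^-1` `]u, v] = `](u - b) / c, (v - b) / c]%classic.
    apply/seteqP; split => x; rewrite /f /= !in_itv/= => /andP[h1 h2];
      apply/andP; split.
    + by rewrite ltr_pdivrMr// ltrBlDr [x * c]mulrC.
    + by rewrite ler_pdivlMr// lerBrDr [x * c]mulrC.
    + by move: h1; rewrite ltr_pdivrMr// ltrBlDr [x * c]mulrC.
    + by move: h2; rewrite ler_pdivlMr// lerBrDr [x * c]mulrC.
  rewrite !lebesgue_measure_itv/= !lte_fin ltr_pM2r ?invr_gt0// ltrD2r.
  case: ifP => uv; last by rewrite mule0.
  rewrite -!EFinD -EFinM; congr EFin; rewrite gtr0_norm//; by field.
Qed.

Lemma ge0_integral_affine (c b : R) (F : R -> \bar R) : c != 0 ->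
  measurable_fun [set: measurableTypeR R] F -> (forall x, 0 <= F x)%E ->
  (\int[leb]_x F x = `|c|%:E * \int[leb]_x F (c * x + b)%R)%E.
Proof.
move=> c0 mF F0.
pose f : measurableTypeR R -> measurableTypeR R := fun x => c * x + b.
have mf : measurable_fun setT f.
  by apply: measurable_funD => //; exact: measurable_funM.
have c0' : 0 <= `|c| by [].
pose pf := measure_function_pushforward__canonical__measure_function_Measure leb mf.
transitivity (\int[mscale (NngNum c0') pf]_x F x)%E.
  by apply: eq_measure_integral => A mA _; exact: lebesgue_measure_affine.
rewrite ge0_integral_mscale//= (ge0_integral_pushforward mf)//.
Qed.

Definition affine_tuple d (c : R) (b : d.-tuple R) (v : d.-tuple R) : d.-tuple R :=
  [tuple c * tnth v i + tnth b i | i < d].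

Lemma measurable_affine_tuple d c (b : d.-tuple R) :
  measurable_fun [set: d.-tuple R] (affine_tuple c b).
Proof.
apply/measurable_fun_tnthP => i.
rewrite (_ : _ \o _ = fun v => c * tnth v i + tnth b i); last first.
  by apply/funext => v; rewrite /= tnth_mktuple.
by apply: measurable_funD => //; apply: measurable_funM => //; exact: measurable_tnth.
Qed.

Lemma affine_tuple_cons d c (b : d.+1.-tuple R) x (v : d.-tuple R) :
  affine_tuple c b (tuple_cons (x, v)) =
  tuple_cons (c * x + thead b, affine_tuple c [tuple of behead b] v).
Proof.
apply: eq_from_tnth => i; rewrite tnth_mktuple.
case: (unliftP ord0 i) => [j ->|->]; last by rewrite /tuple_cons/= !tnth0.
rewrite /tuple_cons/= !tnthS tnth_mktuple tnth_behead; congr (_ + tnth b _).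
by apply: val_inj; rewrite /= inordK// ltnS.
Qed.

(** Induction on d through Tonelli: the outer coordinate uses the formula on R, the inner ones the
    induction hypothesis. *)
Lemma ge0_integral_tuple_affine d (c : R) (b : d.-tuple R) (F : d.-tuple R -> \bar R) :
  c != 0 -> measurable_fun setT F -> (forall x, 0 <= F x)%E ->
  (\int[lebesgue_tuple d]_v F v =
   (`|c| ^+ d)%:E * \int[lebesgue_tuple d]_v F (affine_tuple c b v))%E.
Proof.
move=> c0; elim: d b F => [|d IH] b F mF F0.
  rewrite mul1e; apply: eq_integral => v _; congr F.
  by rewrite (tuple0 v) (tuple0 (affine_tuple _ _ _)).
have mFc : measurable_fun [set: measurableTypeR R * d.-tuple R] (F \o @tuple_cons R d).
  by apply: measurableT_comp => //; exact: measurable_tuple_cons.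
have mFa : measurable_fun setT (F \o affine_tuple c b).
  by apply: measurableT_comp => //; exact: measurable_affine_tuple.
rewrite (ge0_integral_tupleS mF)// (ge0_integral_tupleS mFa); last by move=> v; exact: F0.
have mG := measurable_fun_integral_tuple mF F0.
have G0 x : (0 <= \int[lebesgue_tuple d]_t F (tuple_cons (x, t)))%E.
  exact: integral_ge0.
apply: (etrans (ge0_integral_affine (thead b) c0 mG G0)).
rewrite exprS EFinM -muleA; congr (_ * _)%E.
rewrite -ge0_integralZl//; last 2 first.
- exact: (measurable_fun_integral_tuple mFa (fun v => F0 (affine_tuple c b v))).
- by move=> x _; apply: integral_ge0 => v _; exact: F0.
apply: eq_integral => x _.
rewrite (IH [tuple of behead b])//; last first.
  exact: (measurableT_comp mFc (measurable_pair1 _)).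
by under [in RHS]eq_integral do rewrite /= affine_tuple_cons.
Qed.

Lemma Rintegral_tuple_affine d (c : R) (b : d.-tuple R) (F : d.-tuple R -> R) :
  c != 0 -> (lebesgue_tuple d).-integrable setT (EFin \o F) ->
  \int[lebesgue_tuple d]_v F v =
  `|c| ^+ d * \int[lebesgue_tuple d]_v F (affine_tuple c b v).
Proof.
move=> c0 iF; have mF := measurable_int _ iF.
have ma := @measurable_affine_tuple d c b.
have iF' : (lebesgue_tuple d).-integrable setT (EFin \o (F \o affine_tuple c b)).
  have /integrableP[_ oo] := iF.
  apply/integrableP; split; first exact: measurableT_comp mF ma.
  move: oo; rewrite (@ge0_integral_tuple_affine d c b (abse \o (EFin \o F)))//.
  (* An infinite integral after substitution would stay infinite when multiplied by |c|^d > 0. *)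
  - by apply: contraTT; rewrite -!leNgt !leye_eq => /eqP ->; rewrite gt0_muley// lte_fin exprn_gt0// normr_gt0.
  - exact: measurableT_comp.
  - by move=> x; exact: abse_ge0.
transitivity (fine ((`|c| ^+ d)%:E *
    \int[lebesgue_tuple d]_v (F (affine_tuple c b v))%:E)%E); last first.
  by rewrite fineM//; exact: integrable_fin_num iF'.
congr fine; rewrite integralE [in RHS]integralE.
rewrite (@ge0_integral_tuple_affine d c b (EFin \o F)^\+%E)//; last exact: measurable_funepos.
rewrite (@ge0_integral_tuple_affine d c b (EFin \o F)^\-%E)//; last exact: measurable_funeneg.
rewrite [RHS]muleBr//; last first.
  by apply: fin_num_adde_defr; exact: (integrable_pos_fin_num measurableT iF').
have posE := funepos_comp (EFin \o F) (affine_tuple c b).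
have negE := funeneg_comp (EFin \o F) (affine_tuple c b).
congr (_ * _ - _ * _)%E; apply: eq_integral => v _.
  by move/(congr1 (@^~ v)) : posE => /= <-.
by move/(congr1 (@^~ v)) : negE => /= <-.
Qed.

End lebesgue_tuple_integral.

(** * Fubini for R^(a+b), product integrands and the dominating function *)

Section lebesgue_tuple_fubini.
Context {R : realType}.
Notation leb := (@lebesgue_measure R).

Definition tuple_cat a b (w : a.-tuple R * b.-tuple R) : (a + b).-tuple R :=
  [tuple of w.1 ++ w.2].

Lemma measurable_tuple_cat a b : measurable_fun [set: a.-tuple R * b.-tuple R] (@tuple_cat a b).
Proof.
apply/measurable_fun_tnthP => i; case: (split_ordP i) => j ->.
  rewrite (_ : _ \o _ = fun w => tnth w.1 j); last first.
    by apply/funext => w /=; rewrite tnth_lshift.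
  by apply: (@measurableT_comp _ _ _ _ _ _ (fun x => tnth x j)) => //=; exact: measurable_tnth.
rewrite (_ : _ \o _ = fun w => tnth w.2 j); last first.
  by apply/funext => w /=; rewrite tnth_rshift.
by apply: (@measurableT_comp _ _ _ _ _ _ (fun x => tnth x j)) => //=; exact: measurable_tnth.
Qed.

Lemma tuple_cat_cons a b x (u : a.-tuple R) (v : b.-tuple R) :
  tuple_cons (x, tuple_cat (u, v)) = tuple_cat (tuple_cons (x, u), v).
Proof. exact: val_inj. Qed.

Lemma ge0_integral_tuple_cat a b (F : (a + b).-tuple R -> \bar R) :
  measurable_fun setT F -> (forall v, 0 <= F v)%E ->
  (\int[lebesgue_tuple (a + b)]_v F v =
   \int[lebesgue_tuple a]_u \int[lebesgue_tuple b]_v F (tuple_cat (u, v)))%E.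
Proof.
elim: a F => [|a IH] F mF F0.
  rewrite [RHS](_ : _ = \int[\d_([tuple] : 0.-tuple R)]_u
    \int[lebesgue_tuple b]_v F (tuple_cat (u, v)))%E//.
  rewrite integral_dirac//= ?diracT ?mul1e.
    by apply: eq_integral => v _; congr F; exact: val_inj.
  apply: (@measurable_fun_fubini_tonelli_F _ _ _ _ _ (lebesgue_tuple b)
    (F \o @tuple_cat 0 b)) => //=.
  exact: (measurableT_comp mF (@measurable_tuple_cat 0 b)).
have mFc : measurable_fun setT (F \o @tuple_cat a.+1 b).
  by apply: measurableT_comp => //; exact: measurable_tuple_cat.
rewrite (ge0_integral_tupleS mF)//.
rewrite (@ge0_integral_tupleS _ _ (fun u => \int[lebesgue_tuple b]_v F (tuple_cat (u, v)))%E); last 2 first.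
- apply: (@measurable_fun_fubini_tonelli_F _ _ _ _ _ (lebesgue_tuple b)
    (F \o @tuple_cat a.+1 b)) => //.
  by move=> w; exact: F0.
- by move=> u; apply: integral_ge0 => v _; exact: F0.
apply: eq_integral => x _.
have mx : measurable_fun setT (fun t : (a + b).-tuple R => F (tuple_cons (x, t))).
  apply: (measurableT_comp mF).
  exact: (measurableT_comp (@measurable_tuple_cons R (a + b)) (measurable_pair1 x)).
apply: (etrans (IH _ mx (fun t => F0 (tuple_cons (x, t))))).
by apply: eq_integral => u _; apply: eq_integral => v _; rewrite tuple_cat_cons.
Qed.

(** Tonelli on the indicator of A. Identifying the measures lets Fubini for signed functions be
    transported along concatenation. *)
Lemma lebesgue_tuple_cat a b (A : set ((a + b).-tuple R)) : measurable A ->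
  lebesgue_tuple (a + b) A =
  pushforward (lebesgue_tuple a \x lebesgue_tuple b)%E (@tuple_cat a b) A.
Proof.
move=> mA; rewrite -[in LHS](setIT A) -integral_indic// ge0_integral_tuple_cat//; last first.
  by apply/measurable_EFinP; exact: measurable_indic.
rewrite /pushforward/= /product_measure1; apply: eq_integral => u _ /=.
rewrite (eq_integral (fun v => (\1_(xsection (@tuple_cat a b @^-1` A) u) v)%:E)); last first.
  by move=> v _; rewrite !indicE mem_xsection.
rewrite integral_indic ?setIT//; apply: measurable_xsection.
by rewrite -[X in measurable X]setTI; exact: measurable_tuple_cat.
Qed.

Lemma integral_tuple_cat a b (F : (a + b).-tuple R -> \bar R) :
  (lebesgue_tuple (a + b)).-integrable setT F ->
  (\int[lebesgue_tuple (a + b)]_v F v =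
   \int[lebesgue_tuple a]_u \int[lebesgue_tuple b]_v F (tuple_cat (u, v)))%E.
Proof.
move=> iF; have mF := measurable_int _ iF.
have mc := @measurable_tuple_cat a b.
have iFc : (lebesgue_tuple a \x lebesgue_tuple b)%E.-integrable setT (F \o @tuple_cat a b).
  have /integrableP[_ oo] := iF; apply/integrableP; split; first exact: measurableT_comp.
  rewrite (fubini_tonelli1 (abse \o (F \o @tuple_cat a b)))//=; last first.
    by apply: measurableT_comp => //; exact: (measurableT_comp mF mc).
  have mabs : measurable_fun setT (abse \o F) by apply: measurableT_comp.
  by have <- := ge0_integral_tuple_cat mabs (fun v => abse_ge0 (F v)).
rewrite (integral12_prod_meas1 iFc).
have := @integral_pushforward _ _ _ _ R _ mc (lebesgue_tuple a \x lebesgue_tuple b)%E setT F mF.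
rewrite preimage_setT => /(_ iFc measurableT) <-.
by apply: eq_measure_integral => A mA _; exact: lebesgue_tuple_cat.
Qed.

Lemma integral_tuple_prod d (k : R -> R) (c : R) :
  measurable_fun [set: measurableTypeR R] k -> (forall x, 0 <= k x) ->
  (\int[leb]_x (k x)%:E = c%:E)%E ->
  (\int[lebesgue_tuple d]_v (\prod_i k (tnth v i))%:E = (c ^+ d)%:E)%E.
Proof.
move=> mk k0 kc.
have mprod e : measurable_fun [set: e.-tuple R] (fun v => \prod_i k (tnth v i)).
  apply: measurable_prod => i _.
  exact: (measurableT_comp mk (measurable_tnth i)).
have mprodE e : measurable_fun [set: e.-tuple R] (fun v => (\prod_i k (tnth v i))%:E).
  apply/measurable_EFinP. exact (mprod e).
elim: d => [|d IH].
  rewrite [LHS](_ : _ = \int[\d_([tuple] : 0.-tuple R)]_v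
    (\prod_i k (tnth v i))%:E)%E//.
  rewrite integral_dirac//= ?diracT ?mul1e ?big_ord0//.
  exact: mprodE.
rewrite ge0_integral_tupleS; last 2 first.
- exact: mprodE.
- by move=> v; rewrite lee_fin; exact: prodr_ge0.
have c0 : 0 <= c.
  by rewrite -lee_fin -kc; apply: integral_ge0 => x _; rewrite lee_fin.
transitivity (\int[leb]_x ((c ^+ d)%:E * (k x)%:E))%E.
  apply: eq_integral => x _; rewrite -IH muleC -ge0_integralZl//; last 3 first.
  - exact (mprodE d).
  - by move=> v _; rewrite lee_fin; exact: prodr_ge0.
  - by rewrite lee_fin.
  apply: eq_integral => v _; rewrite /tuple_cons/= big_ord_recl tnth0 EFinM.
  by congr (_ * _%:E)%E; apply: eq_bigr => i _; rewrite tnthS.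
rewrite (@ge0_integralZl _ _ _ leb setT measurableT (EFin \o k))//.
- by rewrite kc -EFinM exprSr.
- exact/measurable_EFinP.
- by move=> x _; rewrite lee_fin.
- by rewrite lee_fin exprn_ge0.
Qed.

(* An integrable function on R^d dominating both the integrands (in l) and the kernel (in g). *)
Definition jprod d (v : 'rV[R]_d) : R := \prod_i (1 + v 0 i ^+ 2)^-1.

Lemma jprod_ge0 d (v : 'rV[R]_d) : 0 <= jprod v.
Proof. by apply: prodr_ge0 => i _; rewrite invr_ge0 addr_ge0// sqr_ge0. Qed.

Lemma measurable_coord d (i : 'I_d) :
  measurable_fun [set: d.-tuple R] (fun l => rV_of_tuple l 0 i).
Proof.
rewrite (_ : (fun _ => _) = @tnth _ _ ^~ i); first exact: measurable_tnth.
by apply/funext => l; rewrite mxE.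
Qed.

(** The integrand is even, so this is twice the half-line value pi/2 of arctan. *)
Lemma integral_inv_oneDsqr : (\int[leb]_x ((1 + x ^+ 2)^-1)%:E = pi%:E :> \bar R)%E.
Proof.
rewrite (@ge0_symfun_integralT R (fun x => (oneDsqr x)^-1)).
- rewrite -set_itvcy integral0y_oneDsqr -EFinM; congr EFin.
  by rewrite mulrC divfK.
- by move=> x; rewrite invr_ge0.
- exact: continuous_oneDsqrV.
- by move=> x; rewrite /oneDsqr /= sqrrN.
Qed.

Lemma integrable_jprod d :
  (lebesgue_tuple d).-integrable setT (fun l => (jprod (rV_of_tuple l))%:E).
Proof.
have mo : measurable_fun [set: measurableTypeR R] (fun x : R => (1 + x ^+ 2)^-1).
  apply: continuous_measurable_fun => x.
  exact: (@continuous_oneDsqrV R x).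
have h : (fun l : d.-tuple R => (jprod (rV_of_tuple l))%:E) =
    (fun l => (\prod_i (1 + tnth l i ^+ 2)^-1)%:E).
  by apply/funext => l; rewrite /jprod; under eq_bigr do rewrite mxE.
apply/integrableP; split.
  rewrite h; apply/measurable_EFinP/measurable_prod => i _.
  exact: (measurableT_comp mo (measurable_tnth i)).
under eq_integral do rewrite gee0_abs ?lee_fin ?jprod_ge0//.
rewrite h (@integral_tuple_prod d _ pi mo) ?ltry//.
- by move=> x; rewrite invr_ge0 addr_ge0// sqr_ge0.
- exact: integral_inv_oneDsqr.
Qed.

End lebesgue_tuple_fubini.

(** * Limits and derivatives under the integral sign *)

Section under_integral.
Context {R : realType} d {Y : measurableType d} {mu : {measure set Y -> \bar R}}.

Lemma dominated_cvg_Rintegral (f_ : (Y -> R)^nat) (f G : Y -> R) :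
  (forall k, measurable_fun setT (f_ k)) ->
  (forall y, f_ k y @[k --> \oo] --> f y) ->
  mu.-integrable setT (EFin \o G) ->
  (forall k y, `|f_ k y| <= G y) ->
  \int[mu]_y f_ k y @[k --> \oo] --> \int[mu]_y f y.
Proof.
move=> mf cf iG fG.
have mfE k : measurable_fun setT (fun y => (f_ k y)%:E) by exact/measurable_EFinP.
have cfE y : setT y -> (f_ k y)%:E @[k --> \oo] --> (f y)%:E.
  by move=> _; apply: cvg_EFin; [exact: nearW|exact: cf].
have fGE k y : setT y -> (`|(f_ k y)%:E| <= (EFin \o G) y)%E.
  by move=> _; rewrite lee_fin.
have mlim : measurable_fun setT (fun y => (f y)%:E).
  exact: emeasurable_fun_cvg mfE cfE.
have [iF _ lim] := dominated_convergence measurableT mfE mlim (aeW _ cfE) iG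
  (aeW _ (fun y k Dy => fGE k y Dy)).
apply: fine_cvg; rewrite fineK; first exact: lim.
exact: integrable_fin_num iF.
Qed.

(** Dominated convergence is sequential. A failure of continuity yields points [w k] in balls of
    radius at most 1/(k+1), hence tending to v0, whose integrals stay at distance at least e, a
    contradiction. *)
Lemma continuous_under_integral (V : pseudoMetricType R) (F : V -> Y -> R) (v0 : V)
    (G : Y -> R) :
  (forall y, {for v0, continuous (F ^~ y)}) ->
  (forall v, measurable_fun setT (F v)) ->
  mu.-integrable setT (EFin \o G) ->
  (\forall v \near v0, forall y, `|F v y| <= G y) ->
  {for v0, continuous (fun v => \int[mu]_y F v y)}.
Proof.
move=> cF mF iG /nbhs_ballP[r /= r0 Fr]; apply/cvgrPdist_lt => e e0.
apply: contrapT => nnear.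
have bad (k : nat) : exists v, ball v0 (Num.min r k.+1%:R^-1) v /\
    e <= `|\int[mu]_y F v0 y - \int[mu]_y F v y|.
  apply: contrapT => /forallNP nex; apply: nnear.
  apply/nbhs_ballP; exists (Num.min r k.+1%:R^-1) => /=.
    by rewrite lt_min r0/= invr_gt0.
  move=> v bv; rewrite ltNge; apply/negP => ev.
  by apply: (nex v); split.
have [w wP] := choice bad.
have wr k : ball v0 r (w k).
  by apply: (le_ball _ (wP k).1); rewrite ge_min lexx.
have cw : w @ \oo --> v0.
  apply/cvg_ballP => s s0.
  near=> k; apply: (le_ball _ (wP k).1); rewrite ge_min; apply/orP; right.
  rewrite ltW//; near: k; exact: near_infty_natSinv_lt (PosNum s0).
have /cvgrPdist_lt/(_ e e0) : \int[mu]_y F (w k) y @[k --> \oo] --> \int[mu]_y F v0 y.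
  apply: (@dominated_cvg_Rintegral (fun k => F (w k)) (F v0) G) => //.
  - by move=> y; exact: (cvg_comp _ _ cw (cF y)).
  - by move=> k y; exact: Fr.
by case=> N _ /(_ N (leqnn N)) /=; rewrite ltNge (wP N).2.
Unshelve. all: by end_near. Qed.

(** The base point 0 is enough: every later use differentiates along a path whose starting point is
    absorbed into f. *)
Lemma is_derive_under_integral (f f' : R -> Y -> R) (G : Y -> R) (r : R) :
  0 < r ->
  (forall (x : R) y, `|x| < r -> is_derive x 1 (f ^~ y) (f' x y)) ->
  (forall x, `|x| < r -> mu.-integrable setT (EFin \o f x)) ->
  mu.-integrable setT (EFin \o G) ->
  (forall x y, `|x| < r -> `|f' x y| <= G y) ->
  is_derive (0 : R) 1 (fun x => \int[mu]_y f x y) (\int[mu]_y f' 0 y).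
Proof.
move=> r0 df intf iG fG.
have I0 : [set` `](- r), r[] (0 : R) by rewrite /= in_itv/= oppr_lt0 r0.
have Ir x : [set` `](- r), r[] x -> `|x| < r.
  by rewrite /= in_itv/= ltr_norml.
have df1 x y : `|x| < r -> partial1of2 f x y = f' x y.
  by move=> xr; rewrite partial1of2E; have ? := df x y xr; exact: derive_val.
have intf' x : [set` `](- r), r[] x -> mu.-integrable setT (EFin \o f x).
  by move=> /Ir; exact: intf.
have derf1 x y : [set` `](- r), r[] x -> setT y -> derivable (f ^~ y) x 1.
  by move=> /Ir xr _; have ? := df x y xr; exact: ex_derive.
have G0 y : 0 <= G y by apply: le_trans (fG 0 y _); rewrite ?normr0.
have Gub x y : [set` `](- r), r[] x -> setT y -> `|partial1of2 f x y| <= G y.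
  by move=> /Ir xr _; rewrite df1// fG.
have D := @derivable_under_integral _ _ _ mu f setT measurableT 0 (- r) r I0 intf'
  derf1 G G0 iG Gub.
have E := @differentiation_under_integral _ _ _ mu f setT measurableT 0 (- r) r I0 intf'
  derf1 G G0 iG Gub.
apply: DeriveDef => //; rewrite -derive1E E.
by apply: eq_Rintegral => y _; rewrite df1// normr0.
Qed.

End under_integral.

(** * The entire functions E_j and their quotients Q_j = E_j / E_1 *)

Section cosh_sqrt.
Context {R : realType}.
Implicit Types (j k : nat) (s : R).

(* E_0 s = cosh (sqrt s) and E_(j+1) = 2 E_j': entire functions of s, so that
   composing them with s = t^2 |l|^2 is smooth in l, also at l = 0. *)
Definition cosh_sqrt_coef j k : R :=
  2 ^+ j * (k + j)`!%:R / (k`!%:R * (k + j).*2`!%:R).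

Definition cosh_sqrt j s : R := limn (pseries (cosh_sqrt_coef j) s).

Local Notation a := cosh_sqrt_coef.
Local Notation E := cosh_sqrt.

Let fact_neq0 k : k`!%:R != 0 :> R.
Proof. by rewrite pnatr_eq0 -lt0n fact_gt0. Qed.

Lemma cosh_sqrt_coef_gt0 j k : 0 < a j k.
Proof. by rewrite divr_gt0 ?mulr_gt0 ?exprn_gt0 ?ltr0n ?fact_gt0. Qed.

(** Comparison with the exponential series; it gives convergence for every s. *)
Lemma cosh_sqrt_coef_le j k : a j k <= 2 ^+ j * k`!%:R^-1.
Proof.
rewrite /a invfM [k`!%:R^-1 * _]mulrC !mulrA ler_pM2r ?invr_gt0 ?ltr0n ?fact_gt0//.
rewrite -mulrA ler_piMr ?exprn_ge0// ler_pdivrMr ?ltr0n ?fact_gt0// mul1r ler_nat.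
by apply: leq_fact; rewrite -addnn leq_addr.
Qed.

(** The ratio is at least 1, which makes E_j decrease in j for s >= 0; its exact value is used in
    [cosh_sqrt2]. *)
Lemma cosh_sqrt_coefS j k : a j k = (k + j).*2.+1%:R * a j.+1 k.
Proof.
rewrite /a addnS doubleS !factS -[(k + j).*2]muln2 !natrM exprS.
have h1 := fact_neq0 k; have h2 := fact_neq0 (k + j).*2; rewrite -muln2 in h2.
have h3 : ((k + j) * 2).+1%:R != 0 :> R by rewrite pnatr_eq0.
have h4 : ((k + j) * 2).+2%:R = 2 * (k + j).+1%:R :> R.
  by rewrite -natrM mul2n doubleS muln2.
have h5 : (k + j).+1%:R != 0 :> R by rewrite pnatr_eq0.
rewrite h4; move: h1 h2 h3 h5; move: (_ `!%:R) (_ `!%:R) (_.+1%:R) (_.+1%:R) => A B C D.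
move=> h1 h2 h3 h5; field.
by rewrite h1 h2 h3 h5.
Qed.

Lemma cosh_sqrt_coef_diffs j : pseries_diffs (a j) = 2^-1 *: a j.+1.
Proof.
apply/funext => k; rewrite /pseries_diffs fctE /a addSnnS.
rewrite factS natrM exprS.
have h1 := fact_neq0 k; have h2 := fact_neq0 (k + j.+1).*2.
have h3 : k.+1%:R != 0 :> R by rewrite pnatr_eq0.
rewrite /GRing.scale/=; move: h1 h2 h3.
move: (k`!%:R) (_.*2`!%:R) (_.+1%:R) => A B C h1 h2 h3; field.
by rewrite h1 h2 h3.
Qed.

Lemma is_cvg_cosh_sqrt j s : cvgn (pseries (a j) s).
Proof.
apply: normed_cvg.
apply: (@series_le_cvg R _ (fun k => 2 ^+ j * exp_coeff `|s| k)) => [k|k|k|].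
- exact: normr_ge0.
- by rewrite mulr_ge0 ?exprn_ge0// /exp_coeff /= divr_ge0 ?exprn_ge0.
- rewrite /= normrM normrX (gtr0_norm (cosh_sqrt_coef_gt0 _ _)).
  rewrite /exp_coeff/= [_ / _]mulrC mulrA ler_wpM2r ?exprn_ge0//.
  exact: cosh_sqrt_coef_le.
- exact: (is_cvg_seriesZ (k := 2 ^+ j) (is_cvg_series_exp_coeff `|s|)).
Qed.

Lemma is_derive_cosh_sqrt j s : is_derive s 1 (E j) (E j.+1 s / 2).
Proof.
have scE (f : nat -> R) : pseries (2^-1 *: f) = fun x => 2^-1 *: pseries f x.
  apply/funext => x; rewrite /pseries -seriesZ; congr series; apply/funext => k.
  by rewrite /= -scalerAl.
have cs i x : cvgn (pseries (2^-1 *: a i) x).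
  by rewrite scE; apply: is_cvgZl_tmp; exact: is_cvg_cosh_sqrt.
have d2 : pseries_diffs (pseries_diffs (a j)) = 2^-1 *: (2^-1 *: a j.+2).
  rewrite cosh_sqrt_coef_diffs -(cosh_sqrt_coef_diffs j.+1).
  by apply/funext => k; exact: mulrCA.
pose K := `|s| + 1.
have h1 : cvgn (pseries (a j) K) by exact: is_cvg_cosh_sqrt.
have h2 : cvgn (pseries (pseries_diffs (a j)) K) by rewrite cosh_sqrt_coef_diffs.
have h3 : cvgn (pseries (pseries_diffs (pseries_diffs (a j))) K).
  rewrite d2 scE; apply: is_cvgZl_tmp; exact: cs.
have h4 : `|s| < `|K| by apply: lt_le_trans (ler_norm _); rewrite ltrDl.
have := pseries_snd_diffs h1 h2 h3 h4.
suff -> : limn (pseries (pseries_diffs (a j)) s) = E j.+1 s / 2 by [].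
rewrite cosh_sqrt_coef_diffs scE mulrC; apply/cvg_lim => //.
by apply: cvgZl_tmp; exact: is_cvg_cosh_sqrt.
Qed.

(** A series of nonnegative terms dominates each of its terms. With k arbitrary, this is the source
    of all decay in l. *)
Lemma ge_cosh_sqrt j k s : 0 <= s -> a j k * s ^+ k <= E j s.
Proof.
move=> s0.
have nd : nondecreasing_seq (pseries (a j) s).
  apply/nondecreasing_seqP => n; rewrite /pseries seriesSr.
  by rewrite lerDl mulr_ge0 ?exprn_ge0// ltW// cosh_sqrt_coef_gt0.
apply: le_trans (nondecreasing_cvgn_le nd (@is_cvg_cosh_sqrt _ _) k.+1).
rewrite /pseries seriesSr lerDr sumr_ge0// => i _.
by rewrite mulr_ge0 ?exprn_ge0// ltW// cosh_sqrt_coef_gt0.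
Qed.

Lemma cosh_sqrt_ge0 j s : 0 <= s -> 0 <= E j s.
Proof.
move=> s0; apply: le_trans (ge_cosh_sqrt j 0 s0).
by rewrite expr0 mulr1 ltW// cosh_sqrt_coef_gt0.
Qed.

Lemma cosh_sqrt_ge1 s : 0 <= s -> 1 <= E 1 s.
Proof.
move=> s0; apply: le_trans (ge_cosh_sqrt 1 0 s0).
by rewrite mulr1 /a expr1 (_ : (0 + 1)`! = 1)%N// (_ : (0 + 1).*2`! = 2)%N// fact0; lra.
Qed.

Lemma cosh_sqrtS_le j s : 0 <= s -> E j.+1 s <= E j s.
Proof.
move=> s0; apply: lim_series_le; try exact: is_cvg_cosh_sqrt.
move=> k; rewrite ler_wpM2r ?exprn_ge0// (cosh_sqrt_coefS j).
by rewrite ler_peMl ?ler1n// ltW// cosh_sqrt_coef_gt0.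
Qed.

(** Equivalent to the derivative of x E_1(x^2) being E_0(x^2). The constant terms of E_0 and E_1
    agree, and multiplication by s shifts indices, so the partial sums match with an offset of
    one. *)
Lemma cosh_sqrt2 s : s * E 2 s = E 0 s - E 1 s.
Proof.
have c j := @is_cvg_cosh_sqrt j s.
have l1 : s * pseries (a 2) s k @[k --> \oo] --> s * E 2 s.
  by apply: cvgMl_tmp; exact: c.
have l2 : pseries (a 0) s k.+1 - pseries (a 1) s k.+1 @[k --> \oo] --> E 0 s - E 1 s.
  by apply: cvgB; rewrite (cvg_shiftS (pseries _ _)); exact: c.
suff e : (fun k => s * pseries (a 2) s k) =
    (fun k => pseries (a 0) s k.+1 - pseries (a 1) s k.+1).
  by rewrite e in l1; rewrite -(cvg_lim _ l1)// (cvg_lim _ l2).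
apply/funext => k; elim: k => [|k IH].
  by rewrite /pseries !seriesEord/= big_ord0 !big_ord_recl !big_ord0 (cosh_sqrt_coefS 0)/= mul1r subrr mulr0.
rewrite /pseries in IH *.
rewrite seriesSr mulrDr IH [in RHS]seriesSr [X in _ = _ - X]seriesSr.
rewrite /= opprD addrACA; congr (_ + _); rewrite -mulrBl exprS.
rewrite [RHS]mulrCA; congr (s * (_ * _)).
rewrite (cosh_sqrt_coefS 0) addn0.
have /(congr1 (@^~ k)) := cosh_sqrt_coef_diffs 1.
rewrite /pseries_diffs fctE /GRing.scale/= => h.
have -> : a 2 k = 2 * (k.+1%:R * a 1 k.+1) by rewrite h mulrA divff// mul1r.
by rewrite -[k.+1.*2.+1%:R]natr1 -mul2n natrM; ring.
Qed.

Lemma is_derive_cosh_sqrt_sqr j (x : R) :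
  is_derive x 1 (fun y => E j (y ^+ 2)) (x * E j.+1 (x ^+ 2)).
Proof.
have h2 : is_derive x 1 (fun y : R => y ^+ 2) (x *+ 2).
  by apply: is_derive_eq; rewrite /GRing.scale/=; ring.
have h := is_derive_cosh_sqrt j (x ^+ 2).
have := @is_derive1_comp _ (E j) (fun y => y ^+ 2) x _ _ h h2.
by congr is_derive; lra.
Qed.

(** The sum and the difference of the two left sides solve y' = y and y' = - y with value 1 at 0;
    multiplied by the opposite exponential, each has zero derivative. *)
Lemma cosh_sinh_sqrt (x : R) : E 0 (x ^+ 2) = cosh x /\ x * E 1 (x ^+ 2) = sinh x.
Proof.
have E00 : E 0 0 = 1.
  apply/cvg_lim => //; apply: cvg_near_cst; exists 1%N => // -[//|k] _ /=.
  rewrite /pseries seriesEord/= big_ord_recl big1 ?addr0 => [|i _].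
    by rewrite expr0 mulr1 /a expr0 fact0 !mul1r invr1.
  by rewrite expr0n mulr0.
have d0 (y : R) := is_derive_cosh_sqrt_sqr 0 y.
have d1 (y : R) : is_derive y 1 (fun y => y * E 1 (y ^+ 2)) (E 0 (y ^+ 2)).
  have h := is_derive_cosh_sqrt_sqr 1 y.
  apply: is_derive_eq => //=.
  rewrite /GRing.scale/= mulr1 mulrA -expr2 cosh_sqrt2; lra.
have ep : E 0 (x ^+ 2) + x * E 1 (x ^+ 2) = expR x.
  pose f y : R := (E 0 (y ^+ 2) + y * E 1 (y ^+ 2)) * expR (- y).
  have df (y : R) : is_derive y 1 f 0.
    have := d0 y; have := d1 y => ? ?.
    apply: is_derive_eq; rewrite /GRing.scale/= mulrN1; ring.
  have := is_derive_0_is_cst x 0 df.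
  rewrite /f expr0n mul0r oppr0 expR0 E00 addr0 mulr1 => h.
  by apply: (mulIf (lt0r_neq0 (expR_gt0 (- x)))); rewrite h -expRD subrr expR0.
have em : E 0 (x ^+ 2) - x * E 1 (x ^+ 2) = expR (- x).
  pose f y : R := (E 0 (y ^+ 2) - y * E 1 (y ^+ 2)) * expR y.
  have df (y : R) : is_derive y 1 f 0.
    have := d0 y; have := d1 y => ? ?.
    apply: is_derive_eq; rewrite /GRing.scale/=; ring.
  have := is_derive_0_is_cst x 0 df.
  rewrite /f expr0n mul0r subr0 expR0 E00 mulr1 => h.
  by apply: (mulIf (lt0r_neq0 (expR_gt0 x))); rewrite h -expRD addNr expR0.
by rewrite /cosh /sinh -ep -em; split; lra.
Qed.

Definition coth_sqrt j s : R := E j s / E 1 s.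

Local Notation Q := coth_sqrt.

Lemma coth_sqrt1 s : 0 <= s -> Q 1 s = 1.
Proof. by move=> s0; rewrite /Q divff// gt_eqF// (lt_le_trans ltr01)// cosh_sqrt_ge1. Qed.

Lemma coth_sqrt2 s : 0 <= s -> s * Q 2 s = Q 0 s - 1.
Proof.
by move=> s0; rewrite -(coth_sqrt1 s0) /Q mulrA cosh_sqrt2 mulrBl.
Qed.

Lemma coth_sqrt_ge0 j s : 0 <= s -> 0 <= Q j s.
Proof. by move=> s0; rewrite divr_ge0// cosh_sqrt_ge0. Qed.

Lemma coth_sqrtS_le j s : 0 <= s -> Q j.+1 s <= Q j s.
Proof.
move=> s0; rewrite ler_pM2r ?invr_gt0 ?cosh_sqrtS_le//.
by rewrite (lt_le_trans ltr01)// cosh_sqrt_ge1.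
Qed.

Lemma coth_sqrt0_ge1 s : 0 <= s -> 1 <= Q 0 s.
Proof. by move=> s0; rewrite -{1}(coth_sqrt1 s0) coth_sqrtS_le. Qed.

(** Q_0 - 1 = s Q_2 and Q_2 <= Q_1 = 1; larger j follow by monotonicity in j. Every Q_j thus grows
    at most polynomially in t and l. *)
Lemma coth_sqrt_le j s : 0 <= s -> Q j s <= 1 + s.
Proof.
move=> s0; elim: j => [|j IH]; last exact: le_trans (coth_sqrtS_le _ s0) IH.
rewrite -lerBlDl -coth_sqrt2// ler_piMr//.
by rewrite -(coth_sqrt1 s0) coth_sqrtS_le.
Qed.

Lemma is_derive_coth_sqrt j s : 0 <= s ->
  is_derive s 1 (Q j) (2^-1 * (Q j.+1 s - Q j s * Q 2 s)).
Proof.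
move=> s0; have E10 : E 1 s != 0.
  by rewrite gt_eqF// (lt_le_trans ltr01)// cosh_sqrt_ge1.
have d1 := is_derive_cosh_sqrt j s; have d2 := is_derive_cosh_sqrt 1 s.
have d3 := is_deriveV E10 d2.
have := is_deriveM d1 d3; congr is_derive.
by rewrite /Q /GRing.scale/=; field.
Qed.

Lemma continuous_cosh_sqrt j : continuous (E j).
Proof.
move=> s; apply/differentiable_continuous/derivable1_diffP.
by have := is_derive_cosh_sqrt j s => -[].
Qed.

Lemma continuous_coth_sqrt j s : 0 <= s -> {for s, continuous (Q j)}.
Proof.
move=> s0; apply/differentiable_continuous/derivable1_diffP.
by have := is_derive_coth_sqrt j s0 => -[].
Qed.

(** Continuity of Q_j is established for s >= 0 only, so the argument is truncated at 0, which
    changes nothing on the range of f. *)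
Lemma measurable_coth_sqrt d (T : measurableType d) (f : T -> R) j :
  measurable_fun setT f -> (forall y, 0 <= f y) ->
  measurable_fun setT (fun y => Q j (f y)).
Proof.
move=> mf f0.
rewrite (_ : (fun y => _) = (fun s => Q j (Num.max s 0)) \o f); last first.
  by apply/funext => y /=; rewrite max_l.
apply: measurableT_comp => //; apply: continuous_measurable_fun => s.
have h : {for Num.max s 0, continuous (Q j)}.
  by apply: continuous_coth_sqrt; rewrite le_max lexx orbT.
apply: (@continuous_comp _ _ _ (fun s => Num.max s 0) (Q j)) => //.
by apply: continuous_max; [exact: cvg_id|exact: cvg_cst].
Qed.

End cosh_sqrt.

(** * The Euclidean inner product *)

Section dotv_theory.
Context {R : realType} {d : nat}.
Implicit Types (u v w : 'rV[R]_d) (c : R).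

Lemma dotvDl u v w : dotv (u + v) w = dotv u w + dotv v w.
Proof. by rewrite /dotv -big_split; apply: eq_bigr => i _; rewrite mxE mulrDl. Qed.

Lemma dotvZl c u v : dotv (c *: u) v = c * dotv u v.
Proof. by rewrite /dotv mulr_sumr; apply: eq_bigr => i _; rewrite mxE mulrA. Qed.

Lemma dotvDr u v w : dotv u (v + w) = dotv u v + dotv u w.
Proof. by rewrite !(dotvC u) dotvDl. Qed.

Lemma dotvZr c u v : dotv u (c *: v) = c * dotv u v.
Proof. by rewrite !(dotvC u) dotvZl. Qed.

Lemma dotv0l v : dotv 0 v = 0.
Proof. by rewrite -(scale0r 0) dotvZl mul0r. Qed.

Lemma dotv0r v : dotv v 0 = 0.
Proof. by rewrite dotvC dotv0l. Qed.

Lemma dotv_ge0 v : 0 <= dotv v v.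
Proof. by apply: sumr_ge0 => i _; rewrite -expr2 sqr_ge0. Qed.

Lemma dotv_delta v i : dotv v (delta_mx 0 i) = v 0 i.
Proof.
rewrite /dotv (bigD1 i)//= big1 => [|j ji]; first by rewrite !mxE !eqxx mulr1 addr0.
by rewrite !mxE (negbTE ji) andbF mulr0.
Qed.

Lemma sqr_enorm v : enorm v ^+ 2 = dotv v v.
Proof. by rewrite sqr_sqrtr// dotv_ge0. Qed.

Lemma coord_sqr_le v i : v 0 i ^+ 2 <= dotv v v.
Proof.
rewrite /dotv (bigD1 i)//= -expr2 lerDl sumr_ge0// => j _.
by rewrite -expr2 sqr_ge0.
Qed.

End dotv_theory.

(** * Symbols, the weight and their derivatives *)

Section symbols.
Context {R : realType} {N m : nat}.
Variable n : nat.
Implicit Types (t : R) (x : 'rV[R]_N) (z l : 'rV[R]_m).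

(* Polynomial expressions in t, 1/t, x_i, l_j and Q_k(t^2 |l|^2), where
   Q_k = E_k / E_1; together with one fixed exponential weight they form an
   algebra closed under differentiation. *)
Inductive symb :=
| SCst of R | STime | STinv | SX of 'I_N | SL of 'I_m | SQ of nat
| SAdd of symb & symb | SMul of symb & symb.

Definition ssq t l : R := t ^+ 2 * dotv l l.

Fixpoint seval t x l (e : symb) : R :=
  match e with
  | SCst c => c
  | STime => t
  | STinv => t^-1
  | SX i => x 0 i
  | SL j => l 0 j
  | SQ k => coth_sqrt k (ssq t l)
  | SAdd a b => seval t x l a + seval t x l b
  | SMul a b => seval t x l a * seval t x l b
  end.

Definition Ssum k (F : 'I_k -> symb) : symb := \big[SAdd/SCst 0]_i F i.

Lemma seval_sum t x l k (F : 'I_k -> symb) :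
  seval t x l (Ssum F) = \sum_i seval t x l (F i).
Proof. exact: (big_morph (seval t x l)). Qed.

Definition SLdot (v : 'rV[R]_m) : symb := Ssum (fun j => SMul (SCst (v 0 j)) (SL j)).
Definition SLL : symb := Ssum (fun j => SMul (SL j) (SL j)).
Definition SXX : symb := Ssum (fun i => SMul (SX i) (SX i)).

Lemma seval_Ldot t x l v : seval t x l (SLdot v) = dotv v l.
Proof. by rewrite seval_sum. Qed.

Lemma seval_LL t x l : seval t x l SLL = dotv l l.
Proof. by rewrite seval_sum. Qed.

Lemma seval_XX t x l : seval t x l SXX = dotv x x.
Proof. by rewrite seval_sum. Qed.

Lemma ssq_ge0 t l : 0 <= ssq t l.
Proof. by rewrite mulr_ge0 ?sqr_ge0 ?dotv_ge0. Qed.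

Definition Sdssq t' (l' : 'rV[R]_m) : symb :=
  SAdd (SMul (SCst (2 * t')) (SMul STime SLL))
       (SMul (SCst 2) (SMul (SMul STime STime) (SLdot l'))).

(* derivative in the direction (t', x', l') *)
Fixpoint Sder t' (x' : 'rV[R]_N) (l' : 'rV[R]_m) (e : symb) : symb :=
  match e with
  | SCst _ => SCst 0
  | STime => SCst t'
  | STinv => SMul (SCst (- t')) (SMul STinv STinv)
  | SX i => SCst (x' 0 i)
  | SL j => SCst (l' 0 j)
  | SQ k => SMul (Sdssq t' l')
      (SMul (SCst 2^-1) (SAdd (SQ k.+1) (SMul (SCst (-1)) (SMul (SQ k) (SQ 2)))))
  | SAdd a b => SAdd (Sder t' x' l' a) (Sder t' x' l' b)
  | SMul a b => SAdd (SMul (Sder t' x' l' a) b) (SMul a (Sder t' x' l' b))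
  end.

Definition Sphase : symb := SMul (SCst (- 4^-1)) (SMul (SQ 0) (SMul SXX STinv)).

Definition weight t x l : R :=
  expR (seval t x l Sphase) * ((4 * pi * t * cosh_sqrt 1 (ssq t l))^-1) ^+ n.

(* logarithmic derivative of [weight] in the direction (t', x', l') *)
Definition Sdlog t' (x' : 'rV[R]_N) (l' : 'rV[R]_m) : symb :=
  SAdd (Sder t' x' l' Sphase)
    (SMul (SCst (- n%:R)) (SAdd (SMul (SCst t') STinv)
       (SMul (SCst 2^-1) (SMul (SQ 2) (Sdssq t' l'))))).

Section path.
Variables (t t' : R) (x x' : 'rV[R]_N) (l l' : 'rV[R]_m).
Let tt (h : R) := t + h * t'.
Let xx (h : R) := x + h *: x'.
Let ll (h : R) := l + h *: l'.

Lemma is_derive_affine (a b h : R) : is_derive h 1 (fun h : R => a + h * b) b.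
Proof. by apply: is_derive_eq; rewrite /GRing.scale/=; ring. Qed.

Lemma is_derive_ssq (h : R) :
  is_derive h 1 (fun h => ssq (tt h) (ll h)) (seval (tt h) (xx h) (ll h) (Sdssq t' l')).
Proof.
rewrite /= seval_LL seval_Ldot.
have -> : (fun h => ssq (tt h) (ll h)) = fun h => (t + h * t') ^+ 2 *
    (dotv l l + h * (2 * dotv l l') + h ^+ 2 * dotv l' l').
  apply/funext => k; rewrite /ssq /ll dotvDl !dotvDr !dotvZl !dotvZr (dotvC l' l).
  by rewrite /tt; ring.
have d1 := is_derive_affine t t' h.
apply: is_derive_eq; rewrite /GRing.scale/= /ll !(dotvDl, dotvDr, dotvZl, dotvZr) (dotvC l' l).
by rewrite /tt; ring.
Qed.

(** Positivity of the time is needed for the inverse; the argument of Q_k is nonnegative at every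
    point of the path, since it is a product of squares. *)
Lemma is_derive_seval e (h : R) : 0 < tt h ->
  is_derive h 1 (fun h => seval (tt h) (xx h) (ll h) e)
    (seval (tt h) (xx h) (ll h) (Sder t' x' l' e)).
Proof.
move=> th0; elim: e => [c|||i|j|k|a IHa b IHb|a IHa b IHb].
- exact: is_derive_cst.
- exact: is_derive_affine.
- have := is_deriveV (lt0r_neq0 th0) (is_derive_affine t t' h).
  by congr is_derive; rewrite /GRing.scale/= -exprVn; ring.
- rewrite (_ : (fun _ => _) = fun h => x 0 i + h * x' 0 i).
    exact: is_derive_affine.
  by apply/funext => k; rewrite /= !mxE.
- rewrite (_ : (fun _ => _) = fun h => l 0 j + h * l' 0 j).
    exact: is_derive_affine.
  by apply/funext => k; rewrite /= !mxE.
- have d1 := is_derive_coth_sqrt k (ssq_ge0 (tt h) (ll h)).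
  have d2 := is_derive_ssq h.
  have := @is_derive1_comp _ (coth_sqrt k) (fun h => ssq (tt h) (ll h)) h _ _ d1 d2.
  by congr is_derive => /=; ring.
- exact: is_deriveD.
- have := is_deriveM IHa IHb; congr is_derive.
  by rewrite /GRing.scale/=; ring.
Qed.

Lemma is_derive_weight (h : R) : 0 < tt h ->
  is_derive h 1 (fun h => weight (tt h) (xx h) (ll h))
    (seval (tt h) (xx h) (ll h) (Sdlog t' x' l') * weight (tt h) (xx h) (ll h)).
Proof.
move=> th0; have d1 := is_derive_seval Sphase th0.
have d2 := @is_derive1_comp _ expR _ h _ _ (is_derive_expR _) d1.
have E1 : cosh_sqrt 1 (ssq (tt h) (ll h)) != 0.
  by rewrite gt_eqF// (lt_le_trans ltr01)// cosh_sqrt_ge1// ssq_ge0.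
have d3 := @is_derive1_comp _ (cosh_sqrt 1) _ h _ _ (is_derive_cosh_sqrt 1 _) (is_derive_ssq h).
pose g (k : R) := (4 * pi * tt k * cosh_sqrt 1 (ssq (tt k) (ll k)))^-1.
set A := seval (tt h) (xx h) (ll h) (Sdssq t' l') in d3.
(* Minus the logarithmic derivative of g: the term of t, plus E_1' / E_1 = Q_2 / 2 times the
   derivative A of s. *)
pose r := t' * (tt h)^-1 + 2^-1 * (coth_sqrt 2 (ssq (tt h) (ll h)) * A).
have pi0 : pi != 0 :> R by rewrite gt_eqF// pi_gt0.
have t0 : tt h != 0 by rewrite gt_eqF.
have dg : is_derive h 1 g (- r * g h).
  have d4 : is_derive h 1 (fun k : R => 4 * pi * tt k) (4 * pi * t').
    by have := is_derive_affine t t' h => ?; apply: is_derive_eq.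
  pose G (k : R) := 4 * pi * tt k * cosh_sqrt 1 (ssq (tt k) (ll k)).
  have d5 : is_derive h 1 G _ := is_deriveM d4 d3.
  have g0 : G h != 0 by rewrite !mulf_neq0.
  have := is_deriveV g0 d5; congr is_derive.
  rewrite /G /GRing.scale/= /r /g /= /coth_sqrt; clearbody A.
  by move: pi0; move: (pi : R) => p p0; field; rewrite t0 E1 p0.
have dgn : is_derive h 1 (fun k => g k ^+ n) (- n%:R * r * g h ^+ n).
  have -> : (fun k => g k ^+ n) = g ^+ n.
    by apply/funext => k; elim: (n) => // i IH; rewrite !exprS IH.
  have := is_deriveX n dg; congr is_derive.
  by rewrite /GRing.scale/=; case: (n) => [|n']; rewrite ?exprS/=; ring.
have := is_deriveM d2 dgn; congr is_derive.
by rewrite /weight /Sdlog /r /g /A /= /GRing.scale/=; ring.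
Qed.

End path.

End symbols.

(** * Polynomials against exponentials, E_1 and the dominating function *)

Section elementary_bounds.
Context {R : realType}.

Lemma exprD1_le k (y : R) : 0 <= y -> (1 + y) ^+ k <= 2 ^+ k * (1 + y ^+ k).
Proof.
move=> y0; have [y1|y1] := leP y 1.
  apply: (@le_trans _ _ (2 ^+ k)); first by apply: lerXn2r; rewrite ?nnegrE; lra.
  by rewrite ler_peMr ?exprn_ge0// lerDl exprn_ge0.
apply: (@le_trans _ _ ((2 * y) ^+ k)); first by apply: lerXn2r; rewrite ?nnegrE; lra.
by rewrite exprMn ler_wpM2l ?exprn_ge0// lerDr.
Qed.

Lemma expR_ge_pow k (u : R) : 0 <= u -> (u / k.+1%:R) ^+ k.+1 <= expR u.
Proof.
move=> u0; have -> : expR u = expR (u / k.+1%:R) ^+ k.+1.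
  by rewrite -expRM_natl mulrC divfK// pnatr_eq0.
apply: lerXn2r; rewrite ?nnegrE ?expR_ge0 ?divr_ge0//.
by apply: le_trans (expR_ge1Dx _); rewrite lerDr.
Qed.

Lemma pow_expRN_bounded k (c : R) : 0 < c ->
  exists2 C, 0 <= C & forall y, 0 <= y -> (1 + y) ^+ k * expR (- (c * y)) <= C.
Proof.
move=> c0.
have d0 : 0 <= (k.+1%:R / c) ^+ k.+1 by rewrite exprn_ge0// divr_ge0// ltW.
exists (2 ^+ k.+1 * (1 + (k.+1%:R / c) ^+ k.+1)) => [|y y0].
  by rewrite mulr_ge0 ?exprn_ge0// addr_ge0.
rewrite expRN ler_pdivrMr ?expR_gt0//.
apply: (@le_trans _ _ ((1 + y) ^+ k.+1)).
  by rewrite exprS ler_peMl ?exprn_ge0 ?lerDl ?addr_ge0.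
apply: (le_trans (exprD1_le _ y0)); rewrite -mulrA ler_wpM2l ?exprn_ge0//.
rewrite mulrDl mul1r lerD//.
  by apply: le_trans (expR_ge1Dx _); rewrite lerDl mulr_ge0// ltW.
have -> : y ^+ k.+1 = (k.+1%:R / c) ^+ k.+1 * (c * y / k.+1%:R) ^+ k.+1.
  have D0 : k.+1%:R != 0 :> R by rewrite pnatr_eq0.
  rewrite -exprMn; congr (_ ^+ _); move: D0; move: (k.+1%:R : R) => D D0.
  by field; rewrite D0 gt_eqF.
by rewrite ler_wpM2l// expR_ge_pow// mulr_ge0// ltW.
Qed.

(** The k-th term of the series of E_1 at t^2 y is at least c y^k as soon as t >= a, so C does not
    depend on t. *)
Lemma pow_le_cosh_sqrt k (a : R) : 0 < a ->
  exists2 C, 0 <= C & forall t y, a <= t -> 0 <= y ->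
    (1 + y) ^+ k <= C * cosh_sqrt 1 (t ^+ 2 * y).
Proof.
move=> a0; pose c := cosh_sqrt_coef 1 k * (a ^+ 2) ^+ k : R.
have c0 : 0 < c by rewrite mulr_gt0 ?cosh_sqrt_coef_gt0// !exprn_gt0.
exists (2 ^+ k * (1 + c^-1)) => [|t y at_ y0].
  by rewrite mulr_ge0 ?exprn_ge0// addr_ge0// invr_ge0 ltW.
have s0 : 0 <= t ^+ 2 * y by rewrite mulr_ge0 ?sqr_ge0.
apply: (le_trans (exprD1_le _ y0)); rewrite -mulrA ler_wpM2l ?exprn_ge0//.
rewrite mulrDl mul1r lerD ?cosh_sqrt_ge1// mulrC ler_pdivlMr//.
apply: le_trans (ge_cosh_sqrt 1 k s0).
rewrite /c mulrCA ler_pM2l ?cosh_sqrt_coef_gt0// -exprMn.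
rewrite mulrC; apply: lerXn2r.
- by rewrite nnegrE mulr_ge0// exprn_ge0// ltW.
- by rewrite nnegrE.
rewrite ler_wpM2r//.
by apply: lerXn2r; rewrite ?nnegrE; lra.
Qed.

Lemma jprod_gt0 d (v : 'rV[R]_d) : 0 < jprod v.
Proof. by apply: prodr_gt0 => i _; rewrite invr_gt0 ltr_pwDl ?sqr_ge0. Qed.

(** Factor by factor, as each v_i^2 is at most |v|^2: d powers of 1 + |v|^2 can be traded for an
    integrable function. *)
Lemma jprod_lower d (v : 'rV[R]_d) : 1 <= (1 + dotv v v) ^+ d * jprod v.
Proof.
rewrite -[d in (_ ^+ d)]card_ord -prodr_const /jprod -big_split/=.
elim/big_ind : _ => // [p q p1 q1|i _].
  by rewrite -[1]mul1r ler_pM.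
rewrite ler_pdivlMr ?mul1r ?lerD2l ?coord_sqr_le//.
by rewrite ltr_pwDl ?sqr_ge0.
Qed.

Lemma jprod_shift d (v w : 'rV[R]_d) : (forall i, `|w 0 i| <= 1) ->
  jprod (v + w) <= 3 ^+ d * jprod v.
Proof.
move=> w1; rewrite -[d in (_ ^+ d)]card_ord -prodr_const /jprod -big_split/=.
apply: ler_prod => i _; rewrite invr_ge0 addr_ge0 ?sqr_ge0//= mxE.
have p u : 0 < 1 + u ^+ 2 :> R by rewrite ltr_pwDl ?sqr_ge0.
rewrite -div1r ler_pdivrMr// mulrAC ler_pdivlMr// mul1r.
have := w1 i; rewrite ler_norml => /andP[h1 h2].
have h3 : w 0 i ^+ 2 <= 1 by nra.
(* Completing the square: 3 (1 + (v+w)^2) - (1 + v^2) = 2 (v + 3w/2)^2 + 2 - 3w^2/2, which is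
   nonnegative when w^2 <= 1. *)
have := sqr_ge0 (v 0 i + 3 / 2 * w 0 i); nra.
Qed.

End elementary_bounds.

(** * The class of integrals: domination, derivatives, integration by parts *)

Section integrands.
Context {R : realType} {N m : nat}.
Variable n : nat.
Implicit Types (t : R) (x : 'rV[R]_N) (z l : 'rV[R]_m).
Local Notation symb := (@symb R N m).
Implicit Types (e : symb) (q : symb * symb).

Definition integrand q t x z l : R :=
  (seval t x l q.1 * cos (dotv l z) + seval t x l q.2 * sin (dotv l z)) *
  weight n t x l.

(** Derivative of e times the weight, divided by the weight. *)
Definition Sderw t' (x' : 'rV[R]_N) (l' : 'rV[R]_m) e : symb :=
  SAdd (Sder t' x' l' e) (SMul e (Sdlog n t' x' l')).

Lemma seval_Sderw t x l t' x' l' e : seval t x l (Sderw t' x' l' e) =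
  seval t x l (Sder t' x' l' e) + seval t x l e * seval t x l (Sdlog n t' x' l').
Proof. by []. Qed.

(* derivative of the integrand in the parameters (t, x, z) *)
Definition Spar t' (x' : 'rV[R]_N) (z' : 'rV[R]_m) q : symb * symb :=
  (SAdd (Sderw t' x' 0 q.1) (SMul (SLdot z') q.2),
   SAdd (Sderw t' x' 0 q.2) (SMul (SMul (SCst (-1)) (SLdot z')) q.1)).

Definition Sfreq (l' : 'rV[R]_m) q : symb * symb :=
  (Sderw 0 0 l' q.1, Sderw 0 0 l' q.2).

(** Derivative of q.1 cos + q.2 sin with respect to the phase. *)
Definition Srot q : symb * symb := (q.2, SMul (SCst (-1)) q.1).

Lemma is_derive_integrand q t t' x x' z z' l l' (h : R) : 0 < t + h * t' ->
  is_derive h 1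
    (fun h => integrand q (t + h * t') (x + h *: x') (z + h *: z') (l + h *: l'))
    (((seval (t + h * t') (x + h *: x') (l + h *: l') (Sderw t' x' l' q.1) +
       (dotv (l + h *: l') z' + dotv l' (z + h *: z')) *
         seval (t + h * t') (x + h *: x') (l + h *: l') q.2) *
      cos (dotv (l + h *: l') (z + h *: z')) +
      (seval (t + h * t') (x + h *: x') (l + h *: l') (Sderw t' x' l' q.2) -
       (dotv (l + h *: l') z' + dotv l' (z + h *: z')) *
         seval (t + h * t') (x + h *: x') (l + h *: l') q.1) *
      sin (dotv (l + h *: l') (z + h *: z'))) *
     weight n (t + h * t') (x + h *: x') (l + h *: l')).
Proof.
move=> th0.
have d1 := is_derive_seval x x' l l' q.1 th0.
have d2 := is_derive_seval x x' l l' q.2 th0.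
have dw := is_derive_weight n x x' l l' th0.
have dp : is_derive h 1 (fun h => dotv (l + h *: l') (z + h *: z'))
    (dotv (l + h *: l') z' + dotv l' (z + h *: z')).
  rewrite (_ : (fun _ => _) = fun h => dotv l z + h * (dotv l z' + dotv l' z) + h ^+ 2 * dotv l' z').
    by apply: is_derive_eq; rewrite !(dotvDl, dotvDr, dotvZl, dotvZr) /GRing.scale/=; ring.
  by apply/funext => k; rewrite !(dotvDl, dotvDr, dotvZl, dotvZr); ring.
have dc := @is_derive1_comp _ (@cos R) _ h _ _ (is_derive_cos _) dp.
have ds := @is_derive1_comp _ (@sin R) _ h _ _ (is_derive_sin _) dp.
have := is_deriveM (is_deriveD (is_deriveM d1 dc) (is_deriveM d2 ds)) dw.
congr is_derive; rewrite !seval_Sderw; move: (seval _ _ _ (Sdlog _ _ _ _)) => D.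
by rewrite !fctE /GRing.scale/=; move: (weight _ _ _ _) => W; ring.
Qed.

Lemma is_derive_integrand_par q t t' x x' z z' l (h : R) : 0 < t + h * t' ->
  is_derive h 1 (fun h => integrand q (t + h * t') (x + h *: x') (z + h *: z') l)
    (integrand (Spar t' x' z' q) (t + h * t') (x + h *: x') (z + h *: z') l).
Proof.
move=> th0; have := @is_derive_integrand q t t' x x' z z' l 0 h th0.
rewrite scaler0 addr0 dotv0l addr0; congr is_derive.
  by apply/funext => k; rewrite scaler0 addr0.
by rewrite /integrand /= !seval_Ldot !(dotvC _ l); ring.
Qed.

Lemma is_derive_integrand_freq q t x z l l' (h : R) : 0 < t ->
  is_derive h 1 (fun h => integrand q t x z (l + h *: l'))
    (integrand (Sfreq l' q) t x z (l + h *: l') +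
     dotv l' z * integrand (Srot q) t x z (l + h *: l')).
Proof.
move=> t0; have := @is_derive_integrand q t 0 x 0 z 0 l l' h.
rewrite !scaler0 !mulr0 !addr0 dotv0r add0r => /(_ t0); congr is_derive.
  by apply/funext => k; rewrite !scaler0 !mulr0 !addr0.
by rewrite /integrand /=; ring.
Qed.

(** Polynomial growth in x and l, uniform for t in a compact interval; the only atoms that are not
    coordinates, constants or powers of t are the Q_k, bounded by 1 + s. *)
Lemma seval_bound e (a b : R) : 0 < a -> a <= b ->
  exists C k, 0 <= C /\ forall t x l, a <= t <= b ->
    `|seval t x l e| <= C * ((1 + dotv x x) * (1 + dotv l l)) ^+ k.
Proof.
move=> a0 ab; have b0 : 0 < b by exact: lt_le_trans ab.
have M1 x l : 1 <= (1 + dotv x x) * (1 + dotv l l).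
  have := dotv_ge0 x; have := dotv_ge0 l; nra.
have M0 x l : 0 <= (1 + dotv x x) * (1 + dotv l l) by exact: le_trans (M1 _ _).
elim: e => [c|||i|j|k|e1 [C1 [k1 [C10 h1]]] e2 [C2 [k2 [C20 h2]]]
               |e1 [C1 [k1 [C10 h1]]] e2 [C2 [k2 [C20 h2]]]].
- by exists `|c|, 0%N; split => // t x l _; rewrite expr0 mulr1.
- exists b, 0%N; split => [|t x l /andP[at_ tb]]; first exact: ltW.
  by rewrite expr0 mulr1 /= ger0_norm// (le_trans (ltW a0)).
- exists a^-1, 0%N; split => [|t x l /andP[at_ tb]]; first by rewrite invr_ge0 ltW.
  have t0 : 0 < t by exact: lt_le_trans at_.
  by rewrite expr0 mulr1 /= ger0_norm ?invr_ge0 ?(ltW t0)// lef_pV2.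
- exists 1, 1%N; split => // t x l _; rewrite mul1r expr1 /=.
  have := dotv_ge0 l; have := coord_sqr_le x i; have := sqr_ge0 (`|x 0 i| - 1).
  rewrite sqrrB1 real_normK ?num_real// => *; nra.
- exists 1, 1%N; split => // t x l _; rewrite mul1r expr1 /=.
  have := dotv_ge0 x; have := coord_sqr_le l j; have := sqr_ge0 (`|l 0 j| - 1).
  rewrite sqrrB1 real_normK ?num_real// => *; nra.
- exists (1 + b ^+ 2), 1%N; split => [|t x l /andP[at_ tb]].
    by rewrite addr_ge0// sqr_ge0.
  have s0 := ssq_ge0 t l.
  rewrite expr1 /= ger0_norm ?coth_sqrt_ge0//.
  apply: le_trans (coth_sqrt_le k s0) _; rewrite /ssq.
  have : t ^+ 2 <= b ^+ 2.
    by apply: lerXn2r; rewrite // nnegrE ltW// (lt_le_trans a0).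
  have := dotv_ge0 l; have := dotv_ge0 x; have := sqr_ge0 t.
  move: (dotv l l) (dotv x x) (t ^+ 2) (b ^+ 2) => L X T B T0 X0 L0 TB.
  have h1 : T * L <= B * L by rewrite ler_wpM2r.
  have B0 : 0 <= B by exact: le_trans TB.
  have h2 : 0 <= X * ((1 + B) * (1 + L)) by rewrite !mulr_ge0 ?addr_ge0.
  lra.
- exists (C1 + C2), (k1 + k2)%N; split => [|t x l tab]; first exact: addr_ge0.
  apply: (le_trans (ler_normD _ _)); rewrite mulrDl exprD lerD//.
    by apply: (le_trans (h1 _ _ _ tab)); rewrite ler_wpM2l// ler_peMr ?exprn_ge0// exprn_ege1.
  by apply: (le_trans (h2 _ _ _ tab)); rewrite ler_wpM2l// ler_peMl ?exprn_ge0// exprn_ege1.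
- exists (C1 * C2), (k1 + k2)%N; split => [|t x l tab]; first exact: mulr_ge0.
  by rewrite /= normrM exprD mulrACA ler_pM ?h1 ?h2.
Qed.

Lemma weight_ge0 t x l : 0 < t -> 0 <= weight n t x l.
Proof.
move=> t0; rewrite mulr_ge0 ?expR_ge0// exprn_ge0// invr_ge0.
by rewrite !mulr_ge0 ?pi_ge0 ?(ltW t0)// cosh_sqrt_ge0// ssq_ge0.
Qed.

Hypothesis n_gt0 : (0 < n)%N.

(** Since Q_0 >= 1, the exponential is at most exp (- |x|^2 / (4 b)) and absorbs the powers of |x|.
    One of the n factors 1/E_1 absorbs the powers of |l|, together with m more of them that produce
    [jprod]; the remaining factors 1/E_1 are at most 1. *)
Lemma weight_bound k (a b : R) : 0 < a -> a <= b ->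
  exists2 C, 0 <= C & forall t x l, a <= t <= b ->
    ((1 + dotv x x) * (1 + dotv l l)) ^+ k * weight n t x l <= C * jprod l.
Proof.
move=> a0 ab; have b0 : 0 < b by exact: lt_le_trans ab.
have b4 : 0 < (4 * b)^-1 by rewrite invr_gt0 mulr_gt0.
have [C1 C10 h1] := pow_expRN_bounded k b4.
have [C2 C20 h2] := pow_le_cosh_sqrt (k + m) a0.
pose c := ((4 * pi * a)^-1) ^+ n : R.
have c0 : 0 <= c by rewrite exprn_ge0// invr_ge0 !mulr_ge0 ?pi_ge0// ltW.
exists (C1 * (C2 * c)) => [|t x l /andP[at_ tb]]; first by rewrite !mulr_ge0.
have t0 : 0 < t by exact: lt_le_trans at_.
have s0 := ssq_ge0 t l; have E1 := cosh_sqrt_ge1 s0.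
have E0 : 0 < cosh_sqrt 1 (ssq t l) by exact: lt_le_trans E1.
have X0 := dotv_ge0 x; have L0 := dotv_ge0 l.
rewrite /weight exprMn.
have w1 : (1 + dotv x x) ^+ k * expR (seval t x l Sphase) <= C1.
  apply: le_trans (h1 _ X0); rewrite ler_wpM2l ?exprn_ge0 ?addr_ge0// ler_expR.
  rewrite /= seval_XX mulNr lerN2 invfM -mulrA ler_wpM2l ?invr_ge0//.
  have q1 := coth_sqrt0_ge1 s0.
  apply: (@le_trans _ _ (dotv x x / t)); last by rewrite ler_peMl// divr_ge0// ltW.
  by rewrite mulrC ler_wpM2l// lef_pV2.
have w2 : (1 + dotv l l) ^+ k * ((4 * pi * t * cosh_sqrt 1 (ssq t l))^-1) ^+ n <=
    C2 * c * jprod l.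
  have le1 : ((4 * pi * t * cosh_sqrt 1 (ssq t l))^-1) ^+ n <=
      c * (cosh_sqrt 1 (ssq t l))^-1.
    rewrite invfM exprMn; apply: ler_pM.
    - by rewrite exprn_ge0// invr_ge0 !mulr_ge0 ?pi_ge0// ltW.
    - by rewrite exprn_ge0// invr_ge0 ltW.
    - apply: lerXn2r; rewrite ?nnegrE ?invr_ge0 ?mulr_ge0 ?pi_ge0 ?(ltW t0) ?(ltW a0)//.
      rewrite lef_pV2 ?posrE ?mulr_gt0 ?pi_gt0// ler_wpM2l// mulr_ge0// pi_ge0//.
    - rewrite -(prednK n_gt0) exprS ler_piMr ?invr_ge0 ?(ltW E0)//.
      by rewrite exprn_ile1// ?invr_ge0 ?(ltW E0)// invf_le1.
  have le2 : (1 + dotv l l) ^+ k <= C2 * cosh_sqrt 1 (ssq t l) * jprod l.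
    apply: (@le_trans _ _ ((1 + dotv l l) ^+ (k + m) * jprod l)).
      by rewrite exprD -mulrA ler_peMr ?exprn_ge0 ?addr_ge0 ?jprod_lower.
    by rewrite ler_wpM2r ?jprod_ge0// h2.
  apply: (@le_trans _ _ (C2 * cosh_sqrt 1 (ssq t l) * jprod l *
      (c * (cosh_sqrt 1 (ssq t l))^-1))).
    apply: ler_pM => //; first by rewrite exprn_ge0// addr_ge0.
    by rewrite exprn_ge0// invr_ge0 !mulr_ge0 ?pi_ge0 ?(ltW t0) ?(ltW E0).
  rewrite le_eqVlt; apply/orP; left; apply/eqP.
  by field; rewrite gt_eqF.
have -> : C1 * (C2 * c) * jprod l = C1 * (C2 * c * jprod l) by ring.
rewrite mulrACA; apply: ler_pM => //.
- by rewrite mulr_ge0 ?expR_ge0 ?exprn_ge0 ?addr_ge0.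
- rewrite mulr_ge0 ?exprn_ge0 ?addr_ge0// invr_ge0.
  by rewrite !mulr_ge0 ?pi_ge0 ?(ltW t0) ?(ltW E0).
Qed.

(** The bound is free of x and z: this makes every integral of the class bounded on the whole group,
    once its symbols include the required powers of the coordinates. *)
Lemma integrand_bound q (a b : R) : 0 < a -> a <= b ->
  exists2 C, 0 <= C & forall t x z l, a <= t <= b ->
    `|integrand q t x z l| <= C * jprod l.
Proof.
move=> a0 ab; have [C1 [k1 [C10 h1]]] := seval_bound q.1 a0 ab.
have [C2 [k2 [C20 h2]]] := seval_bound q.2 a0 ab.
have [D1 D10 w1] := weight_bound k1 a0 ab.
have [D2 D20 w2] := weight_bound k2 a0 ab.
exists (C1 * D1 + C2 * D2) => [|t x z l tab]; first by rewrite addr_ge0 ?mulr_ge0.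
have t0 : 0 < t by case/andP: tab => at_ _; exact: lt_le_trans at_.
have W0 := weight_ge0 x l t0.
have bnd (e : symb) (C D u : R) k : 0 <= C -> `|u| <= 1 ->
    `|seval t x l e| <= C * ((1 + dotv x x) * (1 + dotv l l)) ^+ k ->
    ((1 + dotv x x) * (1 + dotv l l)) ^+ k * weight n t x l <= D * jprod l ->
    `|seval t x l e * u| * weight n t x l <= C * D * jprod l.
  move=> C0 u1 he hw; rewrite -[C * D * _]mulrA.
  apply: (@le_trans _ _ (C * (((1 + dotv x x) * (1 + dotv l l)) ^+ k * weight n t x l))).
    rewrite mulrA ler_wpM2r// normrM; apply: le_trans he.
    by rewrite ler_piMr.
  by rewrite ler_wpM2l.
rewrite normrM (ger0_norm W0).
apply: (@le_trans _ _ (`|seval t x l q.1 * cos (dotv l z)| * weight n t x l +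
    `|seval t x l q.2 * sin (dotv l z)| * weight n t x l)).
  by rewrite -mulrDl ler_wpM2r// ler_normD.
rewrite mulrDl lerD//.
  by apply: bnd; [exact: C10|rewrite ler_norml cos_geN1 cos_le1|exact: h1|exact: w1].
by apply: bnd; [exact: C20|rewrite ler_norml sin_geN1 sin_le1|exact: h2|exact: w2].
Qed.

Section joint_measurability.
Context d (Y : measurableType d) (fx : Y -> 'rV[R]_N) (fz fl : Y -> 'rV[R]_m).
Hypotheses (mx : forall i, measurable_fun setT (fun y => fx y 0 i))
  (mz : forall j, measurable_fun setT (fun y => fz y 0 j))
  (ml : forall j, measurable_fun setT (fun y => fl y 0 j)).

Lemma measurable_ssq t : measurable_fun setT (fun y => ssq t (fl y)).
Proof.
by apply: measurable_funM => //; apply: measurable_sum => j; exact: measurable_funM.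
Qed.

Lemma measurable_seval t e : measurable_fun setT (fun y => seval t (fx y) (fl y) e).
Proof.
elim: e => //= [k|e1 h1 e2 h2|e1 h1 e2 h2].
- apply: measurable_coth_sqrt => [|w]; last exact: ssq_ge0.
  exact: measurable_ssq.
- exact: measurable_funD.
- exact: measurable_funM.
Qed.

Lemma measurable_weight t : measurable_fun setT (fun y => weight n t (fx y) (fl y)).
Proof.
apply: measurable_funM.
  by apply: measurableT_comp => //; exact: measurable_seval.
apply: measurable_funX.
(* E_1 is known to be nonzero for s >= 0, whence the truncation at 0. *)
rewrite (_ : (fun _ => _) = (fun y => (4 * pi * t)^-1 *
   ((fun s => (cosh_sqrt 1 (Num.max s 0))^-1) \o (fun y => ssq t (fl y))) y)); last first.
  by apply/funext => w /=; rewrite max_l ?ssq_ge0// invfM.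
apply: measurable_funM => //; apply: measurableT_comp; last exact: measurable_ssq.
apply: continuous_measurable_fun => s.
have m0 : 0 <= Num.max s 0 by rewrite le_max lexx orbT.
apply: cvgV; first by rewrite gt_eqF// (lt_le_trans ltr01)// cosh_sqrt_ge1.
apply: continuous_cvg; first exact: continuous_cosh_sqrt.
by apply: continuous_max; [exact: cvg_id|exact: cvg_cst].
Qed.

Lemma measurable_integrand q t :
  measurable_fun setT (fun y => integrand q t (fx y) (fz y) (fl y)).
Proof.
have md : measurable_fun setT (fun y => dotv (fl y) (fz y)).
  by apply: measurable_sum => j; exact: measurable_funM.
apply: measurable_funM; last exact: measurable_weight.
apply: measurable_funD; apply: measurable_funM; try exact: measurable_seval.
  apply: (measurableT_comp _ md); apply: continuous_measurable_fun.
  exact: continuous_cos.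
apply: (measurableT_comp _ md); apply: continuous_measurable_fun.
exact: continuous_sin.
Qed.

End joint_measurability.

Lemma measurable_integrand_tuple q t x z : measurable_fun [set: m.-tuple R]
  (fun w : m.-tuple R => integrand q t x z (rV_of_tuple w)).
Proof. by apply: measurable_integrand => // j; exact: measurable_coord. Qed.

Lemma integrable_le_jprod (f : m.-tuple R -> R) (C : R) :
  measurable_fun setT f -> (forall w, `|f w| <= C * jprod (rV_of_tuple w)) ->
  (lebesgue_tuple m).-integrable setT (EFin \o f).
Proof.
move=> mf fC.
have iG : (lebesgue_tuple m).-integrable setT
    (fun w => (C * jprod (rV_of_tuple w))%:E).
  by under eq_fun do rewrite EFinM; apply: integrableZl => //; exact: integrable_jprod.
apply: (le_integrable measurableT _ _ iG) => [|w _]; first exact/measurable_EFinP.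
rewrite lee_fin; apply: (le_trans (fC w)); exact: ler_norm.
Qed.

Lemma integrable_integrand q t x z : 0 < t ->
  (lebesgue_tuple m).-integrable setT
    (fun w => (integrand q t x z (rV_of_tuple w))%:E).
Proof.
move=> t0; have [C C0 h] := integrand_bound q t0 (lexx t).
apply: (integrable_le_jprod (measurable_integrand_tuple q t x z)) => w.
by apply: h; rewrite !lexx.
Qed.

Definition Pint q t x z : R :=
  \int[lebesgue_tuple m]_w integrand q t x z (rV_of_tuple w).

Lemma PintE q1 q2 t x z :
  (forall l, integrand q1 t x z l = integrand q2 t x z l) ->
  Pint q1 t x z = Pint q2 t x z.
Proof. by move=> h; apply: eq_Rintegral => w _. Qed.

Definition Sadd q1 q2 : symb * symb := (SAdd q1.1 q2.1, SAdd q1.2 q2.2).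
Definition Smul e q : symb * symb := (SMul e q.1, SMul e q.2).

Lemma integrandD q1 q2 t x z l : integrand (Sadd q1 q2) t x z l =
  integrand q1 t x z l + integrand q2 t x z l.
Proof. by rewrite /integrand /=; ring. Qed.

Lemma integrandM e q t x z l : integrand (Smul e q) t x z l =
  seval t x l e * integrand q t x z l.
Proof. by rewrite /integrand /=; ring. Qed.

Lemma PintD q1 q2 t x z : 0 < t ->
  Pint (Sadd q1 q2) t x z = Pint q1 t x z + Pint q2 t x z.
Proof.
move=> t0; rewrite /Pint -RintegralD//; [|exact: integrable_integrand..].
by apply: eq_Rintegral => w _; rewrite integrandD.
Qed.

Lemma PintZ e c q t x z : 0 < t -> (forall l, seval t x l e = c) ->
  Pint (Smul e q) t x z = c * Pint q t x z.
Proof.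
move=> t0 ec; rewrite /Pint -RintegralZl//; last exact: integrable_integrand.
by apply: eq_Rintegral => w _; rewrite integrandM ec.
Qed.

Lemma Pint_bound q (a b : R) : 0 < a -> a <= b ->
  exists2 C, 0 <= C & forall t x z, a <= t <= b -> `|Pint q t x z| <= C.
Proof.
move=> a0 ab; have [C C0 h] := integrand_bound q a0 ab.
exists (C * \int[lebesgue_tuple m]_w jprod (rV_of_tuple w)) => [|t x z tab].
  by rewrite mulr_ge0// Rintegral_ge0// => w _; exact: jprod_ge0.
have t0 : 0 < t by case/andP: tab => at_ _; exact: lt_le_trans at_.
have iq := integrable_integrand q x z t0.
apply: (le_trans (le_normr_Rintegral measurableT iq)).
rewrite -RintegralZl//; last exact: integrable_jprod.
apply: le_Rintegral => //.
- by have := integrable_abse iq.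
- by under [X in _.-integrable _ X]eq_fun do rewrite /= EFinM; apply: integrableZl => //; exact: integrable_jprod.
- by move=> w _; exact: h.
Qed.

Lemma is_derive_Pint q t t' x x' z z' : 0 < t ->
  is_derive (0 : R) 1 (fun h => Pint q (t + h * t') (x + h *: x') (z + h *: z'))
    (Pint (Spar t' x' z' q) t x z).
Proof.
move=> t0.
(* For |h| < r the time t + h t' stays in [t/2, 3t/2], where one dominating function serves; the 1
   allows t' = 0. *)
pose r := t / 2 / (1 + `|t'|).
have r0 : 0 < r by rewrite !divr_gt0// ltr_pwDl.
have rt h : `|h| < r -> t / 2 <= t + h * t' <= t + t / 2.
  move=> hr; have : `|h * t'| <= t / 2.
    rewrite normrM; apply: (@le_trans _ _ (r * (1 + `|t'|))).
      by apply: ler_pM => //; [exact: ltW|rewrite lerDr].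
    by rewrite /r divfK// gt_eqF// ltr_pwDl.
  by rewrite ler_norml => /andP[]; lra.
have t20 : 0 < t / 2 by rewrite divr_gt0.
have t2t : t / 2 <= t + t / 2 by lra.
have [C C0 hC] := integrand_bound (Spar t' x' z' q) t20 t2t.
have rt0 h : `|h| < r -> 0 < t + h * t'.
  by move=> /rt /andP[+ _]; exact: lt_le_trans.
have := @is_derive_under_integral _ _ _ (lebesgue_tuple m)
  (fun h w => integrand q (t + h * t') (x + h *: x') (z + h *: z') (rV_of_tuple w))
  (fun h w => integrand (Spar t' x' z' q) (t + h * t') (x + h *: x') (z + h *: z') (rV_of_tuple w))
  (fun w => C * jprod (rV_of_tuple w)) r r0.
rewrite mul0r !scale0r !addr0; apply.
- by move=> h w hr; exact/is_derive_integrand_par/rt0.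
- by move=> h hr; exact/integrable_integrand/rt0.
- by under [X in _.-integrable _ X]eq_fun do rewrite /= EFinM; apply: integrableZl => //; exact: integrable_jprod.
- by move=> h w hr; exact/hC/rt.
Qed.

(* Lebesgue measure being invariant under translations of l, the derivatives
   in l integrate to 0. *)
Lemma Pint_by_parts q t x z l' : 0 < t ->
  dotv l' z * Pint (Srot q) t x z = - Pint (Sfreq l' q) t x z.
Proof.
move=> t0; apply/eqP; rewrite -addr_eq0; apply/eqP.
(* S bounds the coordinates of l', so for |h| < r the shift h l' stays in the unit box, as
   [jprod_shift] requires. *)
pose S := 1 + \sum_j `|l' 0 j|; pose r := S^-1.
have S0 : 0 < S by rewrite ltr_pwDl// sumr_ge0.
have r0 : 0 < r by rewrite invr_gt0.
have l'S j : `|l' 0 j| <= S.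
  by rewrite /S (bigD1 j)//= addrCA lerDl addr_ge0// sumr_ge0.
have [C C0 hC] := integrand_bound (Sfreq l' q) t0 (lexx t).
have [D D0 hD] := integrand_bound (Srot q) t0 (lexx t).
have shift h w : rV_of_tuple w + h *: l' = rV_of_tuple
    (affine_tuple 1 [tuple h * l' 0 i | i < m] w) :> 'rV[R]_m.
  by apply/rowP => i; rewrite !mxE !tnth_mktuple mul1r.
have ma h := @measurable_affine_tuple R m 1 [tuple h * l' 0 i | i < m].
have jh h w : `|h| < r -> jprod (rV_of_tuple w + h *: l') <= 3 ^+ m * jprod (rV_of_tuple w).
  move=> h1; apply: jprod_shift => i; rewrite mxE normrM.
  by rewrite -(mulVf (lt0r_neq0 S0)) ler_pM// ltW.
have mshift q' h : measurable_fun [set: m.-tuple R]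
    (fun w : m.-tuple R => integrand q' t x z (rV_of_tuple w + h *: l')).
  under eq_fun do rewrite shift.
  exact: (measurableT_comp (measurable_integrand_tuple q' t x z) (ma h)).
have const h : \int[lebesgue_tuple m]_w integrand q t x z (rV_of_tuple w + h *: l') =
    Pint q t x z.
  rewrite /Pint [RHS](@Rintegral_tuple_affine _ m 1 [tuple h * l' 0 i | i < m])//.
    by rewrite normr1 expr1n mul1r; apply: eq_Rintegral => w _; rewrite shift.
  exact: integrable_integrand.
pose G (w : m.-tuple R) : R := (C + `|dotv l' z| * D) * 3 ^+ m * jprod (rV_of_tuple w).
have iG : (lebesgue_tuple m).-integrable setT (EFin \o G).
  rewrite /G; under [X in _.-integrable _ X]eq_fun do rewrite /= EFinM.
  by apply: integrableZl => //; exact: integrable_jprod.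
have [E E0 hE] := integrand_bound q t0 (lexx t).
have d h (w : m.-tuple R) (_ : `|h| < r) :=
  is_derive_integrand_freq q x z (rV_of_tuple w) l' h t0.
have int h : `|h| < r -> (lebesgue_tuple m).-integrable setT
    (EFin \o (fun w : m.-tuple R => integrand q t x z (rV_of_tuple w + h *: l'))).
  move=> h1; apply: (@integrable_le_jprod _ (E * 3 ^+ m)) => // w.
  apply: (@le_trans _ _ (E * jprod (rV_of_tuple w + h *: l'))).
    by apply: hE; rewrite !lexx.
  by rewrite -mulrA ler_wpM2l// jh.
have bnd h (w : m.-tuple R) : `|h| < r ->
    `|integrand (Sfreq l' q) t x z (rV_of_tuple w + h *: l') +
      dotv l' z * integrand (Srot q) t x z (rV_of_tuple w + h *: l')| <= G w.
  move=> h1; apply: (@le_trans _ _ ((C + `|dotv l' z| * D) * jprod (rV_of_tuple w + h *: l'))).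
    apply: (le_trans (ler_normD _ _)); rewrite mulrDl lerD ?hC ?lexx//.
    by rewrite normrM -mulrA ler_wpM2l// hD// !lexx.
  by rewrite /G -mulrA ler_wpM2l ?jh// addr_ge0// mulr_ge0.
have := is_derive_under_integral r0 d int iG bnd.
rewrite (_ : (fun h => _) = fun=> Pint q t x z); last by apply/funext => h; exact: const.
move=> [_]; rewrite derive_cst => /esym H.
have iS := integrable_integrand (Sfreq l' q) x z t0.
have iR := integrable_integrand (Srot q) x z t0.
have icR : (lebesgue_tuple m).-integrable setT
    (fun w => (dotv l' z * integrand (Srot q) t x z (rV_of_tuple w))%:E).
  by under eq_fun do rewrite EFinM; exact: integrableZl.
rewrite addrC.
transitivity (\int[lebesgue_tuple m]_w (integrand (Sfreq l' q) t x z (rV_of_tuple w) +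
    dotv l' z * integrand (Srot q) t x z (rV_of_tuple w))).
  by rewrite (RintegralD measurableT iS icR) (RintegralZl _ measurableT iR).
apply: etrans H.
by apply: eq_Rintegral => w _; rewrite scale0r addr0.
Qed.

End integrands.

(** * Continuity of the integrals in the parameters *)

Section integrand_continuity.
Context {R : realType} {N m : nat}.
Variable n : nat.
Local Notation symb := (@symb R N m).

Section at_point.
Context {V : topologicalType} (ft : V -> R) (fx : V -> 'rV[R]_N) (fz : V -> 'rV[R]_m) (v0 : V).
Hypotheses (ct : {for v0, continuous ft})
  (cx : forall i, {for v0, continuous (fun v => fx v 0 i)})
  (cz : forall j, {for v0, continuous (fun v => fz v 0 j)})
  (t0 : 0 < ft v0).

Lemma continuous_ssq (l : 'rV[R]_m) : {for v0, continuous (fun v => ssq (ft v) l)}.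
Proof.
have -> : (fun v => ssq (ft v) l) = (fun v => ft v * ft v * dotv l l).
  by apply/funext => v; rewrite /ssq expr2.
by apply: cvgM; [exact: cvgM|exact: cvg_cst].
Qed.

Lemma continuous_seval l (e : symb) :
  {for v0, continuous (fun v => seval (ft v) (fx v) l e)}.
Proof.
elim: e => /= [c|||i|j|k|a IHa b IHb|a IHa b IHb].
- exact: cvg_cst.
- exact: ct.
- by apply: cvgV => //; rewrite gt_eqF.
- exact: cx.
- exact: cvg_cst.
- apply: (@continuous_comp _ _ _ (fun v => ssq (ft v) l) (coth_sqrt k)).
    exact: continuous_ssq.
  exact: continuous_coth_sqrt (ssq_ge0 _ _).
- exact: cvgD.
- exact: cvgM.
Qed.

Lemma continuous_weight (l : 'rV[R]_m) :
  {for v0, continuous (fun v => weight n (ft v) (fx v) l)}.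
Proof.
apply: cvgM.
  apply: continuous_cvg; first exact: continuous_expR.
  exact: continuous_seval.
suff H : (4 * pi * ft v * cosh_sqrt 1 (ssq (ft v) l))^-1 @[v --> v0] -->
    (4 * pi * ft v0 * cosh_sqrt 1 (ssq (ft v0) l))^-1.
  exact: (cvg_comp _ _ H (@exprn_continuous R n _)).
apply: cvgV.
  rewrite !mulf_neq0 ?gt_eqF ?pi_gt0//.
  by rewrite (lt_le_trans ltr01)// cosh_sqrt_ge1// ssq_ge0.
apply: cvgM; first by apply: cvgM; [exact: cvg_cst|exact: ct].
apply: continuous_cvg; first exact: continuous_cosh_sqrt.
exact: continuous_ssq.
Qed.

Lemma continuous_integrand q l :
  {for v0, continuous (fun v => integrand n q (ft v) (fx v) (fz v) l)}.
Proof.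
have cd : {for v0, continuous (fun v => dotv l (fz v))}.
  apply: cvg_big => [|j _]; first exact: add_continuous.
  by apply: cvgM; [exact: cvg_cst|exact: cz].
apply: cvgM; last exact: continuous_weight.
apply: cvgD; apply: cvgM; try exact: continuous_seval.
  by apply: continuous_cvg => //; exact: continuous_cos.
by apply: continuous_cvg => //; exact: continuous_sin.
Qed.

End at_point.

Hypothesis n_gt0 : (0 < n)%N.

Lemma continuous_Pint {V : pseudoMetricType R} (ft : V -> R) (fx : V -> 'rV[R]_N)
    (fz : V -> 'rV[R]_m) (v0 : V) q :
  {for v0, continuous ft} ->
  (forall i, {for v0, continuous (fun v => fx v 0 i)}) ->
  (forall j, {for v0, continuous (fun v => fz v 0 j)}) ->
  0 < ft v0 ->
  {for v0, continuous (fun v => Pint n q (ft v) (fx v) (fz v))}.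
Proof.
move=> ct cx cz t0.
have a0 : 0 < ft v0 / 2 by rewrite divr_gt0.
have ab : ft v0 / 2 <= ft v0 + ft v0 / 2 by lra.
have [C C0 hC] := integrand_bound n_gt0 q a0 ab.
have near_t : \forall v \near v0, ft v0 / 2 <= ft v <= ft v0 + ft v0 / 2.
  have /cvgrPdist_lt/(_ _ a0) := ct; apply: filterS => v.
  by rewrite ltr_norml => /andP[h1 h2]; apply/andP; split; lra.
apply: (@continuous_under_integral _ _ _ (lebesgue_tuple m) V
  (fun v w => integrand n q (ft v) (fx v) (fz v) (rV_of_tuple w)) v0
  (fun w => C * jprod (rV_of_tuple w))).
- by move=> w; exact: continuous_integrand.
- by move=> v; exact: measurable_integrand_tuple.
- under [X in _.-integrable _ X]eq_fun do rewrite /= EFinM.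
  by apply: integrableZl => //; exact: integrable_jprod.
- by near=> v => w; apply: hC; near: v.
Unshelve. all: by end_near. Qed.

End integrand_continuity.

(** * Smoothness, and multiplication by coordinates *)

Section smoothness.
Context {R : realType} {N m : nat}.
Variable n : nat.
Hypothesis n_gt0 : (0 < n)%N.
Local Notation symb := (@symb R N m).

Lemma is_derive_line (V : normedModType R) (f : V -> R) (x v : V) (df : R) :
  is_derive (0 : R) 1 (fun h : R => f (x + h *: v)) df -> is_derive x v f df.
Proof.
have e : (fun h : R => h^-1 *: (((fun h => f (x + h *: v)) \o shift 0) (h *: (1 : R)) -
    f (x + 0 *: v))) = (fun h => h^-1 *: ((f \o shift x) (h *: v) - f x)).
  apply/funext => h /=; rewrite addr0 scale0r addr0 [h *: 1]mulr1.
  by rewrite (addrC x).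
by move=> [dv dE]; split; [move: dv|rewrite -dE]; rewrite /derivable /derive e.
Qed.

Section affine_parameters.
Context {d : nat} (ft ft' : 'rV[R]_d -> R) (fx : 'rV[R]_d -> 'rV[R]_N)
  (fz : 'rV[R]_d -> 'rV[R]_m).
Hypotheses (ftE : forall v u (h : R), ft (v + h *: u) = ft v + h * ft' u)
  (fxE : forall v u (h : R), fx (v + h *: u) = fx v + h *: fx u)
  (fzE : forall v u (h : R), fz (v + h *: u) = fz v + h *: fz u)
  (ct : continuous ft) (cx : forall i, continuous (fun v => fx v 0 i))
  (cz : forall j, continuous (fun v => fz v 0 j)).

Lemma near_ft_gt0 v : 0 < ft v -> \forall w \near v, 0 < ft w.
Proof. by have h : ft w @[w --> v] --> ft v := @ct v; move=> v0; exact: (cvgr_gt (ft v) h _ v0). Qed.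

(** Taking for the time an affine function with linear part ft' covers two situations at once: time
    as one of the coordinates (ft' = ft), and a fixed time (ft' = 0). *)
Lemma is_derive_Pint_dir q v u : 0 < ft v ->
  is_derive v u (fun w => Pint n q (ft w) (fx w) (fz w))
    (Pint n (Spar n (ft' u) (fx u) (fz u) q) (ft v) (fx v) (fz v)).
Proof.
move=> v0; apply: is_derive_line.
rewrite (_ : (fun _ => _) = fun h => Pint n q (ft v + h * ft' u) (fx v + h *: fx u)
  (fz v + h *: fz u)); first exact: is_derive_Pint.
by apply/funext => h; rewrite ftE fxE fzE.
Qed.

Variables (F : 'rV[R]_d -> R) (q : symb * symb).
Hypothesis FE : forall v, 0 < ft v -> F v = Pint n q (ft v) (fx v) (fz v).

Lemma partials_Pint s : exists q',
  forall v, 0 < ft v -> partials s F v = Pint n q' (ft v) (fx v) (fz v).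
Proof.
elim: s => [|i s [q' IH]]; first by exists q.
exists (Spar n (ft' (delta_mx 0 i)) (fx (delta_mx 0 i)) (fz (delta_mx 0 i)) q') => v v0.
rewrite /= /partial (@near_eq_derive _ _ _ _ (fun w => Pint n q' (ft w) (fx w) (fz w))).
  by have [] := is_derive_Pint_dir q' (delta_mx 0 i) v0.
by near=> w; apply: IH; near: w; exact: near_ft_gt0.
Unshelve. all: by end_near. Qed.

Lemma smooth_Pint s v : 0 < ft v ->
  {for v, continuous (partials s F)} /\
  forall i : 'I_d, derivable (partials s F) v (delta_mx 0 i).
Proof.
move=> v0; have [q' E] := partials_Pint s.
have nE : \forall w \near v, Pint n q' (ft w) (fx w) (fz w) = partials s F w.
  by near=> w; rewrite E//; near: w; exact: near_ft_gt0.
split=> [|i].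
  have cP : {for v, continuous (fun w => Pint n q' (ft w) (fx w) (fz w))}.
    have := @continuous_Pint R N m n n_gt0 'rV[R]_d ft fx fz v q'.
    by apply => // [|i|j]; [exact: ct|exact: cx|exact: cz].
  rewrite /prop_for /continuous_at E//.
  exact: cvg_trans (near_eq_cvg nE) cP.
apply: (near_eq_derivable nE).
by have [] := is_derive_Pint_dir q' (delta_mx 0 i) v0.
Unshelve. all: by end_near. Qed.

End affine_parameters.

Section multipliers.
Local Notation G := 'rV[R]_(N + m).

(** The symbol q' is chosen before t and g, so the uniform bounds on q' become bounds on the product
    with M. *)
Definition multiplier (M : G -> R) := forall q, exists q', forall t g, 0 < t ->
  M g * Pint n q t (lsubmx g) (rsubmx g) = Pint n q' t (lsubmx g) (rsubmx g).

Lemma multiplier_cst c : multiplier (fun=> c).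
Proof.
move=> q; exists (Smul (SCst c) q) => t g t0.
by rewrite (@PintZ _ _ _ _ n_gt0 _ c).
Qed.

Lemma multiplierD M1 M2 : multiplier M1 -> multiplier M2 ->
  multiplier (fun g => M1 g + M2 g).
Proof.
move=> h1 h2 q; have [q1 e1] := h1 q; have [q2 e2] := h2 q.
by exists (Sadd q1 q2) => t g t0; rewrite mulrDl e1// e2// PintD.
Qed.

Lemma multiplierM M1 M2 : multiplier M1 -> multiplier M2 ->
  multiplier (fun g => M1 g * M2 g).
Proof.
move=> h1 h2 q; have [q2 e2] := h2 q; have [q1 e1] := h1 q2.
by exists q1 => t g t0; rewrite -mulrA e2// e1.
Qed.

Lemma multiplier_exp M k : multiplier M -> multiplier (fun g => M g ^+ k).
Proof.
move=> h; elim: k => [|k IH]; first exact: multiplier_cst.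
by under [X in multiplier X]eq_fun do rewrite exprS; exact: multiplierM.
Qed.

Lemma multiplier_prod k (M : 'I_k -> G -> R) : (forall i, multiplier (M i)) ->
  multiplier (fun g => \prod_i M i g).
Proof.
move=> h; elim: k M h => [|k IH] M h.
  by under [X in multiplier X]eq_fun do rewrite big_ord0; exact: multiplier_cst.
under [X in multiplier X]eq_fun do rewrite big_ord_recl.
apply: multiplierM => //; exact: (IH (fun i => M (lift ord0 i))).
Qed.

(** A coordinate of x is itself a symbol; a coordinate of z is traded for a frequency derivative by
    integration by parts. *)
Lemma multiplier_coord i : multiplier (fun g => g 0 i).
Proof.
case: (split_ordP i) => j -> q.
  exists (Smul (SX j) q) => t g t0.
  by rewrite (@PintZ _ _ _ _ n_gt0 _ (g 0 (lshift m j)))// => l; rewrite /= mxE.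
(* Chosen so that its quarter turn [Srot q1] has the integrand of q. *)
pose q1 := (SMul (SCst (-1)) q.2, q.1).
exists (Smul (SCst (-1)) (Sfreq n (delta_mx 0 j) q1)) => t g t0.
rewrite (@PintZ _ _ _ _ n_gt0 _ (-1))// mulN1r -Pint_by_parts//.
rewrite dotvC dotv_delta mxE; congr (_ * _); apply: PintE => l.
by rewrite /integrand /=; ring.
Qed.

Lemma multiplier_bound M q (a b : R) : multiplier M -> 0 < a -> a <= b ->
  exists2 C, 0 <= C & forall t g, a <= t <= b ->
    `|M g * Pint n q t (lsubmx g) (rsubmx g)| <= C.
Proof.
move=> h a0 ab; have [q' e] := h q.
have [C C0 hC] := Pint_bound n_gt0 q' a0 ab.
exists C => // t g tab; rewrite e ?hC//.
by case/andP: tab => at_ _; exact: lt_le_trans at_.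
Qed.

(** The polynomial 1 / [jprod] is a multiplier, so its product with the integral is bounded. This
    gives integrability over the group. *)
Lemma Pint_le_jprod q t : 0 < t -> exists2 C, 0 <= C & forall g : G,
  `|Pint n q t (lsubmx g) (rsubmx g)| <= C * jprod g.
Proof.
move=> t0.
have mM : multiplier (fun g => \prod_i (1 + g 0 i ^+ 2)).
  apply: multiplier_prod => i; apply: multiplierD; first exact: multiplier_cst.
  exact/multiplier_exp/multiplier_coord.
have [C C0 hC] := multiplier_bound q mM t0 (lexx t).
have p0 (g : G) i : 0 < 1 + g 0 i ^+ 2 by rewrite ltr_pwDl ?sqr_ge0.
exists C => // g; have := hC t g; rewrite !lexx => /(_ isT).
rewrite normrM gtr0_norm ?prodr_gt0// => h.
by rewrite /jprod prodfV ler_pdivlMr ?prodr_gt0// mulrC.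
Qed.

End multipliers.

End smoothness.

(** * Values of differentiated symbols *)

Section symbol_derivatives.
Context {R : realType} {N m : nat}.
Variable n : nat.
Local Notation symb := (@symb R N m).
Implicit Types (e : symb) (t : R) (x : 'rV[R]_N) (z l : 'rV[R]_m).

Lemma Sder_sum t' x' l' k (F : 'I_k -> symb) :
  Sder t' x' l' (Ssum F) = Ssum (fun i => Sder t' x' l' (F i)).
Proof. exact: (big_morph (Sder t' x' l')). Qed.

Lemma seval_Sder_Ldot t x l t' x' l' v :
  seval t x l (Sder t' x' l' (SLdot v)) = dotv v l'.
Proof.
rewrite Sder_sum seval_sum; apply: eq_bigr => j _ /=.
by rewrite mul0r add0r.
Qed.

Lemma seval_Sder_XX t x l t' x' l' :
  seval t x l (Sder t' x' l' SXX) = 2 * dotv x x'.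
Proof.
rewrite Sder_sum seval_sum /dotv mulr_sumr; apply: eq_bigr => j _ /=; ring.
Qed.

Lemma seval_Sdlog t x l t' x' l' : 0 < t -> seval t x l (Sdlog n t' x' l') =
  - 4^-1 * ((2 * t' * t * dotv l l + 2 * t ^+ 2 * dotv l' l) * 2^-1 *
              (1 - coth_sqrt 0 (ssq t l) * coth_sqrt 2 (ssq t l)) * dotv x x / t +
            coth_sqrt 0 (ssq t l) * (2 * dotv x x' / t - dotv x x * t' / t ^+ 2)) -
  n%:R * (t' / t + 2^-1 * coth_sqrt 2 (ssq t l) *
            (2 * t' * t * dotv l l + 2 * t ^+ 2 * dotv l' l)).
Proof.
move=> t0; rewrite /Sdlog /=.
rewrite !seval_XX !seval_Sder_XX !seval_LL !seval_Ldot.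
rewrite coth_sqrt1 ?ssq_ge0//.
by field; rewrite gt_eqF.
Qed.

Lemma integrand_Spar t' x' z' q t x z l : integrand n (Spar n t' x' z' q) t x z l =
  ((seval t x l (Sderw n t' x' 0 q.1) + dotv z' l * seval t x l q.2) * cos (dotv l z) +
   (seval t x l (Sderw n t' x' 0 q.2) - dotv z' l * seval t x l q.1) * sin (dotv l z)) *
  weight n t x l.
Proof.
rewrite -(seval_Ldot t x l z') /integrand /Spar.
move: (Sderw n t' x' 0 q.1) (Sderw n t' x' 0 q.2) (SLdot z') => a b c /=; ring.
Qed.

(** The derivative in the zero direction is not syntactically zero; only its value is. *)
Lemma seval_Sder0 t x l e : seval t x l (Sder 0 0 0 e) = 0.
Proof.
elim: e => //= [|i|j|k|a -> b ->|a -> b ->].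
- by rewrite oppr0 mul0r.
- by rewrite mxE.
- by rewrite mxE.
- by rewrite seval_LL seval_Ldot dotv0l !(mul0r, mulr0, addr0).
- by rewrite addr0.
- by rewrite mul0r mulr0 addr0.
Qed.

Lemma seval_Sderw0 t x l e : 0 < t -> seval t x l (Sderw n 0 0 0 e) = 0.
Proof.
move=> t0; rewrite seval_Sderw seval_Sder0 seval_Sdlog// dotv0l dotv0r.
by rewrite !(mulr0, mul0r, addr0, subr0, oppr0).
Qed.

Definition Psum k (F : 'I_k -> symb * symb) : symb * symb :=
  (Ssum (fun i => (F i).1), Ssum (fun i => (F i).2)).

Lemma integrand_sum k (F : 'I_k -> symb * symb) t x z l :
  integrand n (Psum F) t x z l = \sum_i integrand n (F i) t x z l.
Proof.
by rewrite /integrand /= !seval_sum -mulr_suml big_split /= -!mulr_suml.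
Qed.

(** Symbols with equal values have derivatives with equal values, by uniqueness of derivatives.
    Hence a first derivative may be replaced by a simplified symbol before it is differentiated
    again. *)
Lemma seval_Sder_ext e1 e2 t' x' l' :
  (forall t x l, 0 < t -> seval t x l e1 = seval t x l e2) ->
  forall t x l, 0 < t -> seval t x l (Sder t' x' l' e1) = seval t x l (Sder t' x' l' e2).
Proof.
move=> e12 t x l t0.
have t00 : 0 < t + 0 * t' by rewrite mul0r addr0.
have d1 := is_derive_seval x x' l l' e1 t00.
have d2 := is_derive_seval x x' l l' e2 t00.
have near_t : \forall h \near (0 : R), 0 < t + h * t'.
  have h : (fun h : R => t + h * t') h @[h --> (0 : R)] --> t + 0 * t'.
    by apply: cvgD; [exact: cvg_cst|apply: cvgMr_tmp; exact: cvg_id].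
  exact: (cvgr_gt _ h _ t00).
have d3 : is_derive (0 : R) 1 (fun h => seval (t + h * t') (x + h *: x') (l + h *: l') e2)
    (seval (t + 0 * t') (x + 0 *: x') (l + 0 *: l') (Sder t' x' l' e1)).
  apply: near_eq_is_derive d1; near=> h; apply: e12; near: h; exact: near_t.
have := @derive_val _ _ _ _ _ _ _ d2; rewrite (@derive_val _ _ _ _ _ _ _ d3).
by rewrite mul0r !scale0r !addr0.
Unshelve. all: by end_near. Qed.

Hypothesis n_gt0 : (0 < n)%N.

Lemma Pint_sum k (F : 'I_k -> symb * symb) t x z : 0 < t ->
  Pint n (Psum F) t x z = \sum_i Pint n (F i) t x z.
Proof.
move=> t0; elim: k F => [|k IH] F.
  rewrite big_ord0 /Pint; under eq_Rintegral do rewrite integrand_sum big_ord0.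
  by rewrite Rintegral_cst// mul0r.
rewrite big_ord_recl -IH -PintD//; apply: PintE => l.
by rewrite integrandD !integrand_sum big_ord_recl.
Qed.

End symbol_derivatives.

(** * The heat equation under the integral *)

Section heat_equation.
Context {R : realType} {n m : nat}.
Hypothesis n_gt0 : (0 < n)%N.
Local Notation G := 'rV[R]_(n.*2 + m).
Variable br : {bilinear G -> G -> G}.
Local Notation symb := (@symb R n.*2 m).

Let e_ (i : 'I_n.*2) : G := delta_mx 0 (lshift m i).
Let u_ (j : 'I_m) : G := delta_mx 0 (rshift n.*2 j).

Definition Pg (q : symb * symb) t (g : G) : R := Pint n q t (xpart g) (zpart g).

Lemma is_derive_Pg q t (g u : G) : 0 < t ->
  is_derive g u (Pg q t) (Pg (Spar n 0 (xpart u) (zpart u) q) t g).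
Proof.
move=> t0.
apply: (@is_derive_Pint_dir R n.*2 m n n_gt0 (n.*2 + m) (fun=> t) (fun=> 0) xpart zpart) => //.
- by move=> v w h; rewrite mulr0 addr0.
- by move=> v w h; rewrite /xpart linearD linearZ.
- by move=> v w h; rewrite /zpart linearD linearZ.
Qed.

(** The i-th coordinate of J_l x, expanded over the structure constants as a bilinear symbol in x
    and l. *)
Definition Jcoef (i : 'I_n.*2) : symb :=
  Ssum (fun j => Ssum (fun k => SMul (SCst (dotv (u_ j) (br (e_ k) (e_ i))))
    (SMul (SX k) (SL j)))).

Lemma row_mx_l_sum x : row_mx x 0 = \sum_k x 0 k *: e_ k :> G.
Proof.
rewrite [LHS]row_sum_delta big_split_ord /= [X in _ + X]big1 ?addr0 => [|j _].
  by apply: eq_bigr => k _; rewrite row_mxEl.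
by rewrite row_mxEr mxE scale0r.
Qed.

Lemma row_mx_r_sum l : row_mx 0 l = \sum_j l 0 j *: u_ j :> G.
Proof.
rewrite [LHS]row_sum_delta big_split_ord /= [X in X + _]big1 ?add0r => [|j _].
  by apply: eq_bigr => k _; rewrite row_mxEr.
by rewrite row_mxEl mxE scale0r.
Qed.

Lemma dotv_suml d k (c : 'I_k -> R) (v : 'I_k -> 'rV[R]_d) w :
  dotv (\sum_i c i *: v i) w = \sum_i c i * dotv (v i) w.
Proof.
rewrite (big_morph (dotv^~ w) (fun u v => dotvDl u v w) (dotv0l w)).
by apply: eq_bigr => i _; rewrite dotvZl.
Qed.

Lemma seval_Jcoef t x l i : seval t x l (Jcoef i) =
  dotv (row_mx 0 l) (br (row_mx x 0) (e_ i)).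
Proof.
rewrite row_mx_r_sum dotv_suml seval_sum; apply: eq_bigr => j _.
rewrite row_mx_l_sum linear_sumlz /= (dotvC (u_ j)) seval_sum.
under [X in _ * dotv X _]eq_bigr do rewrite linearZl_LR.
rewrite dotv_suml mulr_sumr; apply: eq_bigr => k _ /=.
by rewrite (dotvC (u_ j)); ring.
Qed.

(** Action of X_i on symbols: a derivative in z_j multiplies by l_j and makes a quarter turn, so the
    z-part of X_i amounts to half of (J_l x)_i times that turn. *)
Definition XP (i : 'I_n.*2) (q : symb * symb) : symb * symb :=
  (SAdd (Sderw n 0 (delta_mx 0 i) 0 q.1) (SMul (SCst 2^-1) (SMul (Jcoef i) q.2)),
   SAdd (Sderw n 0 (delta_mx 0 i) 0 q.2) (SMul (SCst (- 2^-1)) (SMul (Jcoef i) q.1))).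

Lemma Xfield_Pg i q t g : 0 < t -> Xfield br i (Pg q t) g = Pg (XP i q) t g.
Proof.
move=> t0; rewrite /Xfield.
have -> : 'D_(e_ i) (Pg q t) g = Pg (Spar n 0 (delta_mx 0 i) 0 q) t g.
  have [_ ->] := is_derive_Pg q g (e_ i) t0.
  rewrite /e_ /xpart /zpart delta_mx_lshift row_mxKl row_mxKr.
  by congr (Pg (Spar _ _ _ _ _)).
pose c j := dotv (Jmap br (u_ j) (row_mx (xpart g) 0)) (e_ i).
pose dz j : symb * symb := (SMul (SL j) q.2, SMul (SCst (-1)) (SMul (SL j) q.1)).
have D j : 'D_(u_ j) (Pg q t) g = Pg (dz j) t g.
  have [_ ->] := is_derive_Pg q g (u_ j) t0.
  rewrite /u_ /xpart /zpart delta_mx_rshift row_mxKl row_mxKr.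
  apply: PintE => l; rewrite integrand_Spar !seval_Sderw0// dotvC dotv_delta.
  by rewrite /integrand /=; ring.
under eq_bigr do rewrite D.
have -> : 2^-1 * (\sum_j c j * Pg (dz j) t g) =
    Pg (Psum (fun j => Smul (SCst (2^-1 * c j)) (dz j))) t g.
  rewrite /Pg Pint_sum// mulr_sumr; apply: eq_bigr => j _.
  by rewrite (@PintZ _ _ _ _ n_gt0 _ (2^-1 * c j))// mulrA.
rewrite /Pg -PintD//; apply: PintE => l.
rewrite integrandD integrand_sum integrand_Spar dotv0l.
have cJ : \sum_j c j * l 0 j = seval t (xpart g) l (Jcoef i).
  rewrite seval_Jcoef row_mx_r_sum dotv_suml; apply: eq_bigr => j _.
  by rewrite /c Jmap_dotv mulrC.
rewrite /XP /integrand.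
move: (Sderw n 0 _ 0 q.1) (Sderw n 0 _ 0 q.2) => a b /=; rewrite -cJ.
have -> : \sum_j (2^-1 * c j * (l 0 j * seval t (xpart g) l q.2) * cos (dotv l (zpart g)) +
    2^-1 * c j * (-1 * (l 0 j * seval t (xpart g) l q.1)) * sin (dotv l (zpart g))) *
    weight n t (xpart g) l =
  2^-1 * (\sum_j c j * l 0 j) * (seval t (xpart g) l q.2 * cos (dotv l (zpart g)) -
    seval t (xpart g) l q.1 * sin (dotv l (zpart g))) * weight n t (xpart g) l.
  rewrite mulr_sumr !mulr_suml; apply: eq_bigr => j _; ring.
move: (\sum_j _) => S; ring.
Qed.

Hypothesis hbr : is_Htype_realization br.

Lemma Jcoef_Jmap t x l i : seval t x l (Jcoef i) =
  Jmap br (row_mx 0 l) (row_mx x 0) 0 (lshift m i).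
Proof. by rewrite seval_Jcoef mxE. Qed.

Lemma lie_centerE g : lie_center br g <-> xpart g = 0.
Proof. by case: hbr => _ ->. Qed.

(** Orthogonality of J is assumed for unit vectors only: l = 0 is treated apart, and otherwise l is
    normalized, J being linear in l. *)
Lemma sum_Jcoef_sqr t x l :
  \sum_i seval t x l (Jcoef i) ^+ 2 = dotv l l * dotv x x.
Proof.
have [[lie _ iso] cE] := hbr.
pose J := Jmap br (row_mx 0 l) (row_mx x 0).
have JJ : \sum_i seval t x l (Jcoef i) ^+ 2 = dotv J J.
  rewrite /dotv big_split_ord /= [X in _ + X]big1 ?addr0 => [|j _].
    by apply: eq_bigr => i _; rewrite Jcoef_Jmap expr2.
  (* J_l x is orthogonal to the center, so its first 2n coordinates carry its whole norm. *)
  have : dotv J (u_ j) = 0.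
    apply: (Jmap_orthoc _ _ lie); apply/lie_centerE.
    by rewrite /u_ /xpart delta_mx_rshift row_mxKl.
  by rewrite dotv_delta => ->; rewrite mulr0.
have dot_l (u v : 'rV[R]_m) : dotv (row_mx 0 u : G) (row_mx 0 v) = dotv u v.
  rewrite /dotv big_split_ord /= big1 ?add0r => [|i _].
    by apply: eq_bigr => i _; rewrite !row_mxEr.
  by rewrite !row_mxEl mxE mul0r.
have dot_x (u v : 'rV[R]_n.*2) : dotv (row_mx u 0 : G) (row_mx v 0) = dotv u v.
  rewrite /dotv big_split_ord /= [X in _ + X]big1 ?addr0 => [|i _].
    by apply: eq_bigr => i _; rewrite !row_mxEl.
  by rewrite !row_mxEr mxE mul0r.
rewrite JJ; have [l0|l0] := eqVneq (dotv l l) 0.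
  rewrite l0 mul0r /dotv big1// => i _.
  have -> : J 0 i = 0; last by rewrite mul0r.
  have lE : l = 0.
    apply/rowP => j; rewrite mxE; apply/eqP; rewrite -sqrf_eq0 eq_le sqr_ge0 andbT.
    by rewrite -l0 coord_sqr_le.
  by rewrite mxE lE row_mx0 dotv0l.
have lp : 0 < dotv l l by rewrite lt0r l0 dotv_ge0.
pose r := enorm l; have r0 : 0 < r by rewrite sqrtr_gt0.
have Jr : J = r *: Jmap br (row_mx 0 (r^-1 *: l)) (row_mx x 0).
  apply/rowP => i; rewrite !mxE -dotvZl; congr dotv.
  by rewrite scale_row_mx scaler0 scalerA divff ?gt_eqF// scale1r.
rewrite Jr dotvZl dotvZr iso.
- by rewrite dot_x mulrA -expr2 sqr_enorm.
- by apply/lie_centerE; rewrite /xpart row_mxKl.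
- rewrite /enorm dot_l dotvZl dotvZr mulrA -invfM -expr2 sqr_enorm mulVf//.
  by rewrite sqrtr1.
- move=> z; rewrite lie_centerE => z0.
  by rewrite -(hsubmxK z) [lsubmx z]z0 /dotv big_split_ord /= !big1 ?addr0 // => i _;
    rewrite ?row_mxEl ?row_mxEr mxE ?mulr0 ?mul0r.
- move=> z; rewrite lie_centerE => z0.
  by rewrite -(hsubmxK z) [lsubmx z]z0 /dotv big_split_ord /= !big1 ?addr0 // => i _;
    rewrite ?row_mxEl ?row_mxEr mxE ?mulr0 ?mul0r.
Qed.

(** The pairing of J_l x with x is that of l with [x, x] = 0. *)
Lemma sum_Jcoef_X t x l : \sum_i seval t x l (Jcoef i) * x 0 i = 0.
Proof.
have [[[alt _] _ _] _] := hbr.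
transitivity (dotv (row_mx 0 l) (br (row_mx x 0) (row_mx x 0))); last by rewrite alt dotv0r.
rewrite [X in br _ X]row_mx_l_sum linear_sumr /= dotvC.
under [X in dotv X _]eq_bigr do rewrite linearZr_LR.
rewrite dotv_suml; apply: eq_bigr => i _.
by rewrite seval_Jcoef mulrC dotvC.
Qed.

(** The trace of J_l: its i-th diagonal entry pairs l with [e_i, e_i] = 0. *)
Lemma sum_Jcoef_der t x l :
  \sum_i seval t x l (Sder 0 (delta_mx 0 i) 0 (Jcoef i)) = 0.
Proof.
have [[[alt _] _ _] _] := hbr.
apply: big1 => i _; rewrite Sder_sum seval_sum big1// => j _.
rewrite Sder_sum seval_sum (bigD1 i)//= big1 => [|k ki].
  by rewrite alt dotv0r !mul0r !addr0.
by rewrite !mxE (negbTE ki) andbF !(mul0r, mulr0, addr0).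
Qed.

(** With K = Q_0, the cosine coefficients of the X_i^2 add up to c (- n K / t + K^2 |x|^2 / (4 t^2)
    - |l|^2 |x|^2 / 4), and the sine coefficients to 0 by the two vanishing sums for J. The time
    derivative of the weight is the same once K is written 1 + t^2 |l|^2 Q_2. *)
Lemma heat_equation_Pg c t g : 0 < t ->
  \sum_i Pg (XP i (XP i (SCst c, SCst 0))) t g =
  Pg (Spar n 1 0 0 (SCst c, SCst 0)) t g.
Proof.
move=> t0; rewrite /Pg -Pint_sum//; apply: PintE => l.
rewrite integrand_sum integrand_Spar dotv0l !mul0r addr0 subr0.
rewrite !seval_Sderw !seval_Sdlog// dotv0l dotv0r.
pose x := xpart g; pose K := coth_sqrt 0 (ssq t l); rewrite -/x.
(* Logarithmic derivative of the weight in x_i, simplified so that the second derivative remains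
   manageable. *)
pose Dg i : symb := SMul (SCst (- 2^-1)) (SMul (SQ 0) (SMul (SX i) STinv)).
have DgE i t1 x1 l1 : 0 < t1 ->
    seval t1 x1 l1 (Sdlog n 0 (delta_mx 0 i) 0) = seval t1 x1 l1 (Dg i).
  move=> t10; rewrite seval_Sdlog// dotv0l dotv_delta /=; field.
  by rewrite gt_eqF.
have SderwE i e1 e2 : (forall t1 x1 l1, 0 < t1 -> seval t1 x1 l1 e1 = seval t1 x1 l1 e2) ->
  seval t x l (Sderw n 0 (delta_mx 0 i) 0 e1) =
  seval t x l (Sder 0 (delta_mx 0 i) 0 e2) + seval t x l e2 * seval t x l (Dg i).
  by move=> e12; rewrite seval_Sderw (seval_Sder_ext _ _ _ e12)// e12// DgE.
have XP1 t1 x1 l1 i q : seval t1 x1 l1 (XP i q).1 =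
    seval t1 x1 l1 (Sderw n 0 (delta_mx 0 i) 0 q.1) +
  2^-1 * (seval t1 x1 l1 (Jcoef i) * seval t1 x1 l1 q.2) by [].
have XP2 t1 x1 l1 i q : seval t1 x1 l1 (XP i q).2 =
    seval t1 x1 l1 (Sderw n 0 (delta_mx 0 i) 0 q.2) +
  - 2^-1 * (seval t1 x1 l1 (Jcoef i) * seval t1 x1 l1 q.1) by [].
have a i : seval t x l (XP i (XP i (SCst c, SCst 0))).1 =
    c * (- 2^-1 * (K / t) + (2^-1 * K / t) ^+ 2 * x 0 i ^+ 2) -
    4^-1 * c * seval t x l (Jcoef i) ^+ 2.
  rewrite XP1 (SderwE i _ (SMul (SCst c) (Dg i))) => [|t1 x1 l1 t10]; last first.
    by rewrite XP1 seval_Sderw DgE//=; ring.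
  have di : (delta_mx 0 i : 'rV[R]_n.*2) 0 i = 1 by rewrite mxE !eqxx.
  rewrite XP2 seval_Sderw DgE//= seval_LL seval_Ldot dotv0l di -/K; field.
  by rewrite gt_eqF.
have b i : seval t x l (XP i (XP i (SCst c, SCst 0))).2 =
    - (2^-1 * c) * seval t x l (Sder 0 (delta_mx 0 i) 0 (Jcoef i)) +
    2^-1 * c * K / t * (seval t x l (Jcoef i) * x 0 i).
  rewrite XP2 (SderwE i _ (SMul (SCst (- (2^-1 * c))) (Jcoef i))) => [|t1 x1 l1 t10]; last first.
    by rewrite XP2 seval_Sderw DgE//=; ring.
  rewrite XP1 seval_Sderw DgE//= -/K; field.
  by rewrite gt_eqF.
have Sa : \sum_i seval t x l (XP i (XP i (SCst c, SCst 0))).1 =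
    c * (- (n%:R * (K / t)) + (2^-1 * K / t) ^+ 2 * dotv x x) - 4^-1 * c * (dotv l l * dotv x x).
  have e2 : t^-1 *+ n.*2 = 2 * n%:R * t^-1.
    by rewrite -[LHS]mulr_natl -(muln2 n) natrM; ring.
  have eX : \sum_i x 0 i ^+ 2 = dotv x x by apply: eq_bigr => i _; rewrite expr2.
  under eq_bigr do rewrite a.
  rewrite sumrB -!mulr_sumr sum_Jcoef_sqr big_split /= -!mulr_sumr sumr_const card_ord.
  rewrite e2 eX; field.
  by rewrite gt_eqF.
have Sb : \sum_i seval t x l (XP i (XP i (SCst c, SCst 0))).2 = 0.
  under eq_bigr do rewrite b.
  by rewrite big_split /= -!mulr_sumr sum_Jcoef_der sum_Jcoef_X !mulr0 addr0.
rewrite /integrand -mulr_suml big_split /= -!mulr_suml Sa Sb.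
have K2 : coth_sqrt 2 (ssq t l) * (t ^+ 2 * dotv l l) = K - 1.
  by rewrite -coth_sqrt2 ?ssq_ge0// mulrC.
rewrite /= -/K; move: K2; clear Sa Sb a b; clearbody K; move: K (coth_sqrt 2 _) (dotv l l) (dotv x x) => K' k2 u v h.
have -> : K' = 1 + k2 * (t ^+ 2 * u) by rewrite h; ring.
by field; rewrite gt_eqF.
Qed.

End heat_equation.

(** * The frequency l = 0 is negligible *)

Section origin.
Context {R : realType}.

Lemma measurable_origin k : measurable [set w : k.-tuple R | rV_of_tuple w = 0].
Proof.
have mf : measurable_fun [set: k.-tuple R] (fun w : k.-tuple R => dotv (rV_of_tuple w) (rV_of_tuple w)).
  by apply: measurable_sum => j; apply: measurable_funM; exact: measurable_coord.
rewrite (_ : [set w | _] = setT `&` (fun w : k.-tuple R =>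
    dotv (rV_of_tuple w) (rV_of_tuple w)) @^-1` [set 0]); first exact: mf.
rewrite setTI; apply/seteqP; split => w /=; first by move=> ->; exact: dotv0l.
move=> w0; apply/rowP => j; rewrite [RHS]mxE; apply/eqP.
by rewrite -sqrf_eq0 eq_le sqr_ge0 andbT -w0 coord_sqr_le.
Qed.

(** The origin lies in the hyperplane where the first coordinate is 0. In dimension 0 the measure is
    a Dirac mass and the claim would fail. *)
Lemma lebesgue_tuple_origin k : (0 < k)%N ->
  lebesgue_tuple k [set w : k.-tuple R | rV_of_tuple w = 0] = 0%E.
Proof.
case: k => // k _; apply/eqP; rewrite eq_le measure_ge0 andbT.
have mc : measurable_fun [set: measurableTypeR R * k.-tuple R] (@tuple_cons R k).
  exact: measurable_tuple_cons.
have le0 : ((@lebesgue_measure R \x lebesgue_tuple k) ([set 0%R] `*` setT) = 0)%E.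
  rewrite product_measure1E//.
  by have /= -> := @lebesgue_measure_set1 R 0; rewrite mul0e.
rewrite -le0; apply: (@le_measure _ _ _ (@lebesgue_measure R \x lebesgue_tuple k)%E
  (@tuple_cons R k @^-1` [set w | rV_of_tuple w = 0]) ([set 0%R] `*` setT)); rewrite ?inE.
- by rewrite -[X in measurable X]setTI; apply: mc => //; exact: measurable_origin.
- exact: measurableX.
- by move=> [a w] /= /rowP/(_ ord0); rewrite !mxE tnth0 /= => a0; split.
Qed.

End origin.

(** * The heat kernel as an integral of the class *)

Section kernel_representation.
Context {R : realType} {n m : nat}.
Hypotheses (n_gt0 : (0 < n)%N) (m_gt0 : (0 < m)%N).
Local Notation G := 'rV[R]_(n.*2 + m).
Local Notation symb := (@symb R n.*2 m).

Definition qcos : symb * symb := (SCst 1, SCst 0).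
Definition qsin : symb * symb := (SCst 0, SCst 1).

Lemma enorm_gt0 d (v : 'rV[R]_d) : v != 0 -> 0 < enorm v.
Proof.
move=> v0; rewrite sqrtr_gt0 lt0r dotv_ge0 andbT; apply: contra v0 => /eqP vv0.
apply/eqP/rowP => j; rewrite mxE; apply/eqP; rewrite -sqrf_eq0 eq_le sqr_ge0 andbT.
by rewrite -vv0 coord_sqr_le.
Qed.

Lemma heat_weight t x (l : 'rV[R]_m) : 0 < t -> l != 0 ->
  expR (- (4^-1 * enorm l * coth (t * enorm l) * enorm x ^+ 2)) *
  (enorm l / (4 * pi * sinh (t * enorm l))) ^+ n = weight n t (x : 'rV[R]_n.*2) l.
Proof.
move=> t0 l0; have r0 := enorm_gt0 l0.
have sE : ssq t l = (t * enorm l) ^+ 2 by rewrite exprMn sqr_enorm.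
have [cE shE] := cosh_sinh_sqrt (t * enorm l).
have E1 : cosh_sqrt 1 (ssq t l) != 0.
  by rewrite gt_eqF// (lt_le_trans ltr01)// cosh_sqrt_ge1// ssq_ge0.
have pi0 : pi != 0 :> R by rewrite gt_eqF// pi_gt0.
have t00 : t != 0 by rewrite gt_eqF.
have r00 : enorm l != 0 by rewrite gt_eqF.
rewrite /weight /= seval_XX; congr (expR _ * _ ^+ _).
  rewrite /coth -cE -shE -sE /coth_sqrt sqr_enorm.
  by field; rewrite E1 t00 r00.
rewrite -shE -sE; move: (pi : R) pi0 => p p0; field.
by rewrite E1 t00 r00 p0.
Qed.

Lemma heat_integrandE t (g : G) l : 0 < t -> l != 0 ->
  complex.Re (heat_integrand t g l) = integrand n qcos t (xpart g) (zpart g) l /\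
  complex.Im (heat_integrand t g l) = integrand n qsin t (xpart g) (zpart g) l.
Proof.
move=> t0 l0; rewrite /integrand -heat_weight// /heat_integrand /cexp /=.
by split; ring.
Qed.

(** The numerator |l| vanishes and n > 0. This differs from the limit as l tends to 0, which
    contains (4 pi t)^-n, so the two integrands agree only away from the origin. *)
Lemma heat_integrand0 t (g : G) : heat_integrand t g 0 = 0.
Proof.
rewrite /heat_integrand /enorm dotv0l sqrtr0 mul0r expr0n gtn_eqF//.
by rewrite mulr0.
Qed.

Lemma Rintegral_origin (f h : m.-tuple R -> R) :
  (forall w, rV_of_tuple w != 0 -> f w = h w) ->
  (forall w, rV_of_tuple w = 0 -> f w = 0) ->
  (lebesgue_tuple m).-integrable setT (EFin \o h) ->
  (lebesgue_tuple m).-integrable setT (EFin \o f) /\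
  \int[lebesgue_tuple m]_w f w = \int[lebesgue_tuple m]_w h w.
Proof.
move=> fh f0 ih.
pose Z := [set w : m.-tuple R | rV_of_tuple w = 0].
have fE : f = fun w => h w * \1_(~` Z) w.
  apply/funext => w; rewrite indicE; have [w0|w0] := eqVneq (rV_of_tuple w) 0.
    by rewrite memNset ?mulr0 ?f0// => h'; apply: h'.
  by rewrite mem_set ?mulr1 ?fh// => h'; move/eqP: w0; apply.
have mh : measurable_fun setT h by have /measurable_int/measurable_EFinP := ih.
have mf : measurable_fun setT f.
  rewrite fE; apply: measurable_funM => //; apply: measurable_indic.
  by apply: measurableC; exact: measurable_origin.
have int_f : (lebesgue_tuple m).-integrable setT (EFin \o f).
  apply: (le_integrable measurableT _ _ ih) => [|w _]; first exact/measurable_EFinP.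
  rewrite lee_fin fE normrM ler_piMr// indicE; case: (_ \in _); by rewrite ?normr1 ?normr0.
split => //; congr fine; apply: ae_eq_integral => //.
- exact/measurable_EFinP.
- exact/measurable_EFinP.
exists Z; split; [exact: measurable_origin|exact: lebesgue_tuple_origin|].
move=> w /= nfh; apply/eqP; apply/negPn/negP => w0; apply: nfh => _.
by rewrite fh.
Qed.

Lemma weight_radial t (x x' : 'rV[R]_n.*2) (l l' : 'rV[R]_m) :
  dotv x x = dotv x' x' -> dotv l l = dotv l' l' -> weight n t x l = weight n t x' l'.
Proof. by move=> xx ll; rewrite /weight /= !seval_XX /ssq xx ll. Qed.

(** The integrand is odd in l; the substitution of - l for l makes the integral equal to its
    opposite. Hence the kernel is real. *)
Lemma Pint_qsin t (x : 'rV[R]_n.*2) z : 0 < t -> Pint n qsin t x z = 0.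
Proof.
move=> t0; pose F (w : m.-tuple R) := integrand n qsin t x z (rV_of_tuple w).
have iF : (lebesgue_tuple m).-integrable setT (EFin \o F).
  exact: integrable_integrand.
have m10 : -1 != 0 :> R by rewrite oppr_eq0 oner_eq0.
have E := Rintegral_tuple_affine [tuple 0 | i < m] m10 iF.
have FN w : F (affine_tuple (-1) [tuple 0 | i < m] w) = -1 * F w.
  have -> : F (affine_tuple (-1) [tuple 0 | i < m] w) =
      integrand n qsin t x z (- rV_of_tuple w).
    congr integrand; apply/rowP => i.
    by rewrite !mxE !tnth_mktuple addr0 mulN1r.
  rewrite /F /integrand (@weight_radial t x x _ (rV_of_tuple w))//.
    have -> : dotv (- rV_of_tuple w) z = - dotv (rV_of_tuple w) z.
      by rewrite -scaleN1r dotvZl mulN1r.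
    by rewrite sinN cosN /=; ring.
  by rewrite -scaleN1r dotvZl dotvZr; ring.
have E' : \int[lebesgue_tuple m]_w F (affine_tuple (-1) [tuple 0 | i < m] w) =
    \int[lebesgue_tuple m]_w (-1 * F w).
  by apply: eq_Rintegral => w _; exact: FN.
move: E; rewrite normrN1 expr1n mul1r E'.
rewrite (RintegralZl _ measurableT iF) -[Pint _ _ _ _ _]/(\int[lebesgue_tuple m]_w F w).
by move: (Rintegral _ _ _) => I; lra.
Qed.

Lemma heat_kernelE t (g : G) : 0 < t ->
  cintegrable (heat_integrand t g) /\
  heat_kernelC t g = (((2 * pi) ^- m * Pint n qcos t (xpart g) (zpart g))%:C)%C.
Proof.
move=> t0; have iC := integrable_integrand n_gt0 qcos (xpart g) (zpart g) t0.
have iS := integrable_integrand n_gt0 qsin (xpart g) (zpart g) t0.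
have [i1 e1] := @Rintegral_origin (fun w => complex.Re (heat_integrand t g (rV_of_tuple w))) _
  (fun w w0 => (heat_integrandE g t0 w0).1)
  (fun w w0 => etrans (congr1 (fun v => complex.Re (heat_integrand t g v)) w0)
     (congr1 (@complex.Re R) (heat_integrand0 t g))) iC.
have [i2 e2] := @Rintegral_origin (fun w => complex.Im (heat_integrand t g (rV_of_tuple w))) _
  (fun w w0 => (heat_integrandE g t0 w0).2)
  (fun w w0 => etrans (congr1 (fun v => complex.Im (heat_integrand t g v)) w0)
     (congr1 (@complex.Im R) (heat_integrand0 t g))) iS.
split; first by split.
rewrite /heat_kernelC /cintegral e1 e2 -/(Pint n qcos _ _ _) -/(Pint n qsin _ _ _).
by rewrite Pint_qsin// rmorphM.
Qed.

End kernel_representation.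

(** * Scaling and radiality *)

Section kernel_symmetries.
Context {R : realType} {n m : nat}.
Hypothesis n_gt0 : (0 < n)%N.
Local Notation symb := (@symb R n.*2 m).
Local Notation qcos := (@qcos R n m).

Lemma weight_scale (a t : R) (x : 'rV[R]_n.*2) (l : 'rV[R]_m) : 0 < a -> 0 < t ->
  weight n (a ^+ 2 * t) (a *: x) (a ^- 2 *: l) = (a ^- 2) ^+ n * weight n t x l.
Proof.
move=> a0 t0; have a1 : a != 0 by rewrite gt_eqF.
have t1 : t != 0 by rewrite gt_eqF.
have sE : ssq (a ^+ 2 * t) (a ^- 2 *: l) = ssq t l.
  by rewrite /ssq dotvZl dotvZr; field.
rewrite /weight /= !seval_XX sE dotvZl dotvZr [RHS]mulrCA -exprMn; congr (expR _ * _ ^+ _).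
  by field; rewrite a1 t1.
by rewrite -invfM; congr (_^-1); move: (pi : R) => p; ring.
Qed.

(** Substitute a^-2 l for l: the Jacobian gives a^(-2m) and the weight a^(-2n), while the phase is
    invariant. *)
Lemma Pint_scale (a t : R) (x : 'rV[R]_n.*2) (z : 'rV[R]_m) : 0 < a -> 0 < t ->
  Pint n qcos t x z =
  a ^+ (2 * (n + m)) * Pint n qcos (a ^+ 2 * t) (a *: x) (a ^+ 2 *: z).
Proof.
move=> a0 t0; have a1 : a != 0 by rewrite gt_eqF.
have at0 : 0 < a ^+ 2 * t by rewrite mulr_gt0// exprn_gt0.
pose F (w : m.-tuple R) :=
  integrand n qcos (a ^+ 2 * t) (a *: x) (a ^+ 2 *: z) (rV_of_tuple w).
have iF : (lebesgue_tuple m).-integrable setT (EFin \o F).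
  exact: integrable_integrand.
have c0 : a ^- 2 != 0 by rewrite invr_eq0 expf_neq0.
have E := Rintegral_tuple_affine [tuple 0 | i < m] c0 iF.
have E' : \int[lebesgue_tuple m]_w F (affine_tuple (a ^- 2) [tuple 0 | i < m] w) =
    \int[lebesgue_tuple m]_w ((a ^- 2) ^+ n * integrand n qcos t x z (rV_of_tuple w)).
  apply: eq_Rintegral => w _.
  have -> : F (affine_tuple (a ^- 2) [tuple 0 | i < m] w) =
      integrand n qcos (a ^+ 2 * t) (a *: x) (a ^+ 2 *: z) (a ^- 2 *: rV_of_tuple w).
    by congr integrand; apply/rowP => i; rewrite !mxE !tnth_mktuple addr0.
  have dE : dotv (a ^- 2 *: rV_of_tuple w) (a ^+ 2 *: z) = dotv (rV_of_tuple w) z.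
    by rewrite dotvZl dotvZr mulrA mulVf ?expf_neq0// mul1r.
  by rewrite /integrand weight_scale// dE /=; ring.
rewrite -[Pint n qcos (a ^+ 2 * t) _ _]/(\int[lebesgue_tuple m]_w F w) E E'.
rewrite RintegralZl//; last exact: integrable_integrand.
rewrite -/(Pint n qcos t x z) ger0_norm ?invr_ge0 ?exprn_ge0 ?ltW//.
rewrite exprM exprD !exprVn; have A0 k : (a ^+ 2) ^+ k != 0 by rewrite !expf_neq0.
by field; rewrite !A0.
Qed.

(* The generator of the rotation in the plane of z and w kills the kernel. *)
Lemma Pint_rotation t (x : 'rV[R]_n.*2) (z w : 'rV[R]_m) : 0 < t ->
  dotv z w = 0 -> 0 < dotv z z -> Pint n (SCst 0, SLdot w) t x z = 0.
Proof.
move=> t0 zw zz.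
(* Parts are integrated with <w, l> cos in direction z and with <z, l> cos in direction w. The
   frequency derivatives coincide because the weight is radial in l; the second boundary factor is
   <w, z> = 0, the first is |z|^2 > 0. *)
have I1 := Pint_by_parts n_gt0 (SLdot w, SCst 0) x z z t0.
have I2 := Pint_by_parts n_gt0 (SLdot z, SCst 0) x z w t0.
move: I2; rewrite (dotvC w) zw mul0r => /esym/eqP; rewrite oppr_eq0 => /eqP I2.
have E : Pint n (Sfreq n z (SLdot w, SCst 0)) t x z =
    Pint n (Sfreq n w (SLdot z, SCst 0)) t x z.
  apply: PintE => l; rewrite /integrand /Sfreq [fst _]/= [snd _]/=.
  rewrite !seval_Sderw !seval_Sdlog// !seval_Sder_Ldot !dotv0r (dotvC w z) zw /=.
  by rewrite !seval_Ldot; ring.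
have h : Pint n (Srot (SLdot w, SCst 0)) t x z = - Pint n (SCst 0, SLdot w) t x z.
  rewrite -mulN1r -(@PintZ _ _ _ _ n_gt0 (SCst (-1)))//; apply: PintE => l.
  by rewrite /integrand /=; ring.
move: I1; rewrite E I2 oppr0 h mulrN => /eqP; rewrite oppr_eq0 mulf_eq0 gt_eqF//=.
by move/eqP.
Qed.

(** The path of z is a circle, not a line, so the general derivative formula does not apply and the
    domination is redone. *)
Lemma is_derive_Pint_rotation t (x : 'rV[R]_n.*2) (z w : 'rV[R]_m) : 0 < t ->
  is_derive (0 : R) 1 (fun h => Pint n qcos t x (cos h *: z + sin h *: w))
    (- Pint n (SCst 0, SLdot w) t x z).
Proof.
move=> t0.
(* Used with z set to 0 in the phase, where the cosine is 1: this bounds the symbol times the weight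
   itself. *)
have [C C0 hC] := integrand_bound n_gt0 ((SLdot z, SCst 0) : symb * symb) t0 (lexx t).
have [D D0 hD] := integrand_bound n_gt0 ((SLdot w, SCst 0) : symb * symb) t0 (lexx t).
pose f (h : R) (v : m.-tuple R) :=
  integrand n qcos t x (cos h *: z + sin h *: w) (rV_of_tuple v).
pose f' (h : R) (v : m.-tuple R) := - sin (dotv (rV_of_tuple v) (cos h *: z + sin h *: w)) *
  (- sin h * dotv (rV_of_tuple v) z + cos h * dotv (rV_of_tuple v) w) *
  weight n t x (rV_of_tuple v).
pose g (v : m.-tuple R) : R := (C + D) * jprod (rV_of_tuple v).
have ig : (lebesgue_tuple m).-integrable setT (EFin \o g).
  rewrite /g; under [X in _.-integrable _ X]eq_fun do rewrite /= EFinM.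
  by apply: integrableZl => //; exact: integrable_jprod.
have df (h : R) v : `|h| < 1 -> is_derive h 1 (f ^~ v) (f' h v).
  move=> _; set l := rV_of_tuple v.
  have dp : is_derive h 1 (fun h : R => dotv l (cos h *: z + sin h *: w))
      (- sin h * dotv l z + cos h * dotv l w).
    rewrite (_ : (fun _ => _) = fun h => cos h * dotv l z + sin h * dotv l w).
      by apply: is_derive_eq; rewrite /GRing.scale/=; ring.
    by apply/funext => k; rewrite dotvDr !dotvZr.
  have dc := @is_derive1_comp _ (@cos R) _ h _ _ (is_derive_cos _) dp.
  rewrite (_ : (f ^~ v) = (fun h => weight n t x l * cos (dotv l (cos h *: z + sin h *: w)))).
    by have := is_deriveZ (weight n t x l) dc; congr is_derive; rewrite /GRing.scale/= /f'; ring.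
  by apply/funext => k; rewrite /f /integrand /=; ring.
have int_f (h : R) : `|h| < 1 -> (lebesgue_tuple m).-integrable setT (EFin \o f h).
  by move=> _; exact: integrable_integrand.
have bnd (h : R) v : `|h| < 1 -> `|f' h v| <= g v.
  move=> _; set l := rV_of_tuple v.
  have W0 := weight_ge0 n x l t0.
  have C1 : `|dotv l z| * weight n t x l <= C * jprod l.
    have := hC t x 0 l; rewrite !lexx => /(_ isT).
    rewrite /integrand dotv0r cos0 sin0 mulr1 mulr0 addr0 normrM (ger0_norm W0).
    by rewrite seval_Ldot dotvC.
  have D1 : `|dotv l w| * weight n t x l <= D * jprod l.
    have := hD t x 0 l; rewrite !lexx => /(_ isT).
    rewrite /integrand dotv0r cos0 sin0 mulr1 mulr0 addr0 normrM (ger0_norm W0).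
    by rewrite seval_Ldot dotvC.
  rewrite /f' normrM (ger0_norm W0) normrM normrN /g.
  apply: (@le_trans _ _ ((`|dotv l z| + `|dotv l w|) * weight n t x l)).
    rewrite ler_wpM2r//.
    apply: (@le_trans _ _ (1 * (`|dotv l z| + `|dotv l w|))); last by rewrite mul1r.
    apply: ler_pM => //; first by rewrite ler_norml sin_geN1 sin_le1.
    apply: (le_trans (ler_normD _ _)); rewrite !normrM normrN lerD//.
      by rewrite ler_piMl// ler_norml sin_geN1 sin_le1.
    by rewrite ler_piMl// ler_norml cos_geN1 cos_le1.
  by rewrite !mulrDl lerD.
have := is_derive_under_integral ltr01 df int_f ig bnd.
congr is_derive.
rewrite -mulN1r -(@PintZ _ _ _ _ n_gt0 (SCst (-1)))//; apply: eq_Rintegral => v _.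
rewrite /f' cos0 sin0 scale1r scale0r addr0 /integrand /= seval_Ldot (dotvC w); ring.
Qed.

Lemma Pint_qcosN t (x : 'rV[R]_n.*2) (z : 'rV[R]_m) :
  Pint n qcos t x (- z) = Pint n qcos t x z.
Proof.
apply: eq_Rintegral => v _; rewrite /integrand -scaleN1r dotvZr mulN1r cosN sinN /=.
by rewrite !mul0r.
Qed.

(** At each angle b the derivative is the one at angle 0 for the rotated frame ([zb], [wb]), again
    orthogonal, so it vanishes. *)
Lemma Pint_circle t (x : 'rV[R]_n.*2) (z w : 'rV[R]_m) (a : R) : 0 < t ->
  dotv z w = 0 -> 0 < dotv z z -> dotv w w = dotv z z ->
  Pint n qcos t x (cos a *: z + sin a *: w) = Pint n qcos t x z.
Proof.
move=> t0 zw zz ww.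
pose F (b : R) := Pint n qcos t x (cos b *: z + sin b *: w).
have dF (b : R) : is_derive b 1 F 0.
  apply: is_derive_line.
  pose zb := cos b *: z + sin b *: w; pose wb := - sin b *: z + cos b *: w.
  have zwb : dotv zb wb = 0.
    by rewrite /zb /wb !(dotvDl, dotvDr, dotvZl, dotvZr) (dotvC w z) zw ww; ring.
  have zzb : dotv zb zb = dotv z z.
    rewrite /zb !(dotvDl, dotvDr, dotvZl, dotvZr) (dotvC w z) zw ww.
    by have := cos2Dsin2 b => h; transitivity ((cos b ^+ 2 + sin b ^+ 2) * dotv z z);
      [ring|rewrite h mul1r].
  have := is_derive_Pint_rotation x zb wb t0.
  rewrite Pint_rotation ?zzb// oppr0; congr is_derive.
  apply/funext => h; rewrite /F; congr Pint.
  rewrite [h *: 1]mulr1 cosD sinD /zb /wb; apply/rowP => j; rewrite !mxE; ring.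
have := is_derive_0_is_cst a 0 dF.
by rewrite /F cos0 sin0 scale1r scale0r addr0.
Qed.

(** Decompose z' = c z + u with u orthogonal to z, so that c is the cosine of the angle. If u = 0
    then c is 1 or -1 and evenness suffices; otherwise z' lies on the circle through z in the plane
    of z and u. *)
Lemma Pint_radial_z t (x : 'rV[R]_n.*2) (z z' : 'rV[R]_m) : 0 < t ->
  dotv z z = dotv z' z' -> Pint n qcos t x z = Pint n qcos t x z'.
Proof.
move=> t0 zz'; have [z0|z0] := eqVneq (dotv z z) 0.
  have v0 (v : 'rV[R]_m) : dotv v v = 0 -> v = 0.
    move=> vv; apply/rowP => j; rewrite mxE; apply/eqP.
    by rewrite -sqrf_eq0 eq_le sqr_ge0 andbT -vv coord_sqr_le.
  by rewrite (v0 z)// (v0 z')// -zz'.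
have zz : 0 < dotv z z by rewrite lt0r z0 dotv_ge0.
pose c := dotv z z' / dotv z z; pose u := z' - c *: z.
have zu : dotv z u = 0.
  by rewrite /u dotvDr -scaleNr dotvZr mulNr /c divfK// subrr.
have uu : dotv u u = (1 - c ^+ 2) * dotv z z.
  rewrite {2}/u dotvDr -scaleNr dotvZr (dotvC u z) zu mulr0 addr0.
  rewrite /u dotvDl -scaleNr dotvZl -zz' /c; field.
  by [].
have [u0|u0] := eqVneq (dotv u u) 0.
  have z'E : z' = c *: z.
    apply/eqP; rewrite -subr_eq0; apply/eqP/rowP => j; rewrite [RHS]mxE; apply/eqP.
    by rewrite -sqrf_eq0 eq_le sqr_ge0 andbT -u0 coord_sqr_le.
  have : c ^+ 2 == 1.
    move/eqP: u0; rewrite uu mulf_eq0 (negbTE z0) orbF subr_eq0 eq_sym.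
    by [].
  rewrite sqrf_eq1 => /orP[] /eqP c1; rewrite z'E c1 ?scale1r// scaleN1r.
  by rewrite Pint_qcosN.
have c21 : 0 < 1 - c ^+ 2.
  have : 0 < dotv u u by rewrite lt0r u0 dotv_ge0.
  by rewrite uu pmulr_lgt0.
pose s := Num.sqrt (1 - c ^+ 2).
have s0 : 0 < s by rewrite sqrtr_gt0.
have s2 : s ^+ 2 = 1 - c ^+ 2 by rewrite sqr_sqrtr// ltW.
pose w := s^-1 *: u.
have c1 : -1 <= c <= 1 by apply/andP; split; nra.
have -> : z' = cos (acos c) *: z + sin (acos c) *: w.
  rewrite acosK ?in_itv//= sin_acos// -/s /w scalerA divff ?gt_eqF// scale1r.
  by rewrite addrC subrK.
apply/esym/Pint_circle => //.
  by rewrite /w dotvZr zu mulr0.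
rewrite /w dotvZl dotvZr uu -s2; field.
by rewrite gt_eqF.
Qed.

End kernel_symmetries.

(** * Exchange of real integrals under a product bound *)

Section Rintegral_fubini.
Context d1 d2 (T1 : measurableType d1) (T2 : measurableType d2) (R : realType).
Variables (m1 : {sigma_finite_measure set T1 -> \bar R})
  (m2 : {sigma_finite_measure set T2 -> \bar R}).

Lemma Rintegral_Fubini (f : T1 -> T2 -> R) (a : T1 -> R) (b : T2 -> R) :
  measurable_fun setT (fun p : T1 * T2 => f p.1 p.2) ->
  m1.-integrable setT (EFin \o a) -> m2.-integrable setT (EFin \o b) ->
  (forall x y, `|f x y| <= a x * b y) ->
  \int[m1]_x \int[m2]_y f x y = \int[m2]_y \int[m1]_x f x y.
Proof.
move=> mf ia ib fab.
have ma : measurable_fun setT a by have /measurable_int/measurable_EFinP := ia.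
have mb : measurable_fun setT b by have /measurable_int/measurable_EFinP := ib.
have mfE : measurable_fun setT (fun p : T1 * T2 => (f p.1 p.2)%:E).
  exact/measurable_EFinP.
have iF : (m1 \x m2)%E.-integrable setT (fun p : T1 * T2 => (f p.1 p.2)%:E).
  apply/(integrable12ltyP _ _ mfE).
  apply: (@le_lt_trans _ _ (\int[m1]_x (`|a x|%:E * \int[m2]_y (`|b y|)%:E))%E).
    apply: ge0_le_integral => //.
    - by move=> x _; apply: integral_ge0.
    - apply: (@measurable_fun_fubini_tonelli_F _ _ _ _ _ m2
        (fun p : T1 * T2 => `|(f p.1 p.2)%:E|%E)) => //.
      exact: measurableT_comp.
    - apply: emeasurable_funM => //.
      by apply/measurable_EFinP; exact: measurableT_comp.
    - move=> x _; rewrite -ge0_integralZl//; last first.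
        by apply/measurable_EFinP; exact: measurableT_comp.
      apply: ge0_le_integral => //.
      + by apply: measurableT_comp => //; exact: (measurableT_comp mfE (measurable_pair1 x)).
      + apply: emeasurable_funM => //.
        by apply/measurable_EFinP; exact: measurableT_comp.
      + move=> y _; rewrite -EFinM lee_fin -normrM.
        by apply: (le_trans (fab x y)); exact: ler_norm.
  rewrite ge0_integralZr//; last 2 first.
  - by apply/measurable_EFinP; exact: measurableT_comp.
  - exact: integral_ge0.
  have /integrableP[_ ia'] := ia; have /integrableP[_ ib'] := ib.
  by rewrite lte_mul_pinfty// ?integral_ge0// ge0_fin_numE// integral_ge0.
have i2 x : m2.-integrable setT (fun y => (f x y)%:E).
  apply: (@le_integrable _ _ _ m2 setT measurableT _ (fun y => (a x * b y)%:E)).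
  - exact: (measurableT_comp mfE (measurable_pair1 x)).
  - by move=> y _; rewrite lee_fin; apply: (le_trans (fab x y)); exact: ler_norm.
  - by under eq_fun do rewrite EFinM; exact: integrableZl.
have i1 y : m1.-integrable setT (fun x => (f x y)%:E).
  apply: (@le_integrable _ _ _ m1 setT measurableT _ (fun x => (b y * a x)%:E)).
  - exact: (measurableT_comp mfE (measurable_pair2 y)).
  - by move=> x _; rewrite lee_fin mulrC; apply: (le_trans (fab x y)); exact: ler_norm.
  - by under eq_fun do rewrite EFinM; exact: integrableZl.
have F := Fubini iF; rewrite /Rintegral.
transitivity (fine (\int[m1]_x \int[m2]_y (f x y)%:E)%E).
  congr fine; apply: eq_integral => x _; rewrite fineK//.
  exact: (integrable_fin_num measurableT (i2 x)).
rewrite F; congr fine; apply: eq_integral => y _; rewrite fineK//.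
exact: (integrable_fin_num measurableT (i1 y)).
Qed.

End Rintegral_fubini.

(** * Fourier inversion at the origin *)

Section laplace_cosine.
Context {R : realType}.
Variable e : R.
Hypothesis e0 : 0 < e.
Notation leb := (@lebesgue_measure R).

(* Abel kernel regularizing the Fourier inversion; its Fourier transform is elementary. *)
Definition lap (z : R) : R := expR (- (e * `|z|)).

Lemma continuous_lap : continuous lap.
Proof.
move=> z; apply: continuous_cvg; first exact: continuous_expR.
by apply: cvgN; apply: cvgM; [exact: cvg_cst|exact: norm_continuous].
Qed.

(** The condition |B| <= A keeps A + B cos nonnegative, so that the fundamental theorem on a
    half-line and Tonelli apply; the pure cosine is recovered at the end by a subtraction. *)
Lemma integral_lap_cos_half (A B l : R) : `|B| <= A ->
  (\int[leb]_(z in `[0%R, +oo[) (expR (- (e * z)) * (A + B * cos (l * z)))%:E =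
  (A / e + B * (e / (e ^+ 2 + l ^+ 2)))%:E)%E.
Proof.
move=> BA; have D0 : e ^+ 2 + l ^+ 2 != 0.
  by rewrite gt_eqF// ltr_pwDl ?exprn_gt0 ?sqr_ge0.
pose F (z : R) := expR (- (e * z)) * (- (A / e) +
  B * (- e * cos (l * z) + l * sin (l * z)) / (e ^+ 2 + l ^+ 2)).
have dF (z : R) : is_derive z 1 F (expR (- (e * z)) * (A + B * cos (l * z))).
  have dl (k : R) : is_derive z 1 (fun z => k * z) k.
    by apply: is_derive_eq; rewrite /GRing.scale/=; ring.
  have d1 := @is_derive1_comp _ (@expR R) (fun z => - (e * z)) z _ _ (is_derive_expR _) (is_deriveN (dl e)).
  have dc : is_derive z 1 (fun z => cos (l * z)) (- sin (l * z) * l) :=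
    @is_derive1_comp _ (@cos R) (fun z => l * z) z _ _ (is_derive_cos _) (dl l).
  have ds : is_derive z 1 (fun z => sin (l * z)) (cos (l * z) * l) :=
    @is_derive1_comp _ (@sin R) (fun z => l * z) z _ _ (is_derive_sin _) (dl l).
  have d2 : is_derive z 1 (fun z => - (A / e) +
      B * (- e * cos (l * z) + l * sin (l * z)) / (e ^+ 2 + l ^+ 2))
      (B * (e * l * sin (l * z) + l ^+ 2 * cos (l * z)) / (e ^+ 2 + l ^+ 2)).
    by apply: is_derive_eq; rewrite /GRing.scale/=; ring.
  have := is_deriveM d1 d2; congr is_derive.
  by rewrite /GRing.scale/=; field; rewrite D0 gt_eqF.
rewrite (@ge0_continuous_FTC2y _ _ F 0 0).
- rewrite -EFinB /F !mulr0 oppr0 expR0 cos0 sin0; congr EFin.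
  by field; rewrite D0 gt_eqF.
- move=> z _; rewrite mulr_ge0 ?expR_ge0//.
  have := ler_norm (- (B * cos (l * z))); rewrite normrN normrM.
  have : `|cos (l * z)| <= 1 by rewrite ler_norml cos_geN1 cos_le1.
  have := normr_ge0 B; have := normr_ge0 (cos (l * z)).
  move: (cos _) (`|cos _|) => C N *; nra.
- apply: continuous_subspaceT => z.
  apply: cvgM.
    apply: continuous_cvg; first exact: continuous_expR.
    by apply: cvgN; apply: cvgM; [exact: cvg_cst|exact: cvg_id].
  apply: cvgD; first exact: cvg_cst.
  apply: cvgM; first exact: cvg_cst.
  apply: continuous_cvg; first exact: continuous_cos.
  by apply: cvgM; [exact: cvg_cst|exact: cvg_id].
- pose M := `|A / e| + `|B| * (e + `|l|) / (e ^+ 2 + l ^+ 2).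
  have Dp : 0 < e ^+ 2 + l ^+ 2 by rewrite ltr_pwDl ?exprn_gt0 ?sqr_ge0.
  have u0 : expR (- (e * z)) * M @[z --> +oo] --> (0 : R).
    rewrite -[X in _ --> X](mul0r M); apply: cvgMr_tmp.
    apply: (cvg_comp (fun z => e * z) (fun z => expR (- z))); last exact: cvgr_expR.
    by apply: gt0_cvgMry => //; exact: cvg_id.
  have un0 : - (expR (- (e * z)) * M) @[z --> +oo] --> (0 : R).
    by rewrite -[X in _ --> X]oppr0; exact: cvgN.
  apply: (squeeze_cvgr _ un0 u0); apply: nearW => z.
  rewrite -ler_norml /F normrM (ger0_norm (expR_ge0 _)) ler_wpM2l ?expR_ge0//.
  apply: (le_trans (ler_normD _ _)); rewrite normrN lerD// !normrM.
  rewrite (@ger0_norm _ (_^-1)) ?invr_ge0 ?(ltW Dp)// ler_wpM2r ?invr_ge0 ?(ltW Dp)//.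
  rewrite ler_wpM2l//; apply: (le_trans (ler_normD _ _)); rewrite !normrM normrN lerD//.
    by rewrite (gtr0_norm e0) ler_piMr ?(ltW e0)// ler_norml cos_geN1 cos_le1.
  by rewrite ler_piMr// ler_norml sin_geN1 sin_le1.
- by move=> z _; have [] := dF z.
- apply: cvg_at_right_filter; apply: differentiable_continuous.
  by apply/derivable1_diffP; have [] := dF 0.
- by move=> z _; rewrite derive1E; have [_ ->] := dF z.
Qed.

Lemma lap_ge0 z : 0 <= lap z. Proof. exact: expR_ge0. Qed.

Lemma lapN z : lap (- z) = lap z. Proof. by rewrite /lap normrN. Qed.

Lemma lap_cos_ge0 (A B u z : R) : `|B| <= A -> 0 <= lap z * (A + B * cos u).
Proof.
move=> BA; rewrite mulr_ge0 ?lap_ge0//.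
have := ler_norm (- (B * cos u)); rewrite normrN normrM.
have : `|cos u| <= 1 by rewrite ler_norml cos_geN1 cos_le1.
have := normr_ge0 B; have := normr_ge0 (cos u).
move: (cos _) (`|cos _|) => C N *; nra.
Qed.

Lemma continuous_lap_cos (A B th l : R) :
  continuous (fun z => lap z * (A + B * cos (th + l * z))).
Proof.
move=> z; apply: cvgM; first exact: continuous_lap.
apply: cvgD; first exact: cvg_cst.
apply: cvgM; first exact: cvg_cst.
apply: continuous_cvg; first exact: continuous_cos.
by apply: cvgD; [exact: cvg_cst|apply: cvgM; [exact: cvg_cst|exact: cvg_id]].
Qed.

Lemma measurable_lap_cos (A B th l : R) : measurable_fun [set: measurableTypeR R]
  (fun z => (lap z * (A + B * cos (th + l * z)))%:E).
Proof.
apply/measurable_EFinP; apply: continuous_measurable_fun => z.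
exact: continuous_lap_cos.
Qed.

(** Averaging the integrand over z and - z cancels the sine part of the phase and leaves cos th cos
    (l z), an even function. *)
Lemma integral_lap_cos (A B th l : R) : `|B| <= A ->
  (\int[leb]_z (lap z * (A + B * cos (th + l * z)))%:E =
  (A * (2 / e) + B * cos th * (2 * e / (e ^+ 2 + l ^+ 2)))%:E)%E.
Proof.
move=> BA; pose g (z : R) := lap z * (A + B * cos (th + l * z)).
pose h (z : R) := lap z * (A + B * cos th * cos (0 + l * z)).
have BcA : `|B * cos th| <= A.
  rewrite normrM; apply: le_trans BA; rewrite ler_piMr//.
  by rewrite ler_norml cos_geN1 cos_le1.
have g0 z : (0 <= (g z)%:E)%E by rewrite lee_fin lap_cos_ge0.
have h0 z : 0 <= h z by rewrite lap_cos_ge0.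
have mg := measurable_lap_cos A B th l.
have mgN : measurable_fun [set: measurableTypeR R] (fun z => (g (- z))%:E).
  rewrite (_ : (fun z => _) = (fun z => (lap z * (A + B * cos (th + (- l) * z)))%:E)).
    exact: measurable_lap_cos.
  by apply/funext => z; rewrite /g lapN mulrN mulNr.
have gN : (\int[leb]_z (g z)%:E = \int[leb]_z (g (- z))%:E)%E.
  have m10 : -1 != 0 :> R by rewrite oppr_eq0 oner_eq0.
  rewrite (ge0_integral_affine 0 m10 mg g0) normrN1 mul1e.
  by apply: eq_integral => z _; rewrite addr0 mulN1r.
have hE : (\int[leb]_z (h z)%:E = \int[leb]_z (g z)%:E)%E.
  transitivity (\int[leb]_z ((2^-1)%:E * (g z)%:E + (2^-1)%:E * (g (- z))%:E))%E.
    apply: eq_integral => z _; rewrite -!EFinM -EFinD; congr EFin.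
    by rewrite /h /g lapN mulrN cosB !cosD cos0 sin0; field.
  rewrite ge0_integralD//.
  - rewrite !ge0_integralZl// -gN -ge0_muleDl ?lee_fin// -EFinD.
    by rewrite (_ : 2^-1 + 2^-1 = 1) ?mul1e//; field.
  - by move=> z _; rewrite mule_ge0// lee_fin.
  - exact: measurable_funeM.
  - by move=> z _; rewrite mule_ge0// lee_fin.
  - exact: measurable_funeM.
rewrite -/(g _) -hE (@ge0_symfun_integralT R h h0).
- rewrite -set_itvcy.
  have -> : (\int[leb]_(z in `[0%R, +oo[) (h z)%:E =
      \int[leb]_(z in `[0%R, +oo[) (expR (- (e * z)) * (A + B * cos th * cos (l * z)))%:E)%E.
    apply: eq_integral => z; rewrite inE/= in_itv/= andbT => z0.
    by rewrite /h /lap (ger0_norm z0) add0r.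
  by rewrite integral_lap_cos_half// -EFinM; congr EFin; ring.
- exact: continuous_lap_cos.
- by move=> z; rewrite /h /= lapN !add0r mulrN cosN.
Qed.

(** The phase th stores the coordinate already split off. Integrating the others turns A and B into
    A (2/e)^d and B times the product of the q_i; as 0 <= q_i <= 2/e, the condition |B| <= A
    persists. *)
Lemma integral_lap_prod_cos d (A B th : R) (l : 'I_d -> R) : `|B| <= A ->
  (\int[lebesgue_tuple d]_w
     ((\prod_i lap (tnth w i)) * (A + B * cos (th + \sum_i l i * tnth w i)))%:E =
   (A * (2 / e) ^+ d + B * cos th * \prod_i (2 * e / (e ^+ 2 + l i ^+ 2)))%:E)%E.
Proof.
have mF k (A1 B1 th1 : R) (l1 : 'I_k -> R) : measurable_fun [set: k.-tuple R]
    (fun w => ((\prod_i lap (tnth w i)) * (A1 + B1 * cos (th1 + \sum_i l1 i * tnth w i)))%:E).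
  apply/measurable_EFinP; apply: measurable_funM.
    apply: measurable_prod => i _; apply: measurableT_comp; last exact: measurable_tnth.
    exact: continuous_measurable_fun continuous_lap.
  apply: measurable_funD => //; apply: measurable_funM => //.
  apply: measurableT_comp.
    by apply: continuous_measurable_fun; exact: continuous_cos.
  apply: measurable_funD => //; apply: measurable_sum => i.
  by apply: measurable_funM => //; exact: measurable_tnth.
elim: d A B th l => [|d IH] A B th l BA.
  rewrite [LHS](_ : _ = \int[\d_([tuple] : 0.-tuple R)]_w
    ((\prod_i lap (tnth w i)) * (A + B * cos (th + \sum_i l i * tnth w i)))%:E)%E//.
  rewrite integral_dirac// ?diracT ?mul1e; last exact (mF 0 A B th l).
  by rewrite !big_ord0 addr0 mul1r expr0 !mulr1.
have A0 : 0 <= A by apply: le_trans BA.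
have q0 (i : R) : 0 <= 2 * e / (e ^+ 2 + i ^+ 2).
  by rewrite divr_ge0 ?mulr_ge0 ?addr_ge0 ?sqr_ge0// ltW.
have q1 (i : R) : 2 * e / (e ^+ 2 + i ^+ 2) <= 2 / e.
  rewrite ler_pdivrMr ?ltr_pwDl ?exprn_gt0 ?sqr_ge0// mulrAC ler_pdivlMr//.
  by have := sqr_ge0 i; have := e0; nra.
rewrite ge0_integral_tupleS; last 2 first.
- exact (mF _ A B th l).
- move=> w; rewrite lee_fin mulr_ge0 ?prodr_ge0//.
  + by move=> i _; exact: lap_ge0.
  + have := lap_cos_ge0 (th + \sum_i l i * tnth w i) 0 BA.
    by rewrite /lap normr0 mulr0 oppr0 expR0 mul1r.
pose q (i : 'I_d) := 2 * e / (e ^+ 2 + l (lift ord0 i) ^+ 2).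
have B'A' : `|B * \prod_i q i| <= A * (2 / e) ^+ d.
  rewrite normrM ler_pM// ger0_norm; last by apply: prodr_ge0 => i _; exact: q0.
  rewrite -[in leRHS](card_ord d) -prodr_const; apply: ler_prod => i _.
  by rewrite /q q0 q1.
transitivity (\int[leb]_x (lap x *
    (A * (2 / e) ^+ d + (B * \prod_i q i) * cos (th + l ord0 * x)))%:E)%E.
  apply: eq_integral => x _.
  transitivity (\int[lebesgue_tuple d]_w ((lap x)%:E * ((\prod_i lap (tnth w i)) *
      (A + B * cos ((th + l ord0 * x) + \sum_i l (lift ord0 i) * tnth w i)))%:E))%E.
    apply: eq_integral => w _.
    have ts i : tnth (tuple_cons (x, w)) (lift ord0 i) = tnth w i by exact: tnthS.
    rewrite -EFinM !big_ord_recl tnth0 addrA mulrA.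
    congr (_ * _ * (_ + _ * cos (_ + _)))%:E.
      by apply: eq_bigr => i _; rewrite ts.
    by apply: eq_bigr => i _; rewrite ts.
  rewrite ge0_integralZl//.
  - rewrite IH// -EFinM; congr (_ * _)%:E; rewrite /q; congr (_ + _).
    by rewrite mulrAC.
  - exact (mF _ A B _ _).
  - move=> w _; rewrite lee_fin mulr_ge0 ?prodr_ge0//.
    + by move=> i _; exact: lap_ge0.
    + have := lap_cos_ge0 (th + l ord0 * x + \sum_i l (lift ord0 i) * tnth w i) 0 BA.
      by rewrite /lap normr0 mulr0 oppr0 expR0 mul1r.
  - by rewrite lee_fin lap_ge0.
rewrite integral_lap_cos// big_ord_recl (exprS (2 / e)); congr EFin.
by rewrite -[X in _ = _ + _ * (_ * X)]/(\prod_i q i); ring.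
Qed.

End laplace_cosine.

Section fourier_inversion.
Context {R : realType}.

Lemma integrable_lap_prod d (e : R) : 0 < e ->
  (lebesgue_tuple d).-integrable setT (fun w => (\prod_i lap e (tnth w i))%:E).
Proof.
move=> e0; apply/integrableP; split.
  apply/measurable_EFinP; apply: measurable_prod => i _.
  apply: measurableT_comp; last exact: measurable_tnth.
  exact: continuous_measurable_fun (@continuous_lap R e).
have BA : `|0 : R| <= 1 by rewrite normr0.
have h := integral_lap_prod_cos e0 0 (fun _ : 'I_d => 0) BA.
apply: (@le_lt_trans _ _ ((1 * (2 / e) ^+ d +
  0 * cos 0 * \prod_(i < d) (2 * e / (e ^+ 2 + 0 ^+ 2)))%:E)%E); last exact: ltry.
rewrite -h le_eqVlt; apply/orP; left; apply/eqP; apply: eq_integral => w _.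
rewrite (mul0r (cos _)) addr0 mulr1 gee0_abs// lee_fin.
by apply: prodr_ge0 => i _; exact: lap_ge0.
Qed.

Lemma measurable_cos_sum d (l : 'I_d -> R) :
  measurable_fun [set: d.-tuple R] (fun w => cos (\sum_i l i * tnth w i)).
Proof.
apply: (@measurableT_comp _ _ _ _ _ _ (@cos R)).
  by apply: continuous_measurable_fun; exact: continuous_cos.
by apply: measurable_sum => i; apply: measurable_funM => //; exact: measurable_tnth.
Qed.

(** Difference of the cases B = 1 and B = 0, both with A = 1. *)
Lemma Rintegral_lap_prod_cos d (e : R) (l : 'I_d -> R) : 0 < e ->
  \int[lebesgue_tuple d]_w ((\prod_i lap e (tnth w i)) * cos (\sum_i l i * tnth w i)) =
  \prod_i (2 * e / (e ^+ 2 + l i ^+ 2)).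
Proof.
move=> e0; have ik := integrable_lap_prod d e0.
have mk : measurable_fun setT (fun w : d.-tuple R => \prod_i lap e (tnth w i)).
  by have /measurable_int/measurable_EFinP := ik.
have k0 (w : d.-tuple R) : 0 <= \prod_i lap e (tnth w i).
  by apply: prodr_ge0 => i _; exact: lap_ge0.
have ikc : (lebesgue_tuple d).-integrable setT
    (fun w => ((\prod_i lap e (tnth w i)) * cos (\sum_i l i * tnth w i))%:E).
  apply: (le_integrable measurableT _ _ ik).
    by apply/measurable_EFinP; apply: measurable_funM => //; exact: measurable_cos_sum.
  move=> w _; rewrite lee_fin normrM ler_piMr//.
  by rewrite ler_norml cos_geN1 cos_le1.
have B0 : `|0 : R| <= 1 by rewrite normr0.
have B1 : `|1 : R| <= 1 by rewrite normr1.
have h0 := integral_lap_prod_cos e0 0 l B0.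
have h1 := integral_lap_prod_cos e0 0 l B1.
have E0 : \int[lebesgue_tuple d]_w (\prod_i lap e (tnth w i)) = (2 / e) ^+ d.
  rewrite /Rintegral -[RHS]mul1r -[in RHS](addr0 (1 * _)) -[RHS]/(fine (_%:E)).
  rewrite !mul0r in h0; rewrite -h0; congr fine; apply: eq_integral => w _.
  by rewrite mul0r addr0 mulr1.
have E1 : \int[lebesgue_tuple d]_w (\prod_i lap e (tnth w i) +
    (\prod_i lap e (tnth w i)) * cos (\sum_i l i * tnth w i)) =
    (2 / e) ^+ d + \prod_i (2 * e / (e ^+ 2 + l i ^+ 2)).
  rewrite cos0 !mul1r in h1; rewrite /Rintegral -[RHS]/(fine (_%:E)) -h1.
  congr fine; apply: eq_integral => w _.
  by rewrite add0r mul1r mulrDr mulr1.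
move: E1; rewrite RintegralD// E0; exact: addrI.
Qed.

Lemma Rintegral_jprod d : \int[lebesgue_tuple d]_w jprod (rV_of_tuple w) = pi ^+ d :> R.
Proof.
rewrite /Rintegral -[RHS]/(fine (_%:E)); congr fine.
rewrite -(@integral_tuple_prod R d (fun x => (1 + x ^+ 2)^-1) pi).
- by apply: eq_integral => w _; rewrite /jprod; under eq_bigr do rewrite mxE.
- by apply: continuous_measurable_fun => x; exact: (@continuous_oneDsqrV R x).
- by move=> x; rewrite invr_ge0 addr_ge0 ?sqr_ge0.
- exact: integral_inv_oneDsqr.
Qed.

Variable m : nat.
Variables (W F : m.-tuple R -> R) (W0 C C' : R).
Hypotheses (mW : measurable_fun setT W)
  (WC : forall l, `|W l| <= C * jprod (rV_of_tuple l))
  (cW : forall (c : R^nat) l, c @ \oo --> (0 : R) ->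
    W (affine_tuple (c k) [tuple 0 | i < m] l) @[k --> \oo] --> W0)
  (FC : forall w, `|F w| <= C' * jprod (rV_of_tuple w))
  (FE : forall w, F w = \int[lebesgue_tuple m]_l
    (W l * cos (\sum_i tnth l i * tnth w i)))
  (mF : measurable_fun setT F).

Lemma jprod_le1 d (v : 'rV[R]_d) : jprod v <= 1.
Proof.
rewrite /jprod; apply: prodr_ile1 => i _.
by rewrite invr_ge0 addr_ge0 ?sqr_ge0//= invf_le1 ?lerDl ?ltr_pwDl ?sqr_ge0.
Qed.

Lemma lap_prod_le1 (e : R) (w : m.-tuple R) : 0 < e -> `|\prod_i lap e (tnth w i)| <= 1.
Proof.
move=> e0; rewrite ger0_norm; last by apply: prodr_ge0 => i _; exact: lap_ge0.
apply: prodr_ile1 => i _; rewrite lap_ge0/= /lap -expR0 ler_expR.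
by rewrite oppr_le0 mulr_ge0// ltW.
Qed.

Lemma W_le l : `|W l| <= C.
Proof.
apply: (le_trans (WC l)); rewrite ler_piMr ?jprod_le1//.
by rewrite -(pmulr_lge0 _ (jprod_gt0 (rV_of_tuple l))) (le_trans _ (WC l)).
Qed.

(** After Fubini the inner integral is the product of the 2e / (e^2 + l_i^2), an approximate
    identity as e tends to 0. Rescaling l by e leaves a fixed density, and e survives only in the
    argument of W. *)
Lemma fourier_regularized (e : R) : 0 < e ->
  \int[lebesgue_tuple m]_w (F w * \prod_i lap e (tnth w i)) =
  \int[lebesgue_tuple m]_u
    (W (affine_tuple e [tuple 0 | i < m] u) * (2 ^+ m * jprod (rV_of_tuple u))).
Proof.
move=> e0; have ik := integrable_lap_prod m e0.
have mk : measurable_fun setT (fun w : m.-tuple R => \prod_i lap e (tnth w i)).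
  by have /measurable_int/measurable_EFinP := ik.
have iWc w : (lebesgue_tuple m).-integrable setT
    (fun l => (W l * cos (\sum_i tnth l i * tnth w i))%:E).
  apply: (@integrable_le_jprod _ _ _ C).
    apply: measurable_funM => //; under eq_fun do under eq_bigr do rewrite mulrC.
    exact: measurable_cos_sum.
  move=> l; apply: le_trans (WC l); rewrite normrM ler_piMr//.
  by rewrite ler_norml cos_geN1 cos_le1.
pose f (w l : m.-tuple R) := (\prod_i lap e (tnth w i)) * (W l * cos (\sum_i tnth l i * tnth w i)).
have ij : (lebesgue_tuple m).-integrable setT (fun l => (C * jprod (rV_of_tuple l))%:E).
  by under eq_fun do rewrite EFinM; apply: integrableZl => //; exact: integrable_jprod.
transitivity (\int[lebesgue_tuple m]_w \int[lebesgue_tuple m]_l f w l).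
  by apply: eq_Rintegral => w _; rewrite mulrC FE /f RintegralZl//; exact: (iWc w).
rewrite (Rintegral_Fubini (a := fun w => \prod_i lap e (tnth w i))
   (b := fun l => C * jprod (rV_of_tuple l))); last 4 first.
- apply: measurable_funM; first exact: (measurableT_comp mk).
  apply: measurable_funM; first exact: (measurableT_comp mW).
  apply: (@measurableT_comp _ _ _ _ _ _ (@cos R)).
    by apply: continuous_measurable_fun; exact: continuous_cos.
  apply: measurable_sum => i; apply: measurable_funM.
    by apply: (measurableT_comp (measurable_tnth i)).
  by apply: (measurableT_comp (measurable_tnth i)).
- exact: ik.
- exact: ij.
- move=> w l; rewrite /f normrM ger0_norm; last by apply: prodr_ge0 => i _; exact: lap_ge0.
  rewrite ler_wpM2l//; first by apply: prodr_ge0 => i _; exact: lap_ge0.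
  apply: le_trans (WC l); rewrite normrM ler_piMr//.
  by rewrite ler_norml cos_geN1 cos_le1.
transitivity (\int[lebesgue_tuple m]_l (W l * \prod_i (2 * e / (e ^+ 2 + tnth l i ^+ 2)))).
  apply: eq_Rintegral => l _; rewrite -(Rintegral_lap_prod_cos (fun i => tnth l i) e0).
  rewrite -RintegralZl//; last first.
    apply: (le_integrable measurableT _ _ ik).
      by apply/measurable_EFinP; apply: measurable_funM => //; exact: measurable_cos_sum.
    move=> w _; rewrite lee_fin normrM ler_piMr//.
    by rewrite ler_norml cos_geN1 cos_le1.
  by apply: eq_Rintegral => w _; rewrite /f mulrCA.
have q0 i : 0 <= 2 * e / (e ^+ 2 + i ^+ 2).
  by rewrite divr_ge0 ?mulr_ge0 ?addr_ge0 ?sqr_ge0// ltW.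
have mq : measurable_fun [set: measurableTypeR R] (fun x : R => 2 * e / (e ^+ 2 + x ^+ 2)).
  apply: continuous_measurable_fun => x; apply: cvgM; first exact: cvg_cst.
  apply: cvgV; first by rewrite gt_eqF// ltr_pwDl ?exprn_gt0 ?sqr_ge0.
  by apply: cvgD; [exact: cvg_cst|exact: exprn_continuous].
rewrite (@Rintegral_tuple_affine _ _ e [tuple 0 | i < m]) ?gt_eqF//; last first.
  apply: (@integrable_le_jprod _ _ _ (C * (2 / e) ^+ m)).
    apply: measurable_funM => //; apply: measurable_prod => i _.
    exact: (measurableT_comp mq (measurable_tnth i)).
  move=> l; rewrite normrM mulrAC ler_pM//.
  rewrite ger0_norm; last by apply: prodr_ge0 => i _; exact: q0.
  rewrite -[in leRHS](card_ord m) -prodr_const; apply: ler_prod => i _.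
  rewrite q0/= ler_pdivrMr ?ltr_pwDl ?exprn_gt0 ?sqr_ge0// mulrAC ler_pdivlMr//.
  by have := sqr_ge0 (tnth l i); have := e0; nra.
rewrite gtr0_norm//; pose We u := W (affine_tuple e [tuple 0 | i < m] u).
have iX : (lebesgue_tuple m).-integrable setT
    (fun u => (We u * (2 ^+ m * jprod (rV_of_tuple u)))%:E).
  apply: (@integrable_le_jprod _ _ _ (C * 2 ^+ m)).
    apply: measurable_funM.
      exact: (measurableT_comp mW (measurable_affine_tuple _ _)).
    apply: measurable_funM => //.
    by have /measurable_int/measurable_EFinP := @integrable_jprod R m.
  move=> u; rewrite normrM (@ger0_norm _ (_ * jprod _)) ?mulr_ge0 ?exprn_ge0 ?jprod_ge0//.
  rewrite -mulrA ler_wpM2r ?mulr_ge0 ?exprn_ge0 ?jprod_ge0//.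
  exact: W_le.
have -> : \int[lebesgue_tuple m]_u (We u *
    \prod_i (2 * e / (e ^+ 2 + tnth (affine_tuple e [tuple 0 | i < m] u) i ^+ 2))) =
  \int[lebesgue_tuple m]_u ((e ^+ m)^-1 * (We u * (2 ^+ m * jprod (rV_of_tuple u)))).
  apply: eq_Rintegral => u _; rewrite mulrCA; congr (_ * _).
  rewrite -exprVn -[m in 2 ^+ m]card_ord -[m in e^-1 ^+ m]card_ord -!prodr_const /jprod -!big_split/=.
  apply: eq_bigr => i _; rewrite !tnth_mktuple addr0 mxE.
  have := sqr_ge0 (tnth u i); move: (tnth u i) => y y0.
  field; rewrite !gt_eqF//; nra.
by rewrite RintegralZl// mulVKf// expf_neq0// gt_eqF.
Qed.

(** Let e = 1/(k+1) tend to 0 on both sides of the regularized identity. On the right W tends to W0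
    pointwise against 2^m [jprod], of mass (2 pi)^m. *)
Lemma fourier_inversion0 : \int[lebesgue_tuple m]_w F w = (2 * pi) ^+ m * W0.
Proof.
pose e (k : nat) : R := k.+1%:R^-1.
have e0 k : 0 < e k by rewrite invr_gt0 ltr0n.
have ce : e @ \oo --> (0 : R).
  exact: cvg_harmonic.
have iF : (lebesgue_tuple m).-integrable setT (fun l => (C' * jprod (rV_of_tuple l))%:E).
  by under eq_fun do rewrite EFinM; apply: integrableZl => //; exact: integrable_jprod.
have iG : (lebesgue_tuple m).-integrable setT
    (fun l => (C * (2 ^+ m * jprod (rV_of_tuple l)))%:E).
  under eq_fun do rewrite mulrA EFinM; apply: integrableZl => //; exact: integrable_jprod.
have mj : measurable_fun setT (fun l : m.-tuple R => jprod (rV_of_tuple l)).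
  by have /measurable_int/measurable_EFinP := @integrable_jprod R m.
have c1 : \int[lebesgue_tuple m]_w (F w * \prod_i lap (e k) (tnth w i)) @[k --> \oo] -->
    \int[lebesgue_tuple m]_w F w.
  apply: (dominated_cvg_Rintegral _ _ iF) => [k|w|k w].
  - apply: measurable_funM => //.
    by have /measurable_int/measurable_EFinP := integrable_lap_prod m (e0 k).
  - rewrite -[X in _ --> X]mulr1; apply: cvgM; first exact: cvg_cst.
    rewrite -[X in _ --> X](expr1n _ m) -[m in 1 ^+ m]card_ord -prodr_const.
    apply: cvg_big => [|i _]; first exact: mul_continuous.
    rewrite -expR0; apply: continuous_cvg; first exact: continuous_expR.
    rewrite -oppr0; apply: cvgN; rewrite -(mul0r `|tnth w i|).
    by apply: cvgM => //; exact: cvg_cst.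
  - by apply: le_trans (FC w); rewrite normrM ler_piMr// lap_prod_le1.
have c2 : \int[lebesgue_tuple m]_w (F w * \prod_i lap (e k) (tnth w i)) @[k --> \oo] -->
    \int[lebesgue_tuple m]_u (W0 * (2 ^+ m * jprod (rV_of_tuple u))).
  under eq_fun do rewrite fourier_regularized//.
  apply: (dominated_cvg_Rintegral _ _ iG) => [k|u|k u].
  - apply: measurable_funM; last exact: measurable_funM.
    exact: (measurableT_comp mW (measurable_affine_tuple _ _)).
  - by apply: cvgM; [exact: cW|exact: cvg_cst].
  - rewrite normrM (@ger0_norm _ (_ * jprod _)) ?mulr_ge0 ?exprn_ge0 ?jprod_ge0//.
    by rewrite ler_wpM2r ?mulr_ge0 ?exprn_ge0 ?jprod_ge0// W_le.
have -> := cvg_unique _ c1 c2 => //.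
under eq_Rintegral do rewrite mulrA.
rewrite RintegralZl//; last exact: integrable_jprod.
by rewrite Rintegral_jprod exprMn; ring.
Qed.

End fourier_inversion.

Lemma measurable_Rintegral d1 d2 (T1 : measurableType d1) (T2 : measurableType d2)
    (R : realType) (mu : {sigma_finite_measure set T2 -> \bar R}) (f : T1 -> T2 -> R) :
  measurable_fun setT (fun p : T1 * T2 => f p.1 p.2) ->
  measurable_fun setT (fun x => \int[mu]_y f x y).
Proof.
move=> mf; have mfE : measurable_fun setT (fun p : T1 * T2 => (f p.1 p.2)%:E).
  exact/measurable_EFinP.
apply: (measurableT_comp (fine_measurable measurableT)) => //.
rewrite (_ : (fun x => _) = (fun x => \int[mu]_y ((fun p : T1 * T2 => (f p.1 p.2)%:E)^\+ (x, y)) -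
    \int[mu]_y ((fun p : T1 * T2 => (f p.1 p.2)%:E)^\- (x, y)))%E); last first.
  apply/funext => x; rewrite [LHS]integralE.
  by congr (_ - _)%E; apply: eq_integral => y _; rewrite ?funeposE ?funenegE.
have h1 := @measurable_fun_fubini_tonelli_F _ _ _ _ _ mu
  _ (measurable_funepos mfE) (fun p => funepos_ge0 _ p).
have h2 := @measurable_fun_fubini_tonelli_F _ _ _ _ _ mu
  _ (measurable_funeneg mfE) (fun p => funeneg_ge0 _ p).
exact: (emeasurable_funB h1 h2).
Qed.

(** * Total mass: integrating out z, then the Gaussian in x *)

Section total_mass.
Context {R : realType} {N m : nat}.
Variable n : nat.
Hypothesis n_gt0 : (0 < n)%N.
Local Notation symb := (@symb R N m).

Lemma measurable_Pint d (Y : measurableType d) (fx : Y -> 'rV[R]_N) (fz : Y -> 'rV[R]_m)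
    (q : symb * symb) t :
  (forall i, measurable_fun setT (fun y => fx y 0 i)) ->
  (forall j, measurable_fun setT (fun y => fz y 0 j)) ->
  measurable_fun setT (fun y => Pint n q t (fx y) (fz y)).
Proof.
move=> mx mz; apply: (@measurable_Rintegral _ _ _ _ _ (lebesgue_tuple m)
  (fun y w => integrand n q t (fx y) (fz y) (rV_of_tuple w))).
apply: (@measurable_integrand _ _ _ _ _ _ (fun p : Y * m.-tuple R => fx p.1)
  (fun p : Y * m.-tuple R => fz p.1) (fun p : Y * m.-tuple R => rV_of_tuple p.2)).
- by move=> i; apply: (measurableT_comp (mx i)).
- by move=> i; apply: (measurableT_comp (mz i)).
- by move=> i; apply: (measurableT_comp (@measurable_coord R m i)).
Qed.

(** For N = 2n this is the Euclidean heat kernel on R^(2n), of mass 1. *)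
Lemma weight0 t (x : 'rV[R]_N) : weight n t x (0 : 'rV[R]_m) =
  expR (- (dotv x x / (4 * t))) * ((4 * pi * t)^-1) ^+ n.
Proof.
have [E0 _] := cosh_sinh_sqrt (0 : R).
have E00 : cosh_sqrt 0 (0 : R) = 1.
  by move: E0; rewrite expr2 mul0r => ->; rewrite /cosh oppr0 expR0; field.
have E10 : cosh_sqrt 1 (0 : R) = 1.
  by apply/esym/eqP; rewrite -subr_eq0 -E00 -cosh_sqrt2 mul0r.
have s0 : ssq t (0 : 'rV[R]_m) = 0 by rewrite /ssq dotv0l mulr0.
rewrite /weight s0 E10 mulr1; congr (expR _ * _).
rewrite /= s0 /coth_sqrt E00 E10 seval_XX invfM divr1 mul1r; ring.
Qed.

Lemma jprod_row_mx (x : 'rV[R]_N) (z : 'rV[R]_m) : jprod (row_mx x z) = jprod x * jprod z.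
Proof.
rewrite /jprod big_split_ord/=; congr (_ * _); apply: eq_bigr => i _.
  by rewrite row_mxEl.
by rewrite row_mxEr.
Qed.

Lemma Rintegral_Pint t (x : 'rV[R]_N) : 0 < t ->
  \int[lebesgue_tuple m]_w Pint n (SCst 1, SCst 0) t x (rV_of_tuple w) =
  (2 * pi) ^+ m * weight n t x (0 : 'rV[R]_m).
Proof.
move=> t0; have [C C0 hC] := @weight_bound R N m n n_gt0 0 t t t0 (lexx t).
have [C' C'0 hC'] := @Pint_le_jprod R N m n n_gt0 (SCst 1, SCst 0) t t0.
apply: (@fourier_inversion0 R m (fun l => weight n t x (rV_of_tuple l)) _ _ C C').
- by apply: measurable_weight => // j; exact: measurable_coord.
- move=> l; rewrite ger0_norm; last exact: weight_ge0.
  by have := hC t x (rV_of_tuple l); rewrite expr0 mul1r !lexx; exact.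
- move=> c l c0.
  have t00 : 0 < t + 0 * 0 by rewrite mul0r addr0.
  (* Continuity at frequency 0 along the ray of l, read off from differentiability along that
     ray. *)
  have [dw _] := @is_derive_weight R N m n t 0 x 0 0 (rV_of_tuple l) 0 t00.
  have fE : (fun h => weight n (t + h * 0) (x + h *: 0) (0 + h *: rV_of_tuple l)) =
      fun h => weight n t x (h *: rV_of_tuple l).
    by apply/funext => h; rewrite mulr0 addr0 scaler0 addr0 add0r.
  rewrite fE in dw.
  have cw : weight n t x (h *: rV_of_tuple l) @[h --> (0 : R)] --> weight n t x (0 : 'rV[R]_m).
    have -> : weight n t x (0 : 'rV[R]_m) = weight n t x (0 *: rV_of_tuple l).
      by rewrite scale0r.
    exact: differentiable_continuous (iffLR (derivable1_diffP _ _) dw).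
  have kE : (fun k => weight n t x (rV_of_tuple (affine_tuple (c k) [tuple 0 | i < m] l))) =
      fun k => weight n t x (c k *: rV_of_tuple l).
    apply/funext => k; congr (weight _ _ _ _).
    by apply/rowP => j; rewrite !mxE !tnth_mktuple addr0.
  by rewrite kE; exact: (cvg_comp _ _ c0 cw).
- move=> w; apply: (@le_trans _ _ (C' * jprod (row_mx x (rV_of_tuple w)))).
    by have := hC' (row_mx x (rV_of_tuple w)); rewrite row_mxKl row_mxKr.
  rewrite ler_wpM2l// jprod_row_mx ler_piMl ?jprod_ge0//; exact: jprod_le1.
- move=> w; apply: eq_Rintegral => l _; rewrite /integrand/= mul0r addr0 mul1r mulrC.
  by congr (_ * cos _); apply: eq_bigr => i _; rewrite !mxE.
- by apply: measurable_Pint => // j; exact: measurable_coord.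
Qed.

Lemma integral_gauss_scaled (a : R) : 0 < a ->
  (\int[@lebesgue_measure R]_x (expR (- (x ^+ 2 / a)))%:E = (Num.sqrt (pi * a))%:E)%E.
Proof.
move=> a0; have s0 : 0 < Num.sqrt a by rewrite sqrtr_gt0.
have mF : measurable_fun [set: measurableTypeR R] (fun x : R => (expR (- (x ^+ 2 / a)))%:E).
  apply/measurable_EFinP; apply: continuous_measurable_fun => x.
  apply: continuous_cvg; first exact: continuous_expR.
  by apply: cvgN; apply: cvgM; [exact: exprn_continuous|exact: cvg_cst].
have F0 (x : R) : (0 <= (expR (- (x ^+ 2 / a)))%:E)%E by rewrite lee_fin expR_ge0.
have sn0 : Num.sqrt a != 0 by rewrite gt_eqF.
rewrite (ge0_integral_affine 0 sn0 mF F0).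
have -> : (\int[@lebesgue_measure R]_x (expR (- ((Num.sqrt a * x + 0) ^+ 2 / a)))%:E =
    \int[@lebesgue_measure R]_x (gauss_fun x)%:E)%E.
  apply: eq_integral => x _; congr (expR _)%:E.
  by rewrite addr0 exprMn sqr_sqrtr ?(ltW a0)// mulrAC mulfV ?mul1r// gt_eqF.
by rewrite integralT_gauss ger0_norm ?(ltW s0)// -EFinM -sqrtrM ?(ltW a0)// mulrC.
Qed.

End total_mass.

Lemma integrable_heat_Pint (R : realType) (n m : nat) (t : R) : (0 < n)%N -> 0 < t ->
  (lebesgue_tuple (n.*2 + m)).-integrable setT (fun v =>
    (Pint n (SCst 1, SCst 0) t (xpart (rV_of_tuple v)) (zpart (rV_of_tuple v)))%:E).
Proof.
move=> n_gt0 t0.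
have [C C0 hC] := @Pint_le_jprod R n.*2 m n n_gt0 (SCst 1, SCst 0) t t0.
apply: (@integrable_le_jprod _ _ _ C); last by move=> w; exact: hC.
apply: measurable_Pint => i.
  rewrite (_ : (fun y => _) = fun y => rV_of_tuple y 0 (lshift m i)).
    exact: measurable_coord.
  by apply/funext => y; rewrite !mxE.
rewrite (_ : (fun y => _) = fun y => rV_of_tuple y 0 (rshift n.*2 i)).
  exact: measurable_coord.
by apply/funext => y; rewrite !mxE.
Qed.

(** Inversion in z leaves a Gaussian in 2n variables, whose integral sqrt (4 pi t)^(2n) cancels (4
    pi t)^-n. *)
Lemma integral_heat_Pint (R : realType) (n m : nat) (t : R) : (0 < n)%N -> 0 < t ->
  (\int[lebesgue_tuple (n.*2 + m)]_v
    (Pint n (SCst 1, SCst 0) t (xpart (rV_of_tuple v)) (zpart (rV_of_tuple v)))%:E =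
   ((2 * pi) ^+ m)%:E)%E.
Proof.
move=> n_gt0 t0; pose P x z : R := Pint n (@SCst R n.*2 m 1, SCst 0) t x z.
have [C C0 hC] := @Pint_le_jprod R n.*2 m n n_gt0 (SCst 1, SCst 0) t t0.
have iP := integrable_heat_Pint m n_gt0 t0.
rewrite (integral_tuple_cat iP).
have iPx x : (lebesgue_tuple m).-integrable setT (fun w => (P x (rV_of_tuple w))%:E).
  apply: (@integrable_le_jprod _ _ _ C) => [|w].
    by apply: measurable_Pint => // j; exact: measurable_coord.
  apply: (@le_trans _ _ (C * jprod (row_mx x (rV_of_tuple w)))).
    by have := hC (row_mx x (rV_of_tuple w)); rewrite row_mxKl row_mxKr.
  rewrite ler_wpM2l// jprod_row_mx ler_piMl ?jprod_ge0//; exact: jprod_le1.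
have xcat u w : xpart (rV_of_tuple (tuple_cat (u, w))) = rV_of_tuple u :> 'rV[R]_n.*2.
  by apply/rowP => i; rewrite !mxE tnth_lshift.
have zcat u w : zpart (rV_of_tuple (tuple_cat (u, w))) = rV_of_tuple w :> 'rV[R]_m.
  by apply/rowP => i; rewrite !mxE tnth_rshift.
have p0 : 0 < 4 * t :> R by rewrite mulr_gt0.
pose k (x : R) := expR (- (x ^+ 2 / (4 * t))).
have mk : measurable_fun [set: measurableTypeR R] k.
  apply: continuous_measurable_fun => x.
  apply: continuous_cvg; first exact: continuous_expR.
  by apply: cvgN; apply: cvgM; [exact: exprn_continuous|exact: cvg_cst].
have kE (u : (n.*2).-tuple R) : \prod_i k (tnth u i) =
    expR (- (dotv (rV_of_tuple u) (rV_of_tuple u) / (4 * t))).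
  rewrite /dotv mulr_suml -sumrN expR_sum; apply: eq_bigr => i _.
  by rewrite mxE /k expr2.
have mkp : measurable_fun setT (fun u : (n.*2).-tuple R => \prod_i k (tnth u i)).
  apply: measurable_prod => i _.
  exact: (measurableT_comp mk (measurable_tnth i)).
transitivity (\int[lebesgue_tuple n.*2]_u
    (((2 * pi) ^+ m * ((4 * pi * t)^-1) ^+ n)%:E * (\prod_i k (tnth u i))%:E))%E.
  apply: eq_integral => u _.
  transitivity (\int[lebesgue_tuple m]_w (P (rV_of_tuple u) (rV_of_tuple w))%:E)%E.
    by apply: eq_integral => w _; rewrite xcat zcat.
  rewrite -[LHS]fineK; last exact: (integrable_fin_num measurableT (iPx _)).
  rewrite -/(Rintegral _ _ _) Rintegral_Pint// weight0 -EFinM; congr EFin.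
  rewrite -[RHS]mulrA; congr (_ * _); rewrite [RHS]mulrC; congr (_ * _).
  by rewrite kE.
have X0 : 0 <= (2 * pi) ^+ m * ((4 * pi * t)^-1) ^+ n :> R.
  by rewrite mulr_ge0 ?exprn_ge0// ?invr_ge0 ?mulr_ge0 ?pi_ge0// ltW.
rewrite ge0_integralZl//; last 2 first.
- exact/measurable_EFinP.
- by move=> u _; rewrite lee_fin prodr_ge0// => i _; exact: expR_ge0.
rewrite (integral_tuple_prod _ mk (fun x => expR_ge0 _) (integral_gauss_scaled p0)).
have s0 : 0 <= pi * (4 * t) by rewrite mulr_ge0 ?pi_ge0// ltW.
rewrite -mul2n exprM (sqr_sqrtr s0) -EFinM -[X in X%:E = _]mulrA -exprMn.
have -> : (4 * pi * t)^-1 * (pi * (4 * t)) = 1.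
  have := pi_gt0 R; move: (pi : R) => q q0.
  by rewrite (_ : q * (4 * t) = 4 * q * t); [rewrite mulVf// !mulf_neq0 ?gt_eqF|ring].
by rewrite expr1n mulr1.
Qed.

(** * The six properties of the heat kernel *)

Section heat_kernel_properties.
Context {R : realType} {n m : nat}.
Hypotheses (n_gt0 : (0 < n)%N) (m_gt0 : (0 < m)%N).
Local Notation G := 'rV[R]_(n.*2 + m).
Local Notation p := (@heat_kernel R n m).
Local Notation q_heat := (@SCst R n.*2 m ((2 * pi) ^- m), @SCst R n.*2 m 0).

Lemma heat_kernel_Pint t (g : G) : 0 < t ->
  p t g = (2 * pi) ^- m * Pint n qcos t (xpart g) (zpart g).
Proof. by move=> t0; rewrite /heat_kernel; have [_ ->] := heat_kernelE n_gt0 m_gt0 g t0. Qed.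

Lemma heat_kernel_Pg t : 0 < t -> p t = Pg q_heat t.
Proof.
move=> t0; apply/funext => g; rewrite heat_kernel_Pint//.
rewrite -(@PintZ _ _ _ _ n_gt0 (SCst ((2 * pi) ^- m)))//.
by apply: PintE => l; rewrite /integrand/= mulr1 mulr0.
Qed.

Lemma derive1_heat_kernel t (g : G) : 0 < t ->
  derive1 (fun s => p s g) t = Pg (Spar n 1 0 0 q_heat) t g.
Proof.
move=> t0; rewrite derive1E (@near_eq_derive _ _ _ _ (fun s => Pg q_heat s g)).
  have d : is_derive t 1 (fun s => Pg q_heat s g) (Pg (Spar n 1 0 0 q_heat) t g).
    apply: is_derive_line.
    have d0 := is_derive_Pint n_gt0 q_heat 1 (xpart g) 0 (zpart g) 0 t0.
    have E : (fun h => Pint n q_heat (t + h * 1) (xpart g + h *: 0) (zpart g + h *: 0)) =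
        fun h => Pg q_heat (t + h *: 1) g.
      by apply/funext => h; rewrite !scaler0 !addr0.
    by rewrite E in d0.
  by have [] := d.
by near=> s; rewrite heat_kernel_Pg//; near: s; exact: lt_nbhsr.
Unshelve. all: by end_near. Qed.

Section heat_equation.
Variable br : {bilinear G -> G -> G}.
Hypothesis hbr : is_Htype_realization br.

Lemma sublaplacian_heat_kernel t (g : G) : 0 < t ->
  sublaplacian br (p t) g = derive1 (fun s => p s g) t.
Proof.
move=> t0; rewrite derive1_heat_kernel// -(heat_equation_Pg n_gt0 hbr)//.
rewrite /sublaplacian; apply: eq_bigr => i _; rewrite heat_kernel_Pg//.
have -> : Xfield br i (Pg q_heat t) = Pg (XP br i q_heat) t.
  by apply/funext => g'; exact: Xfield_Pg.
exact: Xfield_Pg.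
Qed.

End heat_equation.

Lemma smooth_heat_kernel :
  smooth_on [set v : 'rV[R]_(1 + (n.*2 + m)) | 0 < lsubmx v 0 0]
    (fun v => p (lsubmx v 0 0) (rsubmx v)).
Proof.
move=> s v /= v0.
apply: (@smooth_Pint _ _ _ _ n_gt0 _ (fun v => lsubmx v 0 0) (fun v => lsubmx v 0 0)
   (fun v => xpart (rsubmx v)) (fun v => zpart (rsubmx v)) _ _ _ _ _ _ _ q_heat) => //.
- by move=> w u h; rewrite !mxE.
- by move=> w u h; apply/rowP => i; rewrite !mxE.
- by move=> w u h; apply/rowP => i; rewrite !mxE.
- move=> w; rewrite (_ : (fun v => _) = fun v : 'rV_(1 + _) => v 0 (lshift _ 0)).
    exact: coord_continuous.
  by apply/funext => u; rewrite !mxE.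
- move=> i w; rewrite (_ : (fun v => _) = fun v : 'rV_(1 + _) => v 0 (rshift 1 (lshift m i))).
    exact: coord_continuous.
  by apply/funext => u; rewrite !mxE.
- move=> i w; rewrite (_ : (fun v => _) = fun v : 'rV_(1 + _) => v 0 (rshift 1 (rshift n.*2 i))).
    exact: coord_continuous.
  by apply/funext => u; rewrite !mxE.
- by move=> w w0; rewrite heat_kernel_Pg.
Qed.

Lemma schwartz_heat_kernel t : 0 < t -> schwartz (p t).
Proof.
move=> t0.
have tE (v u : G) (h : R) : t = t + h * 0 by rewrite mulr0 addr0.
have xE (v u : G) h : xpart (v + h *: u) = xpart v + h *: xpart u.
  by apply/rowP => i; rewrite !mxE.
have zE (v u : G) h : zpart (v + h *: u) = zpart v + h *: zpart u.
  by apply/rowP => i; rewrite !mxE.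
have ct : continuous (fun _ : G => t) by exact: cst_continuous.
have FE (v : G) : 0 < t -> p t v = Pint n q_heat t (xpart v) (zpart v).
  by move=> _; rewrite heat_kernel_Pg.
split=> [s v _|a s].
  apply: (@smooth_Pint _ _ _ _ n_gt0 _ (fun=> t) (fun=> 0) xpart zpart tE xE zE ct _ _ _ _ FE) => //.
    move=> i w; rewrite (_ : (fun v => _) = fun v : G => v 0 (lshift m i)).
      exact: coord_continuous.
    by apply/funext => u; rewrite !mxE.
  move=> i w; rewrite (_ : (fun v => _) = fun v : G => v 0 (rshift n.*2 i)).
    exact: coord_continuous.
  by apply/funext => u; rewrite !mxE.
have [q' E] := @partials_Pint _ _ _ _ n_gt0 _ (fun=> t) (fun=> 0) xpart zpart tE xE zE ct _ _ FE s.
have mM : multiplier n (fun g : G => \prod_i g 0 i ^+ a i).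
  by apply: multiplier_prod => // i; apply: multiplier_exp => //; exact: multiplier_coord.
have [C C0 hC] := multiplier_bound n_gt0 q' mM t0 (lexx t).
by exists C => v; rewrite E//; apply: hC; rewrite !lexx.
Qed.

Lemma integral_heat_kernel t : 0 < t ->
  (\int[lebesgue_tuple (n.*2 + m)]_v (p t (rV_of_tuple v))%:E = 1%:E)%E.
Proof.
move=> t0; have P0 : (2 * pi) ^+ m != 0 :> R.
  by rewrite expf_neq0// mulf_neq0// gt_eqF// pi_gt0.
have iP := integral_heat_Pint m n_gt0 t0.
have X0 : 0 <= (2 * pi) ^- m :> R by rewrite invr_ge0 exprn_ge0// mulr_ge0 ?pi_ge0.
under eq_integral do rewrite heat_kernel_Pint// EFinM.
rewrite integralZl//; last exact: integrable_heat_Pint.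
by rewrite iP -EFinM mulVf.
Qed.

Lemma heat_kernel_dil a t (g : G) : 0 < a -> 0 < t ->
  p t g = a ^+ (2 * (n + m)) * p (a ^+ 2 * t) (dil a g).
Proof.
move=> a0 t0; rewrite !heat_kernel_Pint ?mulr_gt0 ?exprn_gt0//.
by rewrite /dil /xpart /zpart row_mxKl row_mxKr (Pint_scale n_gt0 _ _ a0 t0) mulrCA.
Qed.

(** In z this is rotation invariance of the integral; in x it already holds for the integrand, as
    the weight sees x through |x|^2. *)
Lemma radial_heat_kernel t : 0 < t -> radial (p t).
Proof.
move=> t0 g g' ex ez.
have sq (d : nat) (u v : 'rV[R]_d) : enorm u = enorm v -> dotv u u = dotv v v.
  by rewrite -!sqr_enorm => ->.
have E : Pint n qcos t (xpart g) (zpart g) = Pint n qcos t (xpart g') (zpart g').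
  rewrite (Pint_radial_z n_gt0 _ t0 (sq _ _ _ ez)); apply: eq_Rintegral => w _.
  by rewrite /integrand/= (weight_radial t (sq _ _ _ ex) (erefl (dotv _ _))).
by rewrite (heat_kernel_Pint g t0) (heat_kernel_Pint g' t0) E.
Qed.

Lemma radial_hinv (f : G -> R) : radial f -> forall g, f (hinv g) = f g.
Proof.
move=> rf g; apply: rf; rewrite /hinv /xpart /zpart ?row_mxKl ?row_mxKr /enorm.
  by congr Num.sqrt; apply: eq_bigr => i _; rewrite !mxE mulrNN.
by congr Num.sqrt; apply: eq_bigr => i _; rewrite !mxE mulrNN.
Qed.

Lemma radial_derive1_heat_kernel t : 0 < t -> radial (fun g => derive1 (fun s => p s g) t).
Proof.
move=> t0 g g' ex ez; rewrite !derive1E; apply: near_eq_derive.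
by near=> s; apply: radial_heat_kernel => //; near: s; exact: lt_nbhsr.
Unshelve. all: by end_near. Qed.

(* comparable with |x_i|^2, resp. |z_j|: homogeneous of degree 2 under dil *)
Definition coord_gauge (g : G) (i : 'I_(n.*2 + m)) : R :=
  match fintype.split i with inl _ => `|g 0 i| ^+ 2 | inr _ => `|g 0 i| end.

Lemma coord_gauge_dil a g i : 0 < a -> coord_gauge (dil a g) i = a ^+ 2 * coord_gauge g i.
Proof.
move=> a0; rewrite /coord_gauge; case: (split_ordP i) => j ->; rewrite /dil.
  by rewrite row_mxEl !mxE normrM exprMn (gtr0_norm a0).
by rewrite row_mxEr !mxE normrM (@gtr0_norm _ (_ ^+ 2)) ?exprn_gt0.
Qed.

Lemma coord_gauge_ge0 g i : 0 <= coord_gauge g i.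
Proof. by rewrite /coord_gauge; case: fintype.split => _; rewrite ?exprn_ge0. Qed.

(** Scaling by a = t^(-1/2) reduces to time 1: the kernel contributes t^-(n+m), the gauge t^(n+m+k).
    The case k = 1 gives the limit at t = 0, the case k = 0 a bound uniform in t. *)
Lemma heat_kernel_decay k : exists2 C, 0 <= C & forall t (g : G) i, 0 < t ->
  `|p t g| * coord_gauge g i ^+ (n + m + k) <= C * t ^+ k.
Proof.
have /choice[C hC] : forall i : 'I_(n.*2 + m), exists C, 0 <= C /\ forall g : G,
    `|p 1 g| * coord_gauge g i ^+ (n + m + k) <= C.
  move=> i; pose b := if fintype.split i is inl _ then 2%N else 1%N.
  have gE (g : G) : coord_gauge g i = `|g 0 i| ^+ b.
    by rewrite /coord_gauge /b; case: (fintype.split i).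
  have mM : multiplier n (fun g : G => g 0 i ^+ (b * (n + m + k))).
    exact/multiplier_exp/multiplier_coord.
  have [C C0 h] := multiplier_bound n_gt0 q_heat mM ltr01 (lexx 1).
  exists C; split=> // g; rewrite gE -exprM -normrX -normrM mulrC heat_kernel_Pg//.
  by apply: h; rewrite !lexx.
exists (\sum_i C i) => [|t g i t0]; first by apply: sumr_ge0 => i _; have [] := hC i.
pose a := (Num.sqrt t)^-1; have a0 : 0 < a by rewrite invr_gt0 sqrtr_gt0.
have a2 : a ^+ 2 = t^-1 by rewrite exprVn sqr_sqrtr// ltW.
have tn0 : t != 0 by rewrite gt_eqF.
rewrite (heat_kernel_dil g a0 t0) a2 mulVf// exprM a2.
have gE : coord_gauge g i = t * coord_gauge (dil a g) i.
  by rewrite coord_gauge_dil// a2 mulVKf.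
rewrite gE normrM ger0_norm ?exprn_ge0 ?invr_ge0 ?(ltW t0)//.
have tt : t^-1 ^+ (n + m) * t ^+ (n + m) = 1 by rewrite -exprMn mulVf// expr1n.
rewrite exprMn (exprD t (n + m) k).
have -> : t^-1 ^+ (n + m) * `|p 1 (dil a g)| *
    (t ^+ (n + m) * t ^+ k * coord_gauge (dil a g) i ^+ (n + m + k)) =
  (`|p 1 (dil a g)| * coord_gauge (dil a g) i ^+ (n + m + k)) * t ^+ k.
  rewrite -[RHS]mul1r -tt; move: (coord_gauge _ _ ^+ _) (t^-1 ^+ _) (t ^+ (n + m)) => x y z.
  by ring.
rewrite ler_wpM2r ?exprn_ge0 ?(ltW t0)//.
have [_ h] := hC i; apply: (le_trans (h _)).
by rewrite (bigD1 i)//= lerDl sumr_ge0// => j _; have [] := hC j.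
Qed.

Lemma heat_kernel_cvg0 (g : G) : g != 0 -> p t g @[t --> 0^'+] --> (0 : R).
Proof.
move=> g0; have [i gi] : exists i, 0 < coord_gauge g i.
  have /rV0Pn[i gi] := g0; exists i.
  by rewrite /coord_gauge; case: fintype.split => _; rewrite ?exprn_gt0 ?normr_gt0.
have [C C0 hC] := heat_kernel_decay 1.
pose D := C / coord_gauge g i ^+ (n + m + 1).
have D0 : 0 <= D by rewrite divr_ge0 ?exprn_ge0 ?coord_gauge_ge0.
have cD : D * t @[t --> 0^'+] --> (0 : R).
  rewrite -[X in _ --> X](mulr0 D); apply: cvgM; first exact: cvg_cst.
  by apply: cvg_at_right_filter; exact: cvg_id.
have cN : - (D * t) @[t --> 0^'+] --> (0 : R).
  by rewrite -[X in _ --> X]oppr0; exact: cvgN.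
apply: (squeeze_cvgr _ cN cD); near=> t.
have t0 : 0 < t by near: t; exact: nbhs_right_gt.
rewrite -ler_norml /D mulrAC ler_pdivlMr ?exprn_gt0//.
by have := hC t g i t0; rewrite expr1.
Unshelve. all: by end_near. Qed.

Lemma heat_kernel_vanishes_at_infinity (e : R) : 0 < e -> exists K : set G, compact K /\
  (ereal_sup [set (`|p t g|%R)%:E | t in [set t : R | (0 < t)%R] & g in ~` K] < e%:E)%E.
Proof.
move=> e0; have [C C0 hC] := heat_kernel_decay 0.
(* K is the box of half-side M. Outside it some gauge is at least M, as M >= 1, and so is its power
   n + m; then M >= 2 C / e makes the kernel at most e/2, which keeps the supremum strictly below
   e. *)
pose M := Num.max 1 (2 * C / e).
have M1 : 1 <= M by rewrite le_max lexx.
have MC : 2 * C / e <= M by rewrite le_max lexx orbT.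
exists [set v : G | forall i, `[- M, M]%classic (v ord0 i)]; split.
  exact: (@rV_compact R _ (fun=> `[- M, M]%classic) (fun=> @segment_compact _ (- M) M)).
apply: (@le_lt_trans _ _ (e / 2)%:E); last by rewrite lte_fin; lra.
apply: ge_ereal_sup => _ [t /= t0] [g gK <-]; rewrite lee_fin.
have [i Mi] : exists i, M < `|g 0 i|.
  apply: contra_notP gK => h i; rewrite /= in_itv/= -ler_norml.
  by rewrite leNgt; apply/negP => Mi; apply: h; exists i.
have Mg : M <= coord_gauge g i.
  rewrite /coord_gauge; case: fintype.split => _; last exact: ltW.
  by rewrite (le_trans (ltW Mi))// expr2 ler_peMr// (le_trans M1)// ltW.
have := hC t g i t0; rewrite expr0 mulr1 addn0 => h.
have Mk : M <= coord_gauge g i ^+ (n + m).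
  apply: (le_trans Mg); rewrite -[leLHS]expr1 ler_weXn2l//.
    exact: le_trans Mg.
  by rewrite addn_gt0 n_gt0.
have : `|p t g| * M <= C by apply: le_trans h; rewrite ler_wpM2l.
move: MC; rewrite ler_pdivrMr// => MC h2.
have := normr_ge0 (p t g); move: (`|p t g|) h2 MC M1 => P; clear -e0 C0; nra.
Qed.

End heat_kernel_properties.

Theorem mainTheorem8 (R : realType) (n m : nat) (hn : (0 < n)%N)
    (hm : (0 < m)%N)
    (br : {bilinear 'rV[R]_(n.*2 + m) -> 'rV[R]_(n.*2 + m) ->
                    'rV[R]_(n.*2 + m)})
    (hbr : is_Htype_realization br) :
  let G := 'rV[R]_(n.*2 + m) in
  let p : R -> G -> R := heat_kernel in
  let L : (G -> R) -> G -> R := sublaplacian br in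
  let dt : R -> G -> R := fun t g => derive1 (fun s => p s g) t in
  (* the integral converges absolutely and is real *)
  (forall (t : R) (g : G), 0 < t ->
     cintegrable (heat_integrand t g) /\
     heat_kernelC t g = ((p t g)%:C)%C) /\
  (smooth_on [set v : 'rV[R]_(1 + (n.*2 + m)) | 0 < lsubmx v 0 0]
     (fun v => p (lsubmx v 0 0) (rsubmx v)) /\
   forall t : R, 0 < t -> schwartz (p t)) /\
  (forall (t : R) (g : G), 0 < t -> L (p t) g - dt t g = 0) /\
  (forall t : R, 0 < t ->
     (\int[lebesgue_tuple (n.*2 + m)]_v (p t (rV_of_tuple v))%:E = 1%:E)%E) /\
  ((forall (a t : R) (g : G), 0 < a -> 0 < t ->
      p t g = a ^+ (2 * (n + m)) * p (a ^+ 2 * t) (dil a g)) /\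
   forall g : G, g != 0 -> p t g @[t --> 0^'+] --> (0 : R)) /\
  (forall t : R, 0 < t ->
     [/\ radial (p t),
         radial (dt t) /\ dt t = L (p t),
         forall g : G, p t (hinv g) = p t g &
         forall g : G, L (p t) (hinv g) = L (p t) g]) /\
  (forall e : R, 0 < e -> exists K : set G, compact K /\
     (ereal_sup [set (`|p t g|%R)%:E | t in [set t : R | (0 < t)%R] & g in ~` K]
        < e%:E)%E).
Proof.
move=> G p L dt; split=> [t g t0|].
  have [ic E] := heat_kernelE hn hm g t0; split=> //.
  by rewrite E /p heat_kernel_Pint.
have dtL t : 0 < t -> dt t = L (p t).
  by move=> t0; apply/funext => g; rewrite /L sublaplacian_heat_kernel.
split; first by split; [exact: smooth_heat_kernel|exact: schwartz_heat_kernel].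
split=> [t g t0|]; first by rewrite dtL// subrr.
split; first exact: integral_heat_kernel.
split; first by split; [exact: heat_kernel_dil|exact: heat_kernel_cvg0].
split=> [t t0|]; last exact: heat_kernel_vanishes_at_infinity.
have rdt := radial_derive1_heat_kernel hn hm t0.
split; first exact: radial_heat_kernel.
- by split=> //; exact: dtL.
- exact/radial_hinv/radial_heat_kernel.
- exact: (eq_ind (dt t) (fun f => forall g, f (hinv g) = f g) (radial_hinv rdt) _ (dtL t t0)).
Qed.
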